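(* Let $\xi$ be a non-negative integer-valued random variable with $\mathbb{E}\xi=1$ and $0<\mathrm{Var}(\xi)<\infty$, let $\mathcal{T}$ be the Galton-Watson tree with offspring distribution $\xi$, and let $\mathcal{T}_n$ be $\mathcal{T}$ conditioned on $|\mathcal{T}|=n$. For a plane tree $T$ let $\pi(T):=\mathbb{P}(\mathcal{T}=T)$ and let $N_T(\mathcal{T}_n)$ be the number of nodes $v$ of $\mathcal{T}_n$ with $\mathcal{T}_{n,v}=T$. Let $k_n$ be positive integers with $k_n\to\infty$ and $k_n=o(n)$. Then $$\lim_{n\to\infty}\ \sup_{T:|T|=k_n} d_{TV}\big(N_T(\mathcal{T}_n),\mathrm{Po}(n\pi(T))\big)=0.$$ Therefore, for any sequence of plane trees $T_n$ with $|T_n|=k_n$, as $n\to\infty$: (i) if $n\pi(T_n)\to 0$, then $N_{T_n}(\mathcal{T}_n)=0$ with high probability; (ii) if $n\pi(T_n)\to\mu\in(0,\infty)$, then $N_{T_n}(\mathcal{T}_n)$ converges in distribution to $\mathrm{Po}(\mu)$; (iii) if $n\pi(T_n)\to\infty$, then $\dfrac{N_{T_n}(\mathcal{T}_n)-n\pi(T_n)}{\sqrt{n\pi(T_n)}}$ converges in distribution to the standard normal distribution $N(0,1)$.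
   Context: A plane tree is a finite rooted, ordered, unlabeled tree; $|T|$ is its number of nodes. For a node $v$ of $T$, the fringe subtree $T_v$ is the subtree consisting of $v$ and all its descendants; equality of trees means isomorphism as plane trees. $\mathcal{T}_{n,v}$ is the fringe subtree of $\mathcal{T}_n$ at $v$. The Galton-Watson tree $\mathcal{T}$ is generated from the root by giving each node independently a number of children distributed as $\xi$. Let $p_i=\mathbb{P}(\xi=i)$ and let $h=\gcd\{i\ge1:p_i>0\}$ be the span. Then $\mathbb{P}(|\mathcal{T}|=n)>0$ for all large $n$ with $n\equiv1\pmod h$; all limits as $n\to\infty$ are taken along such $n$. $\mathrm{Po}(\lambda)$ is a Poisson random variable with mean $\lambda$ ($\mathrm{Po}(0)=0$), $d_{TV}$ is total variation distance between laws, $d_{TV}(X,Y)=\sup_A|\mathbb{P}(X\in A)-\mathbb{P}(Y\in A)|$. ''With high probability'' means with probability tending to $1$ as $n\to\infty$. *)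

(* Defs.v *)
From HB Require Import structures.
From mathcomp Require Import all_boot all_order all_algebra.
From mathcomp Require Import all_classical all_reals all_analysis.

Set Implicit Arguments.
Unset Strict Implicit.
Unset Printing Implicit Defensive.

Import Order.TTheory GRing.Theory Num.Theory.
Import numFieldNormedType.Exports.

Local Open Scope classical_set_scope.
Local Open Scope ring_scope.

Unset Elimination Schemes.
Inductive plane_tree : Type := Node of seq plane_tree.
Set Elimination Schemes.

Fixpoint plane_tree_ind (P : plane_tree -> Prop)
    (IH : forall ts, foldr (fun t => and (P t)) True ts -> P (Node ts))
    (t : plane_tree) : P t :=
  let: Node ts := t in
  IH ts ((fix loop ts := if ts is t :: ts'
                         return foldr (fun t => and (P t)) True ts
                         then conj (plane_tree_ind IH t) (loop ts') else I) ts).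

Fixpoint gentree_of (t : plane_tree) : GenTree.tree void :=
  let: Node ts := t in GenTree.Node 0 (map gentree_of ts).

Fixpoint plane_tree_of (t : GenTree.tree void) : plane_tree :=
  match t with
  | GenTree.Leaf x => match x with end
  | GenTree.Node _ ts => Node (map plane_tree_of ts)
  end.

Lemma gentree_ofK : cancel gentree_of plane_tree_of.
Proof.
elim=> ts /= IH; congr Node; elim: ts IH => //= t ts IHts [-> /IHts ->] //.
Qed.

HB.instance Definition _ := Countable.copy plane_tree (can_type gentree_ofK).

(* The list of the fringe subtrees t_v, where v ranges over the nodes of t in
   depth-first order. *)
Fixpoint fringe (t : plane_tree) : seq plane_tree :=
  let: Node ts := t in t :: flatten (map fringe ts).

Definition tree_size (t : plane_tree) : nat := size (fringe t).

Definition fringe_count (T t : plane_tree) : nat := count_mem T (fringe t).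

(* Ulam-Harris words: [::] is the root and rcons v i is the i-th child of v,
   children being numbered from 0. *)
Definition word := seq nat.

Fixpoint is_node (v : word) (t : plane_tree) : bool :=
  if v is i :: u then
    let: Node ts := t in if onth ts i is Some t' then is_node u t' else false
  else true.

(* The (possibly infinite) tree grown from the root when each potential node v
   is given c v children, as a set of Ulam-Harris words. *)
Definition grown_tree (c : word -> nat) : set word :=
  [set u | forall v i, prefix (rcons v i) u -> (i < c v)%N].

Section galton_watson.
Context {R : realType} {d d' : measure_display}
  {S : measurableType d} {Omega : measurableType d'}.
Variables (Q : probability S R) (P : probability Omega R).

Definition independent_family (X : word -> {RV P >-> nat}) : Prop :=
  forall (s : seq word) (B : word -> set nat), uniq s ->
    P (\bigcap_(v in [set` s]) (X v @^-1` B v)) =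
    (\prod_(v <- s) P (X v @^-1` B v))%E.

Definition iid_copies (xi : {RV Q >-> nat}) (X : word -> {RV P >-> nat}) :
    Prop :=
  (forall v A, distribution P (X v) A = distribution Q xi A) /\
  independent_family X.

Variable X : word -> {RV P >-> nat}.

Definition gw_tree (w : Omega) : set word := grown_tree (fun v => X v w).

(* An infinite gw_tree equals no plane tree, so gw_law is the law of the
   Galton-Watson tree restricted to finite trees. *)
Definition gw_law (E : set plane_tree) : \bar R :=
  P [set w | exists2 t, E t & gw_tree w = [set v | is_node v t]].

Definition gw_pi (T : plane_tree) : R := fine (gw_law [set T]).

(* The law of the tree conditioned to have n nodes; it is identically 0 when the
   conditioning event is null. *)
Definition gw_cond_law (n : nat) (E : set plane_tree) : \bar R :=
  (gw_law ([set t | tree_size t = n] `&` E) /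
   gw_law [set t | tree_size t = n])%E.

Definition fringe_count_law (n : nat) (T : plane_tree) (A : set nat) : \bar R :=
  gw_cond_law n (fringe_count T @^-1` A).

End galton_watson.

Definition is_gcd (A : set nat) (g : nat) : Prop :=
  (forall i, A i -> g %| i)%N /\
  forall m : nat, (forall i, A i -> m %| i)%N -> (m %| g)%N.

Definition is_span {R : realType} {d} {S : measurableType d}
    {Q : probability S R} (xi : {RV Q >-> nat}) (h : nat) : Prop :=
  is_gcd [set i | (1 <= i)%N /\ (0 < distribution Q xi [set i])%E] h.

(* n tends to infinity along the residue class of 1 modulo h. *)
Definition oo_1mod (h : nat) : set_system nat :=
  within [set n | n = 1 %[mod h]%N] \oo.

Definition dTV {R : realType} {d} {S : measurableType d}
    (mu nu : set S -> \bar R) : \bar R :=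
  ereal_sup [set `|mu A - nu A|%E | A in measurable].

(* The second argument of poisson_prob is not used by the library; Po(0) is
   the Dirac mass at 0. *)
Definition Po {R : realType} (lambda : R) : set nat -> \bar R :=
  poisson_prob lambda 0.

(* Convergence in distribution of laws on R: the distribution functions
   converge at every continuity point of the limit. *)
Definition cvg_in_law {R : realType} {I : Type} (F : set_system I)
    (mu : I -> set R -> \bar R) (nu : set R -> \bar R) : Prop :=
  forall x : R, {for x, continuous (fun y : R => nu `]-oo, y]%classic)} ->
    mu i `]-oo, x]%classic @[i --> F] --> nu `]-oo, x]%classic.

(* Main.v *)
Require Import Defs.
From HB Require Import structures.
From mathcomp Require Import all_boot all_order all_algebra.
From mathcomp Require Import all_classical all_reals all_analysis.
From mathcomp Require Import measurable_realfun.
From mathcomp Require Import ring lra zify.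

Set Implicit Arguments.
Unset Strict Implicit.
Unset Printing Implicit Defensive.

Import Order.TTheory GRing.Theory Num.Theory.
Import numFieldNormedType.Exports.

Local Open Scope classical_set_scope.
Local Open Scope ring_scope.

(** The numbers of children of the nodes of a tree, in depth-first order, form a
    word with [n] letters and sum [n - 1] when the tree has [n] nodes, and fringe
    subtrees become factors of this word. By the cycle lemma exactly one rotation
    of each word of that length and sum codes a tree ([cycle_lemma]). Hence the
    number of fringe subtrees equal to [T] has the law of the number [N] of cyclic
    occurrences of the code [c] of [T] in a word of [n] independent letters with
    the offspring law, conditioned on the sum [S] of the letters being [n - 1]
    ([fringe_count_lawE]). Letters not smaller than [n] may be merged into one, so
    that all expectations are finite sums.

    The approximation by the Poisson law of mean [lam = n * gw_pi T] follows
    Stein's method. If [f] solves the Stein equation of a set, the error made on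
    this set is the conditional expectation of [lam f(N + 1) - N f(N)]. No nonempty
    proper prefix of a tree code is a suffix of it, so that occurrences do not overlap and
    an occurrence at the origin leaves a free word of [n - k] letters with sum
    [n - k], where [k] is the size of [T]: the expectation of [N f(N)] on
    [S = n - 1] is [lam] times that of [f] at one plus the number of occurrences in
    the shorter word ([occE_palm]). The [k] letters of [c] are then put back one at
    a time. By rotation invariance, prescribing a letter [a] amounts to reweighting
    the law of the word by the frequency of [a] relative to its mean
    ([iidE_remove_letter]), and on the event that the sum has a given value this
    frequency fluctuates little ([iidE_sum_freq_dev]). As [f] is of size
    [lam ^ (-1/2)] with increments at most [lam ^ (-1)], the total error is at most
    a constant times [k^2 eta + k sqrt eta], with [eta] a bound for the weight of
    [c] with one letter left out ([stein_discrepancy_le]). Every letter has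
    probability at most some [theta < 1], so this vanishes as [k] grows, uniformly
    over the trees of size [k], as long as [lam] stays away from zero; when [lam] is
    small both laws are close to the unit mass at zero ([tv_le_mean]).

    Two local estimates enter. The upper bound [C / sqrt m] for the probability
    that [m] letters have a given sum comes from telescoping along an arithmetic
    progression, each difference being a fluctuation of letter frequencies
    ([sum_pmf_le]). The lower bound [c / sqrt n] for the probability of [S = n - 1]
    comes from shorter words: near the mean of their sum there are long progressions
    of likely values, in steps of the span, and the convolution of a bounded number
    of them covers the mean ([sum_pmf_mean_ge]).

    Of the three limit laws, the first two are then statements about explicit
    Poisson probabilities. The third is the central limit theorem for the Poisson
    law of large mean ([poisson_clt]): its probabilities are compared with the
    masses that the normal law gives to the cells between consecutive standardized
    integers. *)

Lemma ler_of_addgt0 {R : realType} (x y : R) : (forall e, 0 < e -> x <= y + e) -> x <= y.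
Proof. by move/ler_addgt0Pr. Qed.

(** * Words of independent letters *)

Section IidWords.
Context {R : rcfType}.
Variables (B : nat) (q : nat -> R).
Hypothesis q_ge0 : forall a, 0 <= q a.
Hypothesis q_sum1 : \sum_(a < B.+1) q a = 1.

(** The expectation of [F] at a word of [m] independent letters of law [q] on
    [0 .. B]. *)
Fixpoint iidE (m : nat) (F : seq nat -> R) : R :=
  if m is m'.+1 then \sum_(a < B.+1) q a * iidE m' (fun x => F (nat_of_ord a :: x))
  else F [::].

Lemma eq_iidE m F G :
  (forall x, size x = m -> all (leq^~ B) x -> F x = G x) ->
  iidE m F = iidE m G.
Proof.
elim: m F G => [|m IH] F G FG /=; first exact: FG.
apply: eq_bigr => a _; congr (_ * _); apply: IH => x sx xB.
by apply: FG => /=; rewrite ?sx// -ltnS ltn_ord.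
Qed.

Lemma ler_iidE m F G :
  (forall x, size x = m -> all (leq^~ B) x -> F x <= G x) ->
  iidE m F <= iidE m G.
Proof.
elim: m F G => [|m IH] F G FG /=; first exact: FG.
apply: ler_sum => a _; rewrite ler_wpM2l//; apply: IH => x sx xB.
by apply: FG => /=; rewrite ?sx// -ltnS ltn_ord.
Qed.

Lemma iidE_cst m c : iidE m (fun=> c) = c.
Proof.
by elim: m => //= m IH; rewrite IH -mulr_suml q_sum1 mul1r.
Qed.

Lemma iidED m F G : iidE m (fun x => F x + G x) = iidE m F + iidE m G.
Proof.
elim: m F G => //= m IH F G; rewrite -big_split/=; apply: eq_bigr => a _.
by rewrite IH mulrDr.
Qed.

Lemma iidEZl m c F : iidE m (fun x => c * F x) = c * iidE m F.
Proof.
elim: m F => //= m IH F; rewrite mulr_sumr; apply: eq_bigr => a _.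
by rewrite IH mulrCA.
Qed.

Lemma iidEZr m c F : iidE m (fun x => F x * c) = iidE m F * c.
Proof.
by rewrite mulrC -iidEZl; apply: eq_iidE => x _ _; rewrite mulrC.
Qed.

Lemma iidEN m F : iidE m (fun x => - F x) = - iidE m F.
Proof.
by rewrite -mulN1r -iidEZl; apply: eq_iidE => x _ _; rewrite mulN1r.
Qed.

Lemma iidEB m F G : iidE m (fun x => F x - G x) = iidE m F - iidE m G.
Proof. by rewrite iidED iidEN. Qed.

Lemma iidE_sum (I : Type) (r : seq I) (p : pred I) m (F : I -> seq nat -> R) :
  iidE m (fun x => \sum_(i <- r | p i) F i x) =
  \sum_(i <- r | p i) iidE m (F i).
Proof.
elim: r => [|i r IH].
  by rewrite big_nil -[RHS](iidE_cst m); apply: eq_iidE => x; rewrite big_nil.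
rewrite big_cons -IH; case: ifP => pi.
  by rewrite -iidED; apply: eq_iidE => x; rewrite big_cons pi.
by apply: eq_iidE => x; rewrite big_cons pi.
Qed.

Lemma iidE_ge0 m F : (forall x, size x = m -> all (leq^~ B) x -> 0 <= F x) ->
  0 <= iidE m F.
Proof. by move=> F0; rewrite -(iidE_cst m 0); exact: ler_iidE. Qed.

Lemma iidE0 m F : (forall x, size x = m -> all (leq^~ B) x -> F x = 0) ->
  iidE m F = 0.
Proof. by move=> F0; rewrite (eq_iidE F0) iidE_cst. Qed.

Lemma normr_iidE m F : `|iidE m F| <= iidE m (fun x => `|F x|).
Proof.
rewrite ler_norml -iidEN; apply/andP; split; apply: ler_iidE => x _ _.
  by rewrite lerNl -normrN ler_norm.
exact: ler_norm.
Qed.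

Lemma iidE_cat m1 m2 F :
  iidE (m1 + m2) F = iidE m1 (fun x => iidE m2 (fun y => F (x ++ y))).
Proof.
elim: m1 F => // m1 IH F; rewrite addSn /=; apply: eq_bigr => a _.
by rewrite IH.
Qed.

Lemma iidE_exchange m1 m2 F :
  iidE m1 (fun x => iidE m2 (F x)) = iidE m2 (fun y => iidE m1 (F^~ y)).
Proof.
elim: m1 F => //= m1 IH F.
rewrite iidE_sum; apply: eq_bigr => a _.
by rewrite iidEZl -IH.
Qed.

Lemma iidE_rot i m F : iidE m (fun x => F (rot i x)) = iidE m F.
Proof.
have [im|im] := leqP i m; last first.
  by apply: eq_iidE => x sx _; rewrite rot_oversize// sx ltnW.
rewrite -{1}(subnKC im) iidE_cat iidE_exchange -[in RHS](subnK im) iidE_cat.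
apply: eq_iidE => x sx _; apply: eq_iidE => y sy _.
by rewrite -sy rot_size_cat.
Qed.

Lemma iidE_cons_le a m F : (a <= B)%N -> (forall x, 0 <= F x) ->
  q a * iidE m (fun y => F (a :: y)) <= iidE m.+1 F.
Proof.
move=> aB F0 /=; rewrite (bigD1 (Ordinal (aB : a < B.+1)%N))//= lerDl.
by apply: sumr_ge0 => i _; rewrite mulr_ge0// iidE_ge0.
Qed.

Lemma count_mem_rot (a : nat) x :
  count_mem a x = (\sum_(i < size x) (take 1 (rot i x) == [:: a]))%N.
Proof.
rewrite -sum1_count (big_nth 0%N) big_mkord big_mkcond/=.
apply: eq_bigr => i _; rewrite /rot takel_cat; last first.
  by rewrite size_drop subn_gt0.
rewrite (drop_nth 0%N)//= take0 eqseq_cons eqxx andbT.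
by case: eqP.
Qed.

(** Each of the [m + 1] positions contributes as much as the first one. *)
Lemma iidE_count_mem a m (G : seq nat -> R) : (a <= B)%N ->
  (forall i x, G (rot i x) = G x) ->
  iidE m.+1 (fun x => (count_mem a x)%:R * G x) =
  m.+1%:R * q a * iidE m (fun y => G (a :: y)).
Proof.
move=> aB Grot.
have step (i : nat) :
    iidE m.+1 (fun x => (take 1 (rot i x) == [:: a])%:R * G x) =
    q a * iidE m (fun y => G (a :: y)).
  rewrite -(@eq_iidE _ (fun x => (take 1 (rot i x) == [:: a])%:R * G (rot i x)));
    last by move=> x _ _; rewrite Grot.
  rewrite (iidE_rot i m.+1 (fun x => (take 1 x == [:: a])%:R * G x)) /=.
  rewrite (bigD1 (Ordinal (aB : a < B.+1)%N))//= big1 ?addr0 => [|b ba].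
    by congr (_ * _); apply: eq_iidE => x _ _; rewrite take0 eqxx mul1r.
  rewrite -[X in _ * X]/(iidE m _) (_ : iidE _ _ = 0) ?mulr0//.
  rewrite -[RHS](iidE_cst m); apply: eq_iidE => x _ _.
  rewrite take0 eqseq_cons eqxx andbT; case: eqP => [bE|]; last by rewrite mul0r.
  by case/eqP: ba; apply: val_inj.
transitivity (\sum_(i < m.+1)
    iidE m.+1 (fun x => (take 1 (rot i x) == [:: a])%:R * G x)).
  rewrite -iidE_sum; apply: eq_iidE => x sx _.
  by rewrite -mulr_suml count_mem_rot natr_sum sx.
under eq_bigr do rewrite step.
by rewrite sumr_const card_ord -mulrA mulr_natl.
Qed.

Definition letterE (phi : nat -> R) : R := \sum_(a < B.+1) q a * phi a.

Lemma iidE_bigsum phi m :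
  iidE m (fun x => \sum_(a <- x) phi a) = m%:R * letterE phi.
Proof.
elim: m => [|m IH]; first by rewrite /= big_nil mul0r.
transitivity (\sum_(a < B.+1) q a * (phi a + m%:R * letterE phi)).
  apply: eq_bigr => a _; congr (_ * _); rewrite -IH -[X in _ = X + _](iidE_cst m).
  by rewrite -iidED; apply: eq_iidE => x _ _; rewrite big_cons.
under eq_bigr do rewrite mulrDr.
by rewrite big_split/= -/(letterE phi) -mulr_suml q_sum1 mul1r -[m.+1]addn1 natrD mulrDl mul1r addrC.
Qed.

Lemma iidE_bigsum_sqr phi m : letterE phi = 0 ->
  iidE m (fun x => (\sum_(a <- x) phi a) ^+ 2) =
  m%:R * letterE (fun a => phi a ^+ 2).
Proof.
move=> phi0; elim: m => [|m IH]; first by rewrite /= big_nil mul0r expr0n.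
transitivity (\sum_(a < B.+1)
    q a * (phi a ^+ 2 + m%:R * letterE (fun a => phi a ^+ 2))).
  apply: eq_bigr => a _; congr (_ * _).
  rewrite -IH -[X in _ = X + _](iidE_cst m).
  transitivity (iidE m (fun x => phi a ^+ 2 + (\sum_(b <- x) phi b) ^+ 2 +
     (phi a * 2) * (\sum_(b <- x) phi b))).
    by apply: eq_iidE => x _ _; rewrite big_cons; ring.
  by rewrite !iidED iidEZl iidE_bigsum phi0 !mulr0 addr0.
under eq_bigr do rewrite mulrDr.
by rewrite big_split/= -/(letterE _) -mulr_suml q_sum1 mul1r -[m.+1]addn1 natrD mulrDl mul1r addrC.
Qed.

Lemma count_mem_bigsum (a : nat) x (c : R) :
  (count_mem a x)%:R - (size x)%:R * c = \sum_(b <- x) ((b == a)%:R - c).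
Proof.
elim: x => [|b x IH]; first by rewrite big_nil mul0r subr0.
by rewrite big_cons -IH /= natrD -[(size x).+1]add1n natrD; ring.
Qed.

Lemma letterE_eq a : (a <= B)%N -> letterE (fun b => (b == a)%:R) = q a.
Proof.
move=> aB; rewrite /letterE (bigD1 (Ordinal (aB : a < B.+1)%N))//= eqxx mulr1.
rewrite big1 ?addr0// => i /eqP ia; case: eqP; rewrite ?mulr0// => e.
by case: ia; apply: val_inj.
Qed.

Lemma iidE_count_mem_var a m : (a <= B)%N ->
  iidE m (fun x => ((count_mem a x)%:R - m%:R * q a) ^+ 2) <= m%:R * q a.
Proof.
move=> aB.
have -> : iidE m (fun x => ((count_mem a x)%:R - m%:R * q a) ^+ 2) =
  iidE m (fun x => (\sum_(b <- x) ((b == a)%:R - q a)) ^+ 2).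
  by apply: eq_iidE => x <- _; rewrite count_mem_bigsum.
have letterEB (f g : nat -> R) : letterE (fun b => f b - g b) = letterE f - letterE g.
  rewrite /letterE -sumrB; apply: eq_bigr => i _; exact: mulrBr.
have letterEc (c : R) : letterE (fun=> c) = c.
  by rewrite /letterE -mulr_suml q_sum1 mul1r.
rewrite iidE_bigsum_sqr; last by rewrite letterEB letterEc letterE_eq// subrr.
rewrite ler_wpM2l//.
rewrite (_ : letterE _ = letterE (fun b => (b == a)%:R * (1 - q a *+ 2) + q a ^+ 2)); last first.
  by apply: eq_bigr => i _; case: eqP => _ /=; ring.
have -> : letterE (fun b => (b == a)%:R * (1 - q a *+ 2) + q a ^+ 2) =
   q a * (1 - q a *+ 2) + q a ^+ 2.
  rewrite -[X in _ = _ + X]letterEc -[X in _ = X * _ + _](letterE_eq aB) /letterE mulr_suml -big_split/=.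
  by apply: eq_bigr => i _; rewrite mulrDr mulrA.
have := sqr_ge0 (q a); rewrite expr2; lra.
Qed.

Lemma iidE_norm_le_sqrt m F : iidE m (fun x => `|F x|) <= Num.sqrt (iidE m (fun x => F x ^+ 2)).
Proof.
set t := iidE m _; have t0 : 0 <= t by apply: iidE_ge0.
rewrite -(ler_sqr t0) ?nnegrE ?sqrtr_ge0// sqr_sqrtr; last first.
  by apply: iidE_ge0 => x _ _; exact: sqr_ge0.
have : 0 <= iidE m (fun x => (`|F x| - t) ^+ 2).
  by apply: iidE_ge0 => x _ _; exact: sqr_ge0.
have -> : iidE m (fun x => (`|F x| - t) ^+ 2) =
    iidE m (fun x => F x ^+ 2 - (t *+ 2) * `|F x| + t ^+ 2).
  by apply: eq_iidE => x _ _; rewrite sqrrB real_normK ?num_real//; ring.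
rewrite iidED iidEB iidE_cst iidEZl -/t.
by rewrite (_ : _ - _ + _ = iidE m (fun x => F x ^+ 2) - t ^+ 2); [lra|ring].
Qed.

Lemma iidE_count_mem_dev a m : (a <= B)%N ->
  iidE m (fun x => `|(count_mem a x)%:R - m%:R * q a|) <= Num.sqrt (m%:R * q a).
Proof.
move=> aB; apply: le_trans (iidE_norm_le_sqrt _ _) _.
by rewrite ler_wsqrtr// iidE_count_mem_var.
Qed.

End IidWords.

(** * The law of the sum of the letters *)

Section LocalBounds.
Context {R : rcfType}.
Variables (B : nat) (q : nat -> R).
Hypothesis q_ge0 : forall a, 0 <= q a.
Hypothesis q_sum1 : \sum_(a < B.+1) q a = 1.
Local Notation E := (iidE B q).

Definition sum_pmf (m s : nat) : R := E m (fun x => (sumn x == s)%:R).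

Definition freq_dev a (x : seq nat) : R :=
  (count_mem a x)%:R / ((size x)%:R * q a) - 1.

Lemma sumn_rot i (x : seq nat) : sumn (rot i x) = sumn x.
Proof. by apply/perm_sumn; rewrite perm_rot. Qed.

Lemma sum_pmf_ge0 m s : 0 <= sum_pmf m s.
Proof. by apply: iidE_ge0. Qed.

(** Prescribing one letter of a word reweights its law by the relative frequency
    of this letter. *)
Lemma iidE_remove_letter a m (G : seq nat -> R) : (a <= B)%N -> 0 < q a ->
  (forall i x, G (rot i x) = G x) ->
  E m (fun y => G (a :: y)) - E m.+1 G = E m.+1 (fun x => freq_dev a x * G x).
Proof.
move=> aB qa Grot.
have -> : E m.+1 (fun x => freq_dev a x * G x) =
    E m.+1 (fun x => (m.+1%:R * q a)^-1 * ((count_mem a x)%:R * G x) - G x).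
  apply: eq_iidE => x sx _; rewrite /freq_dev sx mulrBl mul1r; congr (_ - _).
  by rewrite [X in X * _]mulrC mulrA.
rewrite iidEB iidEZl iidE_count_mem// mulKf//.
by rewrite mulf_neq0 ?pnatr_eq0// gt_eqF.
Qed.

Lemma sqrtr_divr (x : R) : 0 < x -> Num.sqrt x / x = (Num.sqrt x)^-1.
Proof.
move=> x0; have s0 : Num.sqrt x != 0 by rewrite gt_eqF// sqrtr_gt0.
by rewrite -{2}(sqr_sqrtr (ltW x0)) expr2 invfM mulrA divff// mul1r.
Qed.

Lemma div_sqrt_le2 (c : R) (m n : nat) : 0 <= c -> (0 < m)%N -> (0 < n)%N -> (n <= 4 * m)%N ->
  c / Num.sqrt m%:R <= 2 * (c / Num.sqrt n%:R).
Proof.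
move=> c0 m0 n0 nm.
rewrite mulrCA ler_wpM2l// ler_pdivlMr ?sqrtr_gt0 ?ltr0n// mulrC ler_pdivrMr ?sqrtr_gt0 ?ltr0n//.
have -> : 2 = Num.sqrt (4 : R).
  by rewrite (_ : 4 = 2 ^+ 2) ?sqrtr_sqr ?ger0_norm// expr2; ring.
by rewrite -sqrtrM// ler_wsqrtr// -natrM ler_nat.
Qed.

Lemma freq_devE a m x : 0 < q a -> size x = m.+1 ->
  freq_dev a x = ((count_mem a x)%:R - m.+1%:R * q a) / (m.+1%:R * q a).
Proof.
move=> qa sx; rewrite /freq_dev sx mulrBl divff//.
by rewrite mulf_neq0 ?pnatr_eq0// gt_eqF.
Qed.

Lemma iidE_freq_dev a m : (a <= B)%N -> 0 < q a ->
  E m.+1 (fun x => `|freq_dev a x|) <= (Num.sqrt m.+1%:R)^-1 * (Num.sqrt (q a))^-1.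
Proof.
move=> aB qa; have mq : 0 < m.+1%:R * q a by rewrite mulr_gt0.
rewrite -invfM -sqrtrM// -sqrtr_divr//.
rewrite (@eq_iidE _ _ _ _ _
  (fun x => `|(count_mem a x)%:R - m.+1%:R * q a| / (m.+1%:R * q a))); last first.
  move=> x sx _; rewrite (freq_devE qa sx) normrM normfV.
  by rewrite (gtr0_norm mq).
by rewrite iidEZr ler_wpM2r ?invr_ge0 ?(ltW mq)// iidE_count_mem_dev.
Qed.

Lemma sum_pmf_out m s : (m * B < s)%N -> sum_pmf m s = 0.
Proof.
move=> ms; rewrite -[RHS](iidE_cst q_sum1 m); apply: eq_iidE => x sx xB.
case: eqP => // xs; suff : (sumn x <= m * B)%N by rewrite xs leqNgt ms.
rewrite -sx; elim: (x) xB => //= a y IH /andP[aB yB].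
by rewrite mulSn leq_add// IH.
Qed.

Lemma sum_indic_progr_le1 (b s I t : nat) : (0 < b)%N ->
  \sum_(i < I) (t == s + i * b)%N%:R <= 1 :> R.
Proof.
move=> b0; elim: I => [|I IH]; first by rewrite big_ord0.
rewrite big_ord_recr/=; have [tE|_] := eqVneq; last by rewrite addr0.
rewrite big1 ?add0r// => i _; rewrite tE eqn_add2l eqn_pmul2r//.
by rewrite gtn_eqF.
Qed.

(** The telescoping sum of [P(S = t) - P(S = t + b)] along an arithmetic
    progression is controlled by the fluctuations of letter frequencies. *)
Lemma sum_pmf_le b m s : (0 < b <= B)%N -> 0 < q 0%N -> 0 < q b ->
  sum_pmf m.+1 s <=
  ((Num.sqrt (q 0%N))^-1 + (Num.sqrt (q b))^-1) / Num.sqrt m.+1%:R.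
Proof.
move=> /andP[b0 bB] q0 qb.
pose I := (m.+1 * B).+1.
have tel : sum_pmf m.+1 s = \sum_(i < I)
    (sum_pmf m.+1 (s + i * b)%N - sum_pmf m.+1 (s + i.+1 * b)%N).
  rewrite -(big_mkord xpredT (fun i => sum_pmf m.+1 (s + i * b)%N -
     sum_pmf m.+1 (s + i.+1 * b)%N)).
  under eq_bigr do rewrite -opprB.
  rewrite sumrN telescope_sumr// mul0n addn0 opprB [X in _ - X]sum_pmf_out ?subr0//.
  by rewrite /I -[X in (X < _)%N]add0n -addn1 addnC; nia.
have rotS t : forall i (x : seq nat), (sumn (rot i x) == t)%:R = (sumn x == t)%:R :> R.
  by move=> i x; rewrite sumn_rot.
have e0 t : sum_pmf m t - sum_pmf m.+1 t =
    E m.+1 (fun x => freq_dev 0 x * (sumn x == t)%:R).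
  by rewrite -(@iidE_remove_letter 0 m (fun x => (sumn x == t)%:R)).
have eb t : sum_pmf m t - sum_pmf m.+1 (t + b)%N =
    E m.+1 (fun x => freq_dev b x * (sumn x == t + b)%N%:R).
  rewrite -(@iidE_remove_letter b m (fun x => (sumn x == t + b)%N%:R))//; congr (_ - _).
  by apply: eq_iidE => x _ _ /=; rewrite addnC eqn_add2r.
have step t : sum_pmf m.+1 t - sum_pmf m.+1 (t + b)%N =
    E m.+1 (fun x => freq_dev b x * (sumn x == t + b)%N%:R -
                     freq_dev 0 x * (sumn x == t)%:R).
  by rewrite iidEB -e0 -eb; ring.
rewrite tel.
under eq_bigr => i _ do rewrite mulSn (addnC b) addnA step.
rewrite -iidE_sum//.
apply: (@le_trans _ _ (E m.+1 (fun x => `|freq_dev b x| + `|freq_dev 0 x|))).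
  apply: ler_iidE => // x _ _.
  rewrite sumrB -!mulr_sumr; apply: le_trans (ler_norm _) _.
  apply: le_trans (ler_normB _ _) _; rewrite !normrM lerD//.
    rewrite ler_piMr// ger0_norm ?sumr_ge0//.
    by under eq_bigr do rewrite addnAC; exact: sum_indic_progr_le1.
  by rewrite ler_piMr// ger0_norm ?sumr_ge0// sum_indic_progr_le1.
by rewrite iidED addrC mulrDl lerD// [leRHS]mulrC; exact: iidE_freq_dev.
Qed.

Section WithConcentration.
Variable C : R.
Hypothesis sum_pmf_leC : forall m s : nat, sum_pmf m.+1 s <= C / Num.sqrt m.+1%:R.

Lemma conc_ge0 : 0 <= C.
Proof.
have := le_trans (sum_pmf_ge0 1 0) (sum_pmf_leC 0 0).
by rewrite sqrtr1 divr1.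
Qed.

Lemma iidE_joint_sum (m1 m2 s : nat) (F : seq nat -> R) : (forall x, 0 <= F x) ->
  E (m1 + m2.+1) (fun x => (sumn x == s)%:R * F (take m1 x)) <=
  C / Num.sqrt m2.+1%:R * E m1 F.
Proof.
move=> F0; rewrite iidE_cat -iidEZl; apply: ler_iidE => // x sx _.
have [xs|xs] := leqP (sumn x) s; last first.
  rewrite -[leLHS]/(iidE _ _ _ _) (_ : iidE _ _ _ _ = 0).
    by rewrite mulr_ge0// divr_ge0 ?conc_ge0// sqrtr_ge0.
  rewrite -[RHS](iidE_cst q_sum1 m2.+1); apply: eq_iidE => y _ _ /=.
  rewrite sumn_cat; case: eqP => [xys|]; last by rewrite mul0r.
  by move: xs; rewrite -xys ltnNge leq_addr.
have -> : E m2.+1 (fun y => (sumn (x ++ y) == s)%:R * F (take m1 (x ++ y))) =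
    sum_pmf m2.+1 (s - sumn x)%N * F x.
  rewrite -iidEZr; apply: eq_iidE => y _ _.
  by rewrite sumn_cat take_size_cat// -{1}(subnKC xs) eqn_add2l.
by rewrite ler_wpM2r.
Qed.

(** The local version of the frequency bound: given one half of the word, the
    other half realises a prescribed sum with probability of order at most the
    inverse square root of its length. *)
Lemma iidE_sum_freq_dev (a m s : nat) : (a <= B)%N -> 0 < q a ->
  E m.+2 (fun x => (sumn x == s)%:R * `|freq_dev a x|) <=
  (3 * C) / (m.+2%:R * Num.sqrt (q a)).
Proof.
move=> aB qa; have mq : 0 < m.+2%:R * q a by rewrite mulr_gt0.
pose m1 := (m.+2)./2.-1; pose m2 := (uphalf m.+2).-1.
have m1E : (m1.+1 + m2.+1 = m.+2)%N by rewrite /m1 /m2; lia.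
have m12 : (m1.+1 <= m2.+1)%N by rewrite /m1 /m2; lia.
have m21 : (m2.+1 <= 4 * m1.+1)%N by rewrite /m1 /m2; lia.
pose D n x : R := `|(count_mem a x)%:R - n%:R * q a|.
have D0 n x : 0 <= D n x by rewrite /D normr_ge0.
have split : E m.+2 (fun x => (sumn x == s)%:R * D m.+2 x) <=
    E m.+2 (fun x => (sumn x == s)%:R * D m1.+1 (take m1.+1 x)) +
    E m.+2 (fun x => (sumn x == s)%:R * D m2.+1 (take m2.+1 x)).
  rewrite -[X in _ <= _ + X](iidE_rot q_sum1 m1.+1) -iidED.
  apply: ler_iidE => // x sx _; rewrite sumn_rot -mulrDr ler_wpM2l//.
  have -> : take m2.+1 (rot m1.+1 x) = drop m1.+1 x.
    by rewrite /rot take_size_cat// size_drop sx -m1E addKn.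
  rewrite /D -{1}(cat_take_drop m1.+1 x) count_cat -m1E !natrD.
  by apply: le_trans (ler_normD _ _); rewrite le_eqVlt; apply/orP; left; apply/eqP; congr (`|_|); ring.
have bnd1 : E m.+2 (fun x => (sumn x == s)%:R * D m1.+1 (take m1.+1 x)) <=
    C * Num.sqrt (q a).
  rewrite -{1}m1E; apply: le_trans (iidE_joint_sum _ _ _ (D0 _)) _.
  rewrite -mulrA ler_wpM2l ?conc_ge0// ler_pdivrMl ?sqrtr_gt0//.
  apply: le_trans (iidE_count_mem_dev q_ge0 q_sum1 _ aB) _.
  rewrite sqrtrM// ler_wpM2r ?sqrtr_ge0// ler_wsqrtr// ler_nat//.
have bnd2 : E m.+2 (fun x => (sumn x == s)%:R * D m2.+1 (take m2.+1 x)) <=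
    (2 * C) * Num.sqrt (q a).
  rewrite -{1}m1E addnC; apply: le_trans (iidE_joint_sum _ _ _ (D0 _)) _.
  rewrite (mulrC 2) -!mulrA ler_wpM2l ?conc_ge0// ler_pdivrMl ?sqrtr_gt0//.
  apply: le_trans (iidE_count_mem_dev q_ge0 q_sum1 _ aB) _.
  rewrite sqrtrM// mulrA ler_wpM2r ?sqrtr_ge0//.
  have -> : 2 = Num.sqrt (4 : R).
    by rewrite (_ : 4 = 2 ^+ 2) ?sqrtr_sqr ?ger0_norm// expr2; ring.
  by rewrite -sqrtrM ?ler_wsqrtr// mulrC -natrM ler_nat.
have -> : E m.+2 (fun x => (sumn x == s)%:R * `|freq_dev a x|) =
    E m.+2 (fun x => (sumn x == s)%:R * D m.+2 x) / (m.+2%:R * q a).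
  rewrite -iidEZr; apply: eq_iidE => x sx _; rewrite (freq_devE qa sx).
  by rewrite normrM normfV (gtr0_norm mq) mulrA.
have -> : (3 * C) / (m.+2%:R * Num.sqrt (q a)) =
    (3 * C * Num.sqrt (q a)) / (m.+2%:R * q a).
  have sq0 : Num.sqrt (q a) != 0 by rewrite gt_eqF// sqrtr_gt0.
  rewrite -{3}(sqr_sqrtr (ltW qa)); field.
  by rewrite sq0 -natrD pnatr_eq0.
rewrite ler_wpM2r ?invr_ge0 ?(ltW mq)//.
by apply: le_trans split _; apply: le_trans (lerD bnd1 bnd2) _; lra.
Qed.

Lemma sum_pmf_remove_letter a m s : (a <= B)%N -> 0 < q a ->
  `|sum_pmf m.+1 s - sum_pmf m.+2 (a + s)%N| <=
  (3 * C) / (m.+2%:R * Num.sqrt (q a)).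
Proof.
move=> aB qa.
have rotS : forall i (x : seq nat), (sumn (rot i x) == a + s)%N%:R = (sumn x == a + s)%N%:R :> R.
  by move=> i x; rewrite sumn_rot.
have -> : sum_pmf m.+1 s - sum_pmf m.+2 (a + s)%N =
    E m.+2 (fun x => freq_dev a x * (sumn x == a + s)%N%:R).
  rewrite -(@iidE_remove_letter a _ (fun x => (sumn x == a + s)%N%:R))//; congr (_ - _).
  by apply: eq_iidE => x _ _ /=; rewrite eqn_add2l.
apply: le_trans; first exact: normr_iidE.
apply: le_trans (iidE_sum_freq_dev m (a + s)%N aB qa).
by apply: ler_iidE => // x _ _; rewrite normrM mulrC (ger0_norm (ler0n _ _)).
Qed.

End WithConcentration.

End LocalBounds.

(** * The Stein equation of the Poisson law *)

Section PoissonStein.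
Context {R : realType}.
Variables (lam : R) (p : nat -> R).
Hypothesis lam_gt0 : 0 < lam.
Hypothesis p_gt0 : forall k, 0 < p k.
Hypothesis p_rec : forall k, k.+1%:R * p k.+1 = lam * p k.
Hypothesis p_le1 : forall k, \sum_(i < k) p i <= 1.
Hypothesis p_to1 : forall e : R, 0 < e -> exists k, 1 - e <= \sum_(i < k) p i.
Variables (w : nat -> bool) (W : R).
Hypothesis W_ge : forall k, \sum_(i < k) (w i)%:R * p i <= W.
Hypothesis W_le : forall k,
  W - \sum_(i < k) (w i)%:R * p i <= 1 - \sum_(i < k) p i.

(** Solves [lam f(k + 1) - k f(k) = 1_A(k) - W] for [f], where [w] is the
    indicator of a set [A] of Poisson mass [W]; this mass enters through [W_ge] and
    [W_le] only, which compare it with partial sums. *)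
Definition stein_sol k : R :=
  (\sum_(i < k) (w i)%:R * p i - W * \sum_(i < k) p i) / (k%:R * p k).

Lemma stein_eq k :
  lam * stein_sol k.+1 - k%:R * stein_sol k = (w k)%:R - W.
Proof.
have pk := lt0r_neq0 (p_gt0 k); have lam0 := lt0r_neq0 lam_gt0.
have -> : lam * stein_sol k.+1 =
    (\sum_(i < k.+1) (w i)%:R * p i - W * \sum_(i < k.+1) p i) / p k.
  by rewrite /stein_sol p_rec; field; rewrite pk.
have -> : k%:R * stein_sol k =
    (\sum_(i < k) (w i)%:R * p i - W * \sum_(i < k) p i) / p k.
  case: k pk => [|k] pk; first by rewrite !big_ord0 mulr0 subr0 !mul0r.
  by rewrite /stein_sol; field; rewrite pk nat1r pnatr_eq0.
rewrite !big_ord_recr/=; field; exact: pk.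
Qed.

(** Termwise, since [lam p_i = (i + 1) p_(i + 1)]. *)
Lemma poisson_head_le k :
  lam * \sum_(i < k) p i <= k%:R * \sum_(i < k.+1) p i.
Proof.
rewrite big_ord_recl mulrDr ler_wpDl//; first by rewrite mulr_ge0// ltW.
rewrite !mulr_sumr; apply: ler_sum => i _.
rewrite -p_rec ler_wpM2r ?(ltW (p_gt0 _))//= ler_nat; exact: ltn_ord.
Qed.

Lemma big_ord_addB (n m : nat) :
  \sum_(i < n + m) p i - \sum_(i < n) p i = \sum_(i < m) p (n + i)%N.
Proof. by rewrite big_split_ord /= addrAC subrr add0r. Qed.

Lemma poisson_tail_le k :
  k%:R * (1 - \sum_(i < k.+1) p i) <= lam * (1 - \sum_(i < k) p i).
Proof.
apply: ler_of_addgt0 => e e0.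
have [N hN] := p_to1 (divr_gt0 e0 (ltr0Sn R k)).
have {}hN n : (N <= n)%N -> 1 - e / k.+1%:R <= \sum_(i < n) p i.
  move=> Nn; apply: le_trans hN _; rewrite -subr_ge0.
  rewrite (_ : _ - _ = \sum_(i < n - N) p (N + i)%N); last first.
    by rewrite -big_ord_addB subnKC.
  by rewrite sumr_ge0// => i _; exact: ltW.
have part n : k%:R * (\sum_(i < k.+1 + n) p i - \sum_(i < k.+1) p i) <=
    lam * (\sum_(i < k + n) p i - \sum_(i < k) p i).
  rewrite !big_ord_addB !mulr_sumr.
  apply: ler_sum => i _; rewrite -p_rec ler_wpM2r ?(ltW (p_gt0 _))//.
  by rewrite ler_nat; lia.
have h1 := hN (k.+1 + N)%N (leq_addl _ _).
apply: (@le_trans _ _ (k%:R * (\sum_(i < k.+1 + N) p i - \sum_(i < k.+1) p i) + e)).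
  have : k%:R * (e / k.+1%:R) <= e.
    rewrite mulrCA ler_piMr ?(ltW e0)// ler_pdivrMr ?ltr0Sn// mul1r ler_nat//.
  have : k%:R * (1 - e / k.+1%:R) <= k%:R * \sum_(i < k.+1 + N) p i.
    by rewrite ler_wpM2l.
  rewrite !mulrBr mulr1; move: (k%:R * (e / _)) (k%:R * \sum_(i < k.+1 + N) _) (k%:R * \sum_(i < k.+1) _) => x y z; lra.
rewrite lerD2r; apply: le_trans (part N) _.
by rewrite ler_pM2l// lerD2r p_le1.
Qed.

(** Let [a], [b], [g] be the masses that [A] has below, at and above [k]. The
    increment is linear in them; by the comparisons of heads and tails, [a] and [g]
    have nonpositive coefficients and [b] a nonnegative one. So its extreme values
    are taken when [A] is [{k}] or the complement of [{k}], and they are opposite. *)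
Lemma stein_sol_diff k : (0 < k)%N ->
  `|stein_sol k.+1 - stein_sol k| <= lam^-1.
Proof.
move=> k0; have pk := p_gt0 k; have kR : 0 < k%:R :> R by rewrite ltr0n.
set u := \sum_(i < k) p i; set a := \sum_(i < k) (w i)%:R * p i.
pose b := (w k)%:R * p k; pose v := 1 - u - p k; pose g := W - a - b.
have h1 := poisson_head_le k; have h2 := poisson_tail_le k.
rewrite big_ord_recr/= -/u in h1 h2.
have v0 : 0 <= v.
  by have := p_le1 k.+1; rewrite big_ord_recr/= -/u /v; lra.
have g0 : 0 <= g.
  by have := W_ge k.+1; rewrite big_ord_recr/= -/a -/b /g; lra.
have gv : g <= v.
  by have := W_le k.+1; rewrite !big_ord_recr/= -/a -/u -/b /v /g; lra.
have a0 : 0 <= a by apply: sumr_ge0 => i _; rewrite mulr_ge0// ltW.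
have au : a <= u.
  by apply: ler_sum => i _; rewrite ler_piMl ?(ltW (p_gt0 _))// lern1 leq_b1.
have b0 : 0 <= b by rewrite mulr_ge0// ltW.
have bp : b <= p k by rewrite ler_piMl ?(ltW pk)// lern1 leq_b1.
have u0 : 0 <= u by apply: le_trans au.
have -> : stein_sol k.+1 - stein_sol k =
    (a * (k%:R * v - lam * (v + p k)) + g * (lam * u - k%:R * (u + p k)) +
     b * (k%:R * v + lam * u)) / (k%:R * lam * p k).
  rewrite /stein_sol p_rec !big_ord_recr/= -/a -/u -/b.
  have -> : W = a + b + g by rewrite /g; ring.
  rewrite /v; field.
  by rewrite !gt_eqF.
rewrite normrM normfV (gtr0_norm (_ : 0 < k%:R * lam * p k)); last by rewrite !mulr_gt0.
rewrite ler_pdivrMr ?mulr_gt0//.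
have -> : lam^-1 * (k%:R * lam * p k) = k%:R * p k.
  by field; rewrite gt_eqF.
have c1 : k%:R * v - lam * (v + p k) <= 0 by rewrite /v; lra.
have c2 : lam * u - k%:R * (u + p k) <= 0 by lra.
have c3 : 0 <= k%:R * v + lam * u.
  by rewrite addr_ge0// mulr_ge0// ltW.
have c4 : k%:R * v + lam * u <= k%:R by rewrite /v; lra.
set c := k%:R * v - _ in c1 *; set d := lam * u - _ in c2 *; set e := _ + lam * u in c3 c4 *.
have E : u * c + v * d = - (p k * e) by rewrite /c /d /e; ring.
have pe : p k * e <= k%:R * p k by rewrite mulrC ler_wpM2r// ltW.
have ac0 : a * c <= 0 by rewrite mulr_ge0_le0.
have gd0 : g * d <= 0 by rewrite mulr_ge0_le0.
have be : b * e <= p k * e by rewrite ler_wpM2r.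
have be0 : 0 <= b * e by rewrite mulr_ge0.
have ac : u * c <= a * c by rewrite ler_wnM2r.
have gd : v * d <= g * d by rewrite ler_wnM2r.
by rewrite ler_norml; apply/andP; split; lra.
Qed.

Let W01 : 0 <= W <= 1.
Proof.
by have := W_ge 0; have := W_le 0; rewrite !big_ord0 !subr0 => -> ->.
Qed.

Lemma stein_sol_far k : (0 < k)%N -> `|lam - k%:R| * `|stein_sol k| <= 2.
Proof.
move=> k0; rewrite -normrM.
have -> : (lam - k%:R) * stein_sol k =
    ((w k)%:R - W) - lam * (stein_sol k.+1 - stein_sol k).
  by rewrite -stein_eq; ring.
apply: le_trans (ler_normB _ _) _; rewrite (_ : 2 = 1 + 1)// lerD//.
  have /andP[W0 W1] := W01.
  by case: (w k); rewrite ler_norml /=; apply/andP; split; lra.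
rewrite normrM (gtr0_norm lam_gt0) mulrC -ler_pdivlMr// div1r.
exact: stein_sol_diff.
Qed.

Lemma stein_sol_lipschitz j k : (0 < k)%N ->
  `|stein_sol (k + j) - stein_sol k| <= j%:R / lam.
Proof.
move=> k0; elim: j => [|j IH]; first by rewrite addn0 subrr normr0 mul0r.
rewrite addnS -(subrKA (stein_sol (k + j))); apply: le_trans (ler_normD _ _) _.
rewrite -[X in X%:R]addn1 natrD mulrDl [leRHS]addrC lerD// div1r.
by apply: stein_sol_diff; rewrite addn_gt0 k0.
Qed.

(** Away from the mean the equation itself bounds the solution; from within a
    standard deviation of the mean one walks out with increments [1 / lam]. *)
Lemma stein_sol_bound k : (0 < k)%N ->
  `|stein_sol k| <= 4 / Num.sqrt lam + lam^-1.
Proof.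
move=> k0; have s0 : 0 < Num.sqrt lam by rewrite sqrtr_gt0.
have s2 : Num.sqrt lam * Num.sqrt lam = lam by rewrite -expr2 sqr_sqrtr// ltW.
have far j : (0 < j)%N -> Num.sqrt lam <= `|lam - j%:R| ->
    `|stein_sol j| <= 2 / Num.sqrt lam.
  move=> j0 sj; rewrite ler_pdivlMr// mulrC.
  by apply: le_trans (stein_sol_far j0); rewrite ler_wpM2r.
have li : 0 < lam^-1 by rewrite invr_gt0.
have si : 0 < (Num.sqrt lam)^-1 by rewrite invr_gt0.
have [sk|sk] := leP (Num.sqrt lam) `|lam - k%:R|.
  by apply: le_trans (far _ k0 sk) _; lra.
pose j := (Num.truncn (lam + Num.sqrt lam - k%:R)).+1.
move: sk; rewrite ltr_norml => /andP[sk1 sk2].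
have pos : 0 <= lam + Num.sqrt lam - k%:R by lra.
have jlt : lam + Num.sqrt lam - k%:R < j%:R by exact: truncnS_gt.
have jle : j%:R <= lam + Num.sqrt lam - k%:R + 1.
  by rewrite /j -addn1 natrD lerD2r truncn_le.
have kj : `|stein_sol (k + j)| <= 2 / Num.sqrt lam.
  apply: far; first by rewrite addn_gt0 k0.
  by rewrite ler0_norm natrD; lra.
have := stein_sol_lipschitz j k0 => lip.
have : `|stein_sol k| <= `|stein_sol (k + j)| + `|stein_sol (k + j) - stein_sol k|.
  rewrite -[X in `|X| <= _](subKr (stein_sol (k + j))).
  exact: ler_normB.
have : j%:R / lam <= (2 * Num.sqrt lam + 1) / lam.
  by rewrite ler_wpM2r ?(ltW li)//; lra.
have -> : (2 * Num.sqrt lam + 1) / lam = 2 / Num.sqrt lam + lam^-1.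
  rewrite mulrDl div1r -{2}s2; congr (_ + _); field.
  by rewrite gt_eqF.
by lra.
Qed.

End PoissonStein.

(** * Plane trees as words *)

Fixpoint code (t : plane_tree) : seq nat :=
  let: Node ts := t in size ts :: flatten (map code ts).

(** Reading from the right, a letter [a] joins the first [a] trees of the forest
    read so far under a new root. *)
Definition parse : seq nat -> seq plane_tree :=
  foldr (fun a st => Node (take a st) :: drop a st) [::].

Definition tree0 := Node [::].

(** Every nonempty suffix has sum less than its length; these are the codes of the
    forests. *)
Fixpoint forest_word (x : seq nat) : bool :=
  if x is a :: y then (a + sumn y <= size y)%N && forest_word y else true.

Lemma foldr_andP (P : plane_tree -> Prop) (ts : seq plane_tree) :
  foldr (fun t => and (P t)) True ts <-> (forall t, t \in ts -> P t).
Proof.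
elim: ts => //= t ts ->; split => [[Pt Pts] u|Pts].
  by rewrite inE => /predU1P[->//|]; exact: Pts.
by split=> [|u uts]; apply: Pts; rewrite inE ?eqxx// uts orbT.
Qed.

Lemma parse_codes_cat_of (ts : seq plane_tree) x :
  (forall t, t \in ts -> forall x, parse (code t ++ x) = t :: parse x) ->
  parse (flatten (map code ts) ++ x) = ts ++ parse x.
Proof.
elim: ts x => //= t ts IH x Pts; rewrite -catA Pts ?inE ?eqxx//.
by rewrite IH// => u uts; apply: Pts; rewrite inE uts orbT.
Qed.

Lemma parse_code_cat t x : parse (code t ++ x) = t :: parse x.
Proof.
elim: t x => ts /foldr_andP IH x /=.
by rewrite parse_codes_cat_of// take_size_cat// drop_size_cat.
Qed.

Lemma parse_code t : parse (code t) = [:: t].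
Proof. by rewrite -[code t]cats0 parse_code_cat. Qed.

Lemma forest_word_sumn x : forest_word x -> (sumn x <= size x)%N.
Proof. by case: x => //= a y /andP[? _]; rewrite ltnW. Qed.

Lemma size_parse x : forest_word x -> size (parse x) = (size x - sumn x)%N.
Proof.
elim: x => //= a x IH /andP[ax ok]; rewrite size_drop IH//.
by have := forest_word_sumn ok; lia.
Qed.

Lemma codes_parse x : forest_word x -> flatten (map code (parse x)) = x.
Proof.
elim: x => //= a x IH /andP[ax ok].
rewrite -[in RHS](IH ok) -flatten_cat -map_cat cat_take_drop size_takel//.
rewrite size_parse//; have := forest_word_sumn ok; lia.
Qed.

Lemma codes_sum_of (ts : seq plane_tree) :
  (forall t, t \in ts -> forest_word (code t) /\ (sumn (code t)).+1 = size (code t)) ->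
  forall x, forest_word x ->
  forest_word (flatten (map code ts) ++ x) /\
  (sumn (flatten (map code ts)) + size ts)%N = size (flatten (map code ts)).
Proof.
have cat_ok (y x : seq nat) : forest_word y -> forest_word x -> forest_word (y ++ x).
  elim: y => //= a y IH /andP[ay oky] okx; rewrite IH// andbT.
  by rewrite sumn_cat size_cat; have := forest_word_sumn okx; lia.
elim: ts => //= t ts IH Pts x okx.
have [|ok1 sz1] := IH _ x okx; first by move=> u uts; apply: Pts; rewrite inE uts orbT.
have [ok2 sz2] := Pts t (mem_head _ _).
rewrite -catA; split; first exact: cat_ok.
by rewrite sumn_cat size_cat -sz1 -sz2; lia.
Qed.

Lemma forest_word_code t : forest_word (code t) /\ (sumn (code t)).+1 = size (code t).
Proof.
elim: t => ts /foldr_andP IH /=.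
have [ok sz] := codes_sum_of IH (x := [::]) isT.
rewrite cats0 in ok; rewrite ok andbT -sz addnC leqnn; split=> //.
Qed.

Lemma parse_treeP x : forest_word x -> (sumn x).+1 = size x ->
  parse x = [:: head tree0 (parse x)] /\ code (head tree0 (parse x)) = x.
Proof.
move=> ok sx; have := size_parse ok; have := codes_parse ok.
case: (parse x) => [|t [|u s]] /=; rewrite -sx; try lia.
by rewrite cats0.
Qed.

Lemma forest_word_drop i x : forest_word x -> forest_word (drop i x).
Proof. by elim: x i => [|a x IH] [|i]//= /andP[_ /IH]; exact. Qed.

Lemma forest_word_suffix y z : z <> [::] -> forest_word (y ++ z) -> (sumn z < size z)%N.
Proof.
move=> z0 /(forest_word_drop (size y)); rewrite drop_size_cat//.
by case: z z0 => //= a z _ /andP[]; rewrite ltnS.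
Qed.

Lemma forest_wordP x :
  (forall i, (i < size x)%N -> (sumn (drop i x) < size x - i)%N) -> forest_word x.
Proof.
elim: x => //= a x IH H; apply/andP; split; first by have := H 0%N isT.
by apply: IH => i ix; have := H i.+1 ix; rewrite subSS.
Qed.

(** ** Fringe subtrees and suffixes *)

(** The suffixes of the code of a forest start with the codes of its fringe
    subtrees. *)
Lemma fringe_parse x : flatten (map fringe (parse x)) =
  [seq head tree0 (parse (drop i x)) | i <- iota 0 (size x)].
Proof.
elim: x => //= a x IH; rewrite -flatten_cat -map_cat cat_take_drop IH.
by rewrite (iotaDl 1 0) -map_comp.
Qed.

Lemma fringe_code t : fringe t =
  [seq head tree0 (parse (drop i (code t))) | i <- iota 0 (size (code t))].
Proof. by rewrite -fringe_parse parse_code /= cats0. Qed.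

Lemma size_code t : size (code t) = tree_size t.
Proof. by rewrite /tree_size fringe_code size_map size_iota. Qed.

Definition cyclic_occ (c x : seq nat) : nat :=
  count (fun i => take (size c) (rot i x) == c) (iota 0 (size x)).

Definition linear_occ (c x : seq nat) : nat :=
  count (fun i => take (size c) (drop i x) == c) (iota 0 (size x)).

(** The suffix at a node continues the code of its fringe subtree, and a word
    starts with the code of at most one tree; so no occurrence of a tree code in
    another one wraps around. *)
Lemma fringe_count_code T t :
  fringe_count T t = cyclic_occ (code T) (code t).
Proof.
rewrite /fringe_count fringe_code count_map; apply: eq_in_count => i.
rewrite mem_iota /= add0n => ilt; set x := code t in ilt *.
have okx : forest_word (drop i x).
  by apply: forest_word_drop; case: (forest_word_code t).
have := codes_parse okx; case E : (parse (drop i x)) => [|u s] /=.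
  by move=> /(congr1 size); rewrite size_drop /=; lia.
move=> dx; rewrite /rot -dx -catA; apply/eqP/eqP => [->|eqT].
  by rewrite take_size_cat.
have := cat_take_drop (size (code T)) (code u ++ flatten (map code s) ++ take i x).
by rewrite eqT => /(congr1 parse); rewrite !parse_code_cat => -[].
Qed.

(** ** The code of a tree has no border *)

Section NoBorder.
Variable c : seq nat.
Hypothesis okc : forest_word c.
Hypothesis sumc : (sumn c).+1 = size c.

(** A border [a] and the complementary suffix [b] would both have sum less than
    their length, which is too small a total for the sum of [c]. *)
Lemma code_no_border a b u : a <> [::] -> b <> [::] -> c = a ++ b ->
  c = u ++ a -> False.
Proof.
move=> a0 b0 ab ua.
have := forest_word_suffix b0; have := forest_word_suffix a0.
move=> /(_ u); rewrite -ua => /(_ okc) sa /(_ a); rewrite -ab => /(_ okc) sb.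
by move: sumc; rewrite ab sumn_cat size_cat; lia.
Qed.

(** A further occurrence meeting the initial one, on either side, would produce a
    border. *)
Lemma cyclic_occ_code_cat y : cyclic_occ c (c ++ y) = (linear_occ c y).+1.
Proof.
have c0 : (0 < size c)%N by rewrite -sumc.
rewrite /cyclic_occ size_cat iotaD count_cat.
rewrite -[X in iota 0 X]prednK//= rot0 take_size_cat// eqxx add1n.
rewrite (_ : count _ (iota 1 _) = 0)%N; last first.
  apply/eqP; rewrite -leqn0 leqNgt -has_count; apply/hasPn => i.
  rewrite mem_iota => /andP[i0 ilt]; apply/eqP => ti.
  have {ilt}ilt : (i < size c)%N by lia.
  have rotE : rot i (c ++ y) = drop i c ++ (y ++ take i c).
    by rewrite /rot drop_cat ilt takel_cat ?(ltnW ilt)// catA.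
  move: ti; rewrite rotE take_cat size_drop.
  rewrite ifF; last by lia.
  move=> /esym ab; apply: (@code_no_border _ _ (take i c) _ _ ab).
  - by move=> /(congr1 size); rewrite size_drop /=; lia.
  - move=> /(congr1 size); rewrite size_take size_cat size_takel ?(ltnW ilt)//=.
    by case: ifP; lia.
  - by rewrite cat_take_drop.
rewrite add0n; congr S.
rewrite -[X in iota X _]addn0 iotaDl count_map /linear_occ; apply: eq_in_count => j.
rewrite mem_iota add0n => /andP[_ jy] /=.
have rotE : rot (size c + j) (c ++ y) = drop j y ++ (c ++ take j y).
  have F : (size c + j < size c)%N = false by lia.
  by rewrite /rot drop_cat take_cat F addKn catA.
rewrite rotE take_cat size_drop; case: ltnP => jc //.
have [->|jc'] := eqVneq (size c) (size y - j)%N.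
  by rewrite subnn take0 cats0 take_oversize// size_drop.
have {jc jc'}jc : (size y - j < size c)%N by lia.
transitivity false.
  apply/eqP; rewrite takel_cat; last by lia.
  set i := (size c - _)%N; move=> /esym ci.
  apply: (@code_no_border (take i c) (drop i c) (drop j y)) => //.
  - by move=> /(congr1 size); rewrite size_take /=; case: ifP; lia.
  - by move=> /(congr1 size); rewrite size_drop /=; lia.
  - by rewrite cat_take_drop.
apply/esym/eqP => /(congr1 size); rewrite size_take size_drop ltnNge (ltnW jc)/=.
by move=> E; rewrite E ltnn in jc.
Qed.

End NoBorder.

(** ** The cycle lemma *)

Lemma first_argmax (D : nat -> int) n :
  exists i, [/\ (i <= n)%N, forall j, (j <= n)%N -> D j <= D i &
    forall j, (j < i)%N -> D j < D i].
Proof.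
elim: n => [|n [i [iN imax ilt]]].
  by exists 0%N; split=> // j; rewrite leqn0 => /eqP->.
have [Di|Di] := ltP (D i) (D n.+1); last first.
  exists i; split=> // [|j]; first exact: leqW.
  by rewrite leq_eqVlt => /predU1P[->//|]; exact: imax.
exists n.+1; split=> // j.
  by rewrite leq_eqVlt => /predU1P[->//|/imax Dj]; exact: le_trans Dj (ltW Di).
by rewrite ltnS => /imax Dj; exact: le_lt_trans Di.
Qed.

Lemma forest_rot_exists x : (sumn x).+1 = size x ->
  exists2 i, (i < size x)%N & forest_word (rot i x).
Proof.
move=> sx; pose D i : int := i%:Z - (sumn (take i x))%:Z.
have [i [ix imax ilt]] := first_argmax D (size x).
have Dn : D (size x) = 1 by rewrite /D take_size -sx; lia.
have i0 : (0 < i)%N.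
  rewrite lt0n; apply/eqP => i0; have := imax (size x) (leqnn _).
  by rewrite Dn i0 /D take0.
suff ok : forest_word (rot i x).
  have [iE|iE] := eqVneq i (size x); last by exists i => //; lia.
  by exists 0%N; [lia | rewrite rot0 -(rot_size x) -iE].
have sumD j : (j <= size x)%N ->
    (sumn (take j x))%:Z = j%:Z - D j by move=> _; rewrite /D; lia.
have sumdrop j : (sumn (take j x) + sumn (drop j x))%N = sumn x.
  by rewrite -sumn_cat cat_take_drop.
apply: forest_wordP => j; rewrite size_rot => jx; rewrite /rot drop_cat size_drop.
case: (ltnP j (size x - i)%N) => ji.
  rewrite drop_drop sumn_cat; have := sumdrop (j + i)%N.
  have := imax (j + i)%N; have := imax (size x) (leqnn _); rewrite Dn /D; lia.
have /ilt : (j - (size x - i) < i)%N by lia.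
set l := (j - _)%N => Dl.
have : (sumn (take l x) + sumn (drop l (take i x)))%N = sumn (take i x).
  rewrite -[in RHS](cat_take_drop l (take i x)) sumn_cat take_takel//; lia.
move: Dl; rewrite /D /l; lia.
Qed.

Lemma forest_rot_unique x i j : (sumn x).+1 = size x ->
  (i < j < size x)%N -> forest_word (rot i x) -> forest_word (rot j x) -> False.
Proof.
move=> sx /andP[ij jx] oki okj; set y := rot i x in oki.
have yj : rot j x = rot (j - i) y by rewrite /y -rotD subnK//; lia.
have sy : (sumn y).+1 = size y by rewrite sumn_rot size_rot.
rewrite yj /rot in okj; rewrite -(cat_take_drop (j - i) y) in oki sy.
have ys : size y = size x by rewrite size_rot.
have d0 : drop (j - i) y <> [::] by move=> /(congr1 size); rewrite size_drop /=; lia.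
have t0 : take (j - i) y <> [::] by move=> /(congr1 size); rewrite size_take /=; case: ifP; lia.
have := forest_word_suffix d0 oki; have := forest_word_suffix t0 okj.
by move: sy; rewrite sumn_cat size_cat; lia.
Qed.

(** Exactly one rotation of a word of [n] letters with sum [n - 1] codes a tree:
    existence starts the word after the first maximum of [i |-> i - sum of the
    first i letters]; two such rotations would split the word into two
    nonempty factors, both with sum less than length. *)
Lemma cycle_lemma x : (sumn x).+1 = size x ->
  (\sum_(i < size x) forest_word (rot i x))%N = 1%N.
Proof.
move=> sx; have [i ix oki] := forest_rot_exists sx.
rewrite (bigD1 (Ordinal ix))//= oki big1 ?addn0// => j /eqP ji.
case okj : (forest_word _) => //; exfalso.
have [lt|lt|E] := ltngtP i j.
- by apply: (forest_rot_unique sx _ oki okj); rewrite lt ltn_ord.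
- by apply: (forest_rot_unique sx _ okj oki); rewrite lt ix.
- by apply: ji; apply: val_inj.
Qed.

(** * A lower bound for the point probabilities near the mean *)

Section LatticeSteps.
Context {R : rcfType}.
Variables (B : nat) (q : nat -> R).
Hypothesis q_ge0 : forall a, 0 <= q a.
Hypothesis q_sum1 : \sum_(a < B.+1) q a = 1.
Hypothesis q0_gt0 : 0 < q 0%N.
Variable C : R.
Hypothesis sum_pmf_leC : forall m s : nat,
  sum_pmf B q m.+1 s <= C / Num.sqrt m.+1%:R.

Definition step_cost (a : nat) : R :=
  3 * C * ((Num.sqrt (q 0%N))^-1 + (Num.sqrt (q a))^-1).

(** Both probabilities are compared with that of the word shortened by one letter,
    which is [0] in one case and [a] in the other. *)
Lemma sum_pmf_letter_step a m s : (a <= B)%N -> 0 < q a ->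
  `|sum_pmf B q m.+2 s - sum_pmf B q m.+2 (a + s)%N| <= step_cost a / m.+2%:R.
Proof.
move=> aB qa.
have h0 := sum_pmf_remove_letter q_ge0 q_sum1 sum_pmf_leC m s (leq0n B) q0_gt0.
have ha := sum_pmf_remove_letter q_ge0 q_sum1 sum_pmf_leC m s aB qa.
rewrite add0n in h0.
have -> : step_cost a / m.+2%:R = 3 * C / (m.+2%:R * Num.sqrt (q 0%N)) +
   3 * C / (m.+2%:R * Num.sqrt (q a)).
  by rewrite /step_cost !invfM; ring.
rewrite -(subrKA (sum_pmf B q m.+1 s)); apply: le_trans (ler_normD _ _) _.
by rewrite lerD// distrC.
Qed.

Lemma sum_pmf_letters_step (A : seq nat) m s :
  (forall a, a \in A -> (a <= B)%N && (0 < q a)) ->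
  `|sum_pmf B q m.+2 s - sum_pmf B q m.+2 (sumn A + s)%N| <=
  (\sum_(a <- A) step_cost a) / m.+2%:R.
Proof.
elim: A s => [|a A IH] s HA; first by rewrite big_nil mul0r add0n subrr normr0.
have /andP[aB qa] := HA a (mem_head _ _).
rewrite big_cons mulrDl /= -addnA.
rewrite -(subrKA (sum_pmf B q m.+2 (sumn A + s)%N)).
apply: le_trans (ler_normD _ _) _; rewrite addrC lerD//.
  exact: sum_pmf_letter_step.
by apply: IH => b bA; apply: HA; rewrite inE bA orbT.
Qed.

Lemma sum_pmf_span_step (h : nat) (A A' : seq nat) m s :
  (forall a, a \in A ++ A' -> (a <= B)%N && (0 < q a)) ->
  (h + sumn A)%N = sumn A' ->
  `|sum_pmf B q m.+2 s - sum_pmf B q m.+2 (s + h)%N| <=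
  (\sum_(a <- A ++ A') step_cost a) / m.+2%:R.
Proof.
move=> HA hA.
have h1 := @sum_pmf_letters_step A m (s + h)%N.
have h2 := @sum_pmf_letters_step A' m s.
rewrite big_cat/= mulrDl.
rewrite -(subrKA (sum_pmf B q m.+2 (sumn A' + s)%N)).
apply: le_trans (ler_normD _ _) _; rewrite addrC lerD//.
  rewrite distrC -hA (_ : (h + sumn A + s = sumn A + (s + h))%N); last by lia.
  by apply: h1 => a aA; apply: HA; rewrite mem_cat aA.
by apply: h2 => a aA; apply: HA; rewrite mem_cat aA orbT.
Qed.

End LatticeSteps.

Section Bezout.
Variables (S : nat -> Prop) (h : nat).
Hypothesis h_max : forall m : nat, (forall i, S i -> (m %| i)%N) -> (m %| h)%N.
Hypothesis S_pos : exists2 i, S i & (0 < i)%N.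

Let G g := exists A A' : seq nat,
  (forall a, a \in A ++ A' -> S a) /\ (g + sumn A)%N = sumn A'.

Lemma sumn_flatten_nseq (x : seq nat) n : sumn (flatten (nseq n x)) = (n * sumn x)%N.
Proof. by elim: n => //= n IH; rewrite sumn_cat IH mulSn. Qed.

Lemma mem_flatten_nseq (x : seq nat) n a : a \in flatten (nseq n x) -> a \in x.
Proof. by elim: n => //= n IH; rewrite mem_cat => /orP[|]. Qed.

(** The least positive difference of two sums of elements of [S] divides all
    elements of [S], as the remainders are again such differences. *)
Lemma span_combination : exists A A' : seq nat,
  (forall a, a \in A ++ A' -> S a) /\ (h + sumn A)%N = sumn A'.
Proof.
have GS i : S i -> G i.
  move=> Si; exists [::], [:: i]; split; last by rewrite /= !addn0.
  by move=> a; rewrite inE => /eqP->.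
have Gmul g n : G g -> G (n * g)%N.
  move=> [A [A' [SA gA]]]; exists (flatten (nseq n A)), (flatten (nseq n A')).
  split; last by rewrite !sumn_flatten_nseq -mulnDr gA.
  move=> a; rewrite mem_cat => /orP[] /mem_flatten_nseq aA; apply: SA.
    by rewrite mem_cat aA.
  by rewrite mem_cat aA orbT.
have Gsub g i r : G g -> S i -> (r + g = i)%N -> G r.
  move=> [A [A' [SA gA]]] Si ri; exists A', (i :: A); split=> /=; last by lia.
  move=> a; rewrite mem_cat inE orbA orbC orbA => /orP[aA|/eqP-> //].
  by apply: SA; rewrite mem_cat.
have [i0 Si0 i0_gt0] := S_pos.
have exG : exists n, `[< (0 < n)%N /\ G n >].
  by exists i0; apply/asboolP; split=> //; exact: GS.
have [g /asboolP[g0 Gg] gmin] := ex_minnP exG.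
have gdvd i : S i -> (g %| i)%N.
  move=> Si; rewrite /dvdn; apply/eqP; apply: contrapT => /eqP r0.
  have : (g <= i %% g)%N.
    apply: gmin; apply/asboolP; split; first by rewrite lt0n.
    apply: (Gsub (i %/ g * g)%N i) => //; first exact: Gmul.
    by rewrite addnC -divn_eq.
  by rewrite leqNgt ltn_pmod.
have /dvdnP[n ->] := h_max gdvd.
exact: Gmul.
Qed.

End Bezout.

Section Lumps.
Context {R : realType}.
Variables (B : nat) (q : nat -> R).
Hypothesis q_ge0 : forall a, 0 <= q a.
Hypothesis q_sum1 : \sum_(a < B.+1) q a = 1.
Local Notation E := (iidE B q).
Local Notation P := (sum_pmf B q).

Lemma natr_sumn (x : seq nat) : (sumn x)%:R = \sum_(a <- x) a%:R :> R.
Proof. by rewrite sumnE natr_sum. Qed.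

Lemma iidE_sum_mean m : E m (fun x => (sumn x)%:R) = m%:R * letterE B q (fun a => a%:R).
Proof.
by rewrite -(iidE_bigsum q_sum1); apply: eq_iidE => x _ _; rewrite natr_sumn.
Qed.

Lemma iidE_sum_var m (M := letterE B q (fun a => a%:R)) :
  E m (fun x => ((sumn x)%:R - m%:R * M) ^+ 2) <=
  m%:R * letterE B q (fun a => a%:R ^+ 2).
Proof.
have letterED (f g : nat -> R) : letterE B q (fun b => f b + g b) = letterE B q f + letterE B q g.
  rewrite /letterE -big_split; apply: eq_bigr => i _; exact: mulrDr.
have letterEc (c : R) : letterE B q (fun=> c) = c.
  by rewrite /letterE -mulr_suml q_sum1 mul1r.
have -> : E m (fun x => ((sumn x)%:R - m%:R * M) ^+ 2) =
    E m (fun x => (\sum_(a <- x) (a%:R - M)) ^+ 2).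
  apply: eq_iidE => x <- _; congr (_ ^+ 2).
  by rewrite sumrB -natr_sumn big_const_seq count_predT iter_addr_0 mulr_natl.
rewrite (iidE_bigsum_sqr q_sum1); last by rewrite letterED letterEc subrr.
rewrite ler_wpM2l//.
have -> : letterE B q (fun a => (a%:R - M) ^+ 2) =
    letterE B q (fun a => a%:R ^+ 2 + (a%:R * (- (M *+ 2)) + M ^+ 2)).
  by apply: eq_bigr => a _; congr (_ * _); ring.
rewrite !letterED letterEc.
have -> : letterE B q (fun a => a%:R * (- (M *+ 2))) = M * (- (M *+ 2)).
  by rewrite {2}/M /letterE mulr_suml; apply: eq_bigr => i _; rewrite mulrA.
have := sqr_ge0 M; rewrite expr2; lra.
Qed.

Lemma interval_prob m lo l : E m (fun x => (lo <= sumn x < lo + l)%N%:R) =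
  \sum_(i < l) P m (lo + i)%N.
Proof.
rewrite -iidE_sum//; apply: eq_iidE => x _ _.
elim: l => [|l IH]; first by rewrite big_ord0 addn0; case: ltnP => //; rewrite andbF.
rewrite big_ord_recr/= -IH -natrD; congr (_%:R); lia.
Qed.

Lemma mem_centred_interval (m s l : nat) : (m < s + l)%N -> (s < m + l)%N ->
  (m - l <= s < m - l + (l + l))%N.
Proof. by lia. Qed.

(** On either side of [m] a value of probability at least [peak / sqrt m] is found
    within [spread * sqrt m]. *)
Definition spread (C V : R) : R := 128 * C * (2 * V ^+ 2).
Definition peak (C V : R) : R := (512 * C * spread C V ^+ 2)^-1.

Lemma spread_gt0 (C V : R) : 0 < C -> 0 < V -> 0 < spread C V.
Proof.
have pos n : 0 < n.+1%:R :> R by rewrite ltr0Sn.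
move=> C0 V0; have V2 : 0 < V ^+ 2 by rewrite exprn_gt0.
exact: mulr_gt0 (mulr_gt0 (pos _) C0) (mulr_gt0 (pos _) V2).
Qed.

Lemma peak_gt0 (C V : R) : 0 < C -> 0 < V -> 0 < peak C V.
Proof.
have pos n : 0 < n.+1%:R :> R by rewrite ltr0Sn.
move=> C0 V0; have S2 : 0 < spread C V ^+ 2 by rewrite exprn_gt0// spread_gt0.
by rewrite invr_gt0; exact: mulr_gt0 (mulr_gt0 (pos _) C0) S2.
Qed.

Section Points.
Variables (C V : R) (m : nat).
Hypothesis C_ge1 : 1 <= C.
Hypothesis V_ge1 : 1 <= V.
Hypothesis sum_pmf_leC : forall m s : nat, P m.+1 s <= C / Num.sqrt m.+1%:R.
Hypothesis m_gt0 : (0 < m)%N.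
Let M := letterE B q (fun a => a%:R).
Hypothesis meanM : 0 <= m%:R * (1 - M) <= V.
Hypothesis sqrM : letterE B q (fun a => a%:R ^+ 2) <= V.
Hypothesis m_large : 32 * C * V <= Num.sqrt m%:R.
Let D : R := 2 * V ^+ 2.
Let K : R := spread C V.
Let r : R := Num.sqrt m%:R.

Let r2 : r * r = m%:R. Proof. by rewrite -expr2 sqr_sqrtr. Qed.
Let r0 : 0 < r. Proof. by rewrite sqrtr_gt0 ltr0n. Qed.
Let C_ge0 : 0 <= C. Proof. exact: le_trans C_ge1. Qed.
Let C_gt0 : 0 < C. Proof. exact: lt_le_trans C_ge1. Qed.
Let V_ge0 : 0 <= V. Proof. exact: le_trans V_ge1. Qed.
Let CV : C <= C * V. Proof. by rewrite ler_peMr. Qed.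
Let VC : V <= C * V. Proof. by rewrite ler_peMl. Qed.

Let Y (x : seq nat) : R := (sumn x)%:R - m%:R.

Lemma centred_mean : - V <= E m Y <= 0.
Proof.
rewrite iidEB iidE_cst// iidE_sum_mean -/M; move: meanM => /andP[m1 m2].
by apply/andP; split; lra.
Qed.

Lemma centred_sqr : E m (fun x => Y x ^+ 2) <= D * m%:R.
Proof.
have C1 := C_ge1; have V1 := V_ge1; have C0 := C_gt0; have rp := r0; have cv := CV; have vc := VC.
have -> : E m (fun x => Y x ^+ 2) = E m (fun x => ((sumn x)%:R - m%:R * M) ^+ 2 +
   ((((sumn x)%:R - m%:R * M) * (- (m%:R * (1 - M) *+ 2))) + (m%:R * (1 - M)) ^+ 2)).
  by apply: eq_iidE => x _ _; rewrite /Y; ring.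
rewrite iidED iidED iidEZr iidEB iidE_sum_mean !iidE_cst// -/M subrr mul0r add0r.
apply: le_trans (lerD (iidE_sum_var _) (lexx _)) _.
have m1 : 1 <= m%:R :> R by rewrite ler1n.
have h1 : m%:R * letterE B q (fun a => a%:R ^+ 2) <= m%:R * V by rewrite ler_wpM2l.
move: meanM => /andP[l1 l2].
have h2 : (m%:R * (1 - M)) ^+ 2 <= V ^+ 2 by rewrite lerXn2r// nnegrE; lra.
have h3 : m%:R * V <= V ^+ 2 * m%:R.
  by rewrite mulrC expr2 ler_wpM2r// ler_peMr//; lra.
have h4 : V ^+ 2 <= V ^+ 2 * m%:R by rewrite ler_peMr// sqr_ge0.
by rewrite /D; lra.
Qed.

(** By the upper bound on point probabilities the sum is unlikely to be within
    [r / (8 * C)] of [m]. *)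
Lemma centred_norm : r / (16 * C) <= E m (fun x => `|Y x|).
Proof.
have C1 := C_ge1; have V1 := V_ge1; have C0 := C_gt0; have rp := r0; have cv := CV; have vc := VC.
pose d : R := r / (8 * C).
have d0 : 0 < d by rewrite divr_gt0//; lra.
have near : E m (fun x => (`|Y x| < d)%R%:R) <= 2^-1.
  pose l := (Num.truncn d).+1.
  apply: (@le_trans _ _ (E m (fun x => (m - l <= sumn x < m - l + (l + l))%N%:R))).
    apply: ler_iidE => // x _ _; rewrite ler_nat; case: ltP => // Yd.
    have dl : d < l%:R by exact: truncnS_gt.
    have : `|Y x| < l%:R by apply: lt_trans dl.
    rewrite /Y ltr_norml => /andP[a1 a2].
    have : (sumn x)%:R < (m + l)%N%:R :> R by rewrite natrD; lra.
    have : (m)%:R < (sumn x + l)%N%:R :> R by rewrite natrD; lra.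
    by rewrite !ltr_nat => ? ?; rewrite mem_centred_interval.
  rewrite interval_prob.
  apply: (@le_trans _ _ (\sum_(i < l + l) (C / r))).
    apply: ler_sum => i _; rewrite /r; case: (m) m_gt0 => // m' _; exact: sum_pmf_leC.
  rewrite sumr_const card_ord -[leLHS]mulr_natl natrD.
  have ll : l%:R <= d + 1 by rewrite /l -addn1 natrD lerD2r truncn_le// ltW.
  apply: (@le_trans _ _ ((d + 1 + (d + 1)) * (C / r))).
    by rewrite ler_wpM2r ?divr_ge0 ?(ltW r0)//; lra.
  rewrite mulrA ler_pdivrMr//.
  have -> : (d + 1 + (d + 1)) * C = r / 4 + 2 * C.
    by rewrite /d; field; apply/lt0r_neq0; lra.
  by move: m_large; rewrite -/r; lra.
apply: (@le_trans _ _ (E m (fun x => d * (1 - (`|Y x| < d)%R%:R)))).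
  rewrite iidEZl iidEB iidE_cst//.
  have -> : r / (16 * C) = d * 2^-1 by rewrite /d; field; apply/lt0r_neq0; lra.
  by rewrite ler_wpM2l ?(ltW d0)//; lra.
apply: ler_iidE => // x _ _; case: ltP => Yd; first by rewrite subrr mulr0.
by rewrite subr0 mulr1.
Qed.

(** The first absolute moment of the sum on one side of [m] is at most
    [K r] times the probability of the values within [K r], plus the second moment
    divided by [K r] for the values beyond. The second moment being of order [m],
    one of the at most [2 K r] values within [K r] must have probability of order
    [1 / r]. *)
Lemma point_on_side (Z : seq nat -> R) (e : nat -> nat) :
  (forall x, Z x = `|Y x| \/ Z x = 0) ->
  (forall x, Z x = `|Y x| -> `|Y x| <= K * r ->
     exists2 i, i%:R <= K * r & sumn x = e i) ->
  r / (64 * C) <= E m Z ->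
  exists2 i, i%:R <= K * r & peak C V / r <= P m (e i).
Proof.
have C1 := C_ge1; have V1 := V_ge1; have C0 := C_gt0; have rp := r0; have cv := CV; have vc := VC.
move=> Zcases Ze EZ.
have D0 : 0 < D by rewrite /D mulr_gt0// exprn_gt0//; lra.
have V0 : 0 < V by exact: lt_le_trans ltr01 V1.
have K0 : 0 < K by exact: spread_gt0.
have Kr : 0 < K * r by rewrite mulr_gt0.
apply: contrapT => no.
pose l := (Num.truncn (K * r)).+1.
have ll : l%:R <= 2 * (K * r).
  have : 1 <= K * r.
    have r1 : 1 <= r by move: m_large; rewrite -/r; lra.
    have V2 : 1 <= V ^+ 2 by rewrite exprn_ege1.
    have : 1 <= K by rewrite /K /spread mulr_ege1//; lra.
    by move=> K1; rewrite mulr_ege1.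
  have : l%:R <= K * r + 1 by rewrite /l -addn1 natrD lerD2r truncn_le// ltW.
  by lra.
have : E m Z <= E m (fun x => K * r * \sum_(i < l) (sumn x == e i)%:R + Y x ^+ 2 / (K * r)).
  apply: ler_iidE => // x _ _.
  have s0 : 0 <= \sum_(i < l) (sumn x == e i)%:R :> R by apply: sumr_ge0.
  have y0 : 0 <= Y x ^+ 2 / (K * r) by rewrite divr_ge0 ?sqr_ge0// ltW.
  case: (Zcases x) => Zx; last by rewrite Zx addr_ge0// mulr_ge0// ltW.
  have [YK|YK] := leP `|Y x| (K * r).
    have [i iK se] := Ze x Zx YK.
    have il : (i < l)%N by rewrite /l ltnS truncn_ge_nat // ltW.
    have : 1 <= \sum_(i < l) (sumn x == e i)%:R :> R.
      by rewrite (bigD1 (Ordinal il))//= se eqxx lerDl sumr_ge0.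
    move=> s1; rewrite Zx; apply: (@le_trans _ _ (K * r)) => //.
    by rewrite -[leLHS]addr0 lerD// ler_peMr// ltW.
  apply: (@le_trans _ _ (Y x ^+ 2 / (K * r))); last first.
    by rewrite lerDr mulr_ge0// ltW.
  rewrite Zx ler_pdivlMr// -(real_normK (num_real _)) expr2 ler_wpM2l//.
  exact: ltW.
rewrite iidED iidEZl iidEZr iidE_sum//.
have pts : \sum_(i < l) E m (fun x => (sumn x == e i)%:R) <= l%:R * (peak C V / r).
  rewrite mulr_natl -[in leRHS](card_ord l) -sumr_const; apply: ler_sum => i _.
  apply/ltW; rewrite ltNge; apply/negP => ge; apply: no; exists (nat_of_ord i) => //.
  have := ltn_ord i; rewrite /l ltnS => il; apply: le_trans (_ : (Num.truncn (K * r))%:R <= _).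
    by rewrite ler_nat.
  by rewrite truncn_le// ltW.
have sq : E m (fun x => Y x ^+ 2) / (K * r) <= r / (128 * C).
  rewrite ler_pdivrMr//; apply: le_trans centred_sqr _.
  rewrite -r2 /K /spread -/D le_eqVlt; apply/orP; left; apply/eqP; field.
  by apply/lt0r_neq0; lra.
have : K * r * (\sum_(i < l) E m (fun x => (sumn x == e i)%:R)) <= r / (256 * C).
  apply: (@le_trans _ _ (K * r * (2 * (K * r) * (peak C V / r)))).
    rewrite ler_wpM2l ?(ltW Kr)//; apply: le_trans pts _.
    exact: ler_wpM2r (divr_ge0 (ltW (peak_gt0 C0 V0)) (ltW rp)) _ _ ll.
  rewrite le_eqVlt; apply/orP; left; apply/eqP; rewrite /peak -/K; field.
  by rewrite !gt_eqF//=; lra.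
have c0 : 0 < r / C by rewrite divr_gt0//; lra.
have e1 : r / (256 * C) = 256^-1 * (r / C) by field; apply/lt0r_neq0; lra.
have e2 : r / (128 * C) = 128^-1 * (r / C) by field; apply/lt0r_neq0; lra.
have e3 : r / (64 * C) = 64^-1 * (r / C) by field; apply/lt0r_neq0; lra.
rewrite e3 in EZ; rewrite e2 in sq; rewrite e1.
by lra.
Qed.

Lemma point_right : exists j, [/\ (m <= j)%N, (j - m)%N%:R <= K * r &
  peak C V / r <= P m j].
Proof.
have C1 := C_ge1; have V1 := V_ge1; have rp := r0; have vc := VC.
have [|||i iK Pi] := @point_on_side (fun x => (`|Y x| + Y x) / 2) (addn m).
- by move=> x; have [Y0|Y0] := lerP 0 (Y x); [left|right]; rewrite ?(ger0_norm Y0) ?(ltr0_norm Y0); lra.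
- move=> x; have [Y0 _|Y0] := lerP 0 (Y x); last by rewrite (ltr0_norm Y0); lra.
  rewrite (ger0_norm Y0); have ms : (m <= sumn x)%N.
    by rewrite -(ler_nat R); move: Y0; rewrite /Y; lra.
  by exists (sumn x - m)%N; [rewrite natrB | rewrite subnKC].
- rewrite iidEZr iidED; have /andP[e1 e2] := centred_mean; have := centred_norm.
  have c0 : 0 < r / C by rewrite divr_gt0//; lra.
  have e3 : r / (16 * C) = 16^-1 * (r / C) by field; apply/lt0r_neq0; lra.
  have e4 : r / (64 * C) = 64^-1 * (r / C) by field; apply/lt0r_neq0; lra.
  have : V <= 32^-1 * (r / C).
    rewrite mulrA ler_pdivlMr; last by lra.
    by move: m_large; rewrite -/r; lra.
  by rewrite e3 e4; lra.
- by exists (m + i)%N; rewrite leq_addr addKn.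
Qed.

Lemma point_left : exists j, [/\ (j <= m)%N, (m - j)%N%:R <= K * r &
  peak C V / r <= P m j].
Proof.
have C1 := C_ge1; have V1 := V_ge1; have rp := r0; have vc := VC.
have [|||i iK Pi] := @point_on_side (fun x => (`|Y x| - Y x) / 2) (subn m).
- by move=> x; have [Y0|Y0] := lerP (Y x) 0; [left|right]; rewrite ?(ler0_norm Y0) ?(gtr0_norm Y0); lra.
- move=> x; have [Y0 _|Y0] := lerP (Y x) 0; last by rewrite (gtr0_norm Y0); lra.
  rewrite (ler0_norm Y0) => YK; have ms : (sumn x <= m)%N.
    by rewrite -(ler_nat R); move: Y0; rewrite /Y; lra.
  exists (m - sumn x)%N; last by rewrite subKn.
  by rewrite natrB//; move: YK; rewrite /Y; lra.
- rewrite iidEZr iidEB; have /andP[e1 e2] := centred_mean; have := centred_norm.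
  have c0 : 0 < r / C by rewrite divr_gt0//; lra.
  have e3 : r / (16 * C) = 16^-1 * (r / C) by field; apply/lt0r_neq0; lra.
  have e4 : r / (64 * C) = 64^-1 * (r / C) by field; apply/lt0r_neq0; lra.
  by rewrite e3 e4; lra.
- exists (m - i)%N; rewrite leq_subr; split=> //.
  by apply: le_trans iK; rewrite ler_nat leq_subLR addnC -leq_subLR.
Qed.

End Points.

(** Around [j], values in steps of [h] up to distance [w * h], on either side, all
    of probability at least [c]. *)
Definition lump (h n j w : nat) (c : R) : Prop :=
  forall x i : nat, (i <= w)%N -> x = (j + i * h)%N \/ (x + i * h)%N = j ->
  c <= P n x.

Lemma lump_of_point h n j w c e :
  (forall s, `|P n s - P n (s + h)%N| <= e) -> c <= P n j -> w%:R * e <= c / 2 ->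
  lump h n j w (c / 2).
Proof.
move=> Pe Pj we x i iw xj.
have chain s : `|P n s - P n (s + i * h)%N| <= i%:R * e.
  elim: i {iw xj} s => [|i IH] s; first by rewrite !mul0r addn0 subrr normr0.
  rewrite mulSn addnA -(subrKA (P n (s + h)%N)) -[i.+1]add1n natrD mulrDl mul1r.
  by apply: le_trans (ler_normD _ _) _; rewrite lerD.
have ie : i%:R * e <= w%:R * e.
  by rewrite ler_wpM2r ?ler_nat//; apply: le_trans (Pe 0%N).
case: xj => xj.
  have := chain j; rewrite -xj ler_norml => /andP[_]; lra.
have := chain x; rewrite xj ler_norml => /andP[]; lra.
Qed.

(** The [v + 1] ways of splitting [x = (x - y) + y] with [y] on the side of [j2]
    that brings [x - y] closer to [j1] all contribute. *)
Lemma lump_conv h m1 m2 j1 j2 w1 v c1 c2 : (0 < h)%N -> (2 * v <= w1)%N ->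
  (w1 * h <= j1)%N -> (2 * v * h <= j2)%N -> 0 <= c1 -> 0 <= c2 ->
  lump h m1 j1 w1 c1 -> lump h m2 j2 (2 * v) c2 ->
  lump h (m1 + m2) (j1 + j2) (w1 + v) (v.+1%:R * (c1 * c2)).
Proof.
move=> h0 vw vj1 vj2 c10 c20 l1 l2 x i iw xj.
have split_le (e1 e2 : nat -> nat) : (forall i', (i' < v.+1)%N -> (e1 i' + e2 i')%N = x) ->
    (forall i1 i2, (i1 < v.+1)%N -> (i2 < v.+1)%N -> e2 i1 = e2 i2 -> i1 = i2) ->
    (forall i', (i' < v.+1)%N -> c1 <= P m1 (e1 i') /\ c2 <= P m2 (e2 i')) ->
    v.+1%:R * (c1 * c2) <= P (m1 + m2) x.
  move=> e12 inj ec.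
  apply: (@le_trans _ _ (\sum_(i' < v.+1) P m1 (e1 i') * P m2 (e2 i'))).
    rewrite mulr_natl -[in leLHS](card_ord v.+1) -sumr_const.
    apply: ler_sum => i' _; have [? ?] := ec i' (ltn_ord i').
    exact: ler_pM.
  have -> : \sum_(i' < v.+1) P m1 (e1 i') * P m2 (e2 i') = E m1 (fun x1 => E m2 (fun x2 =>
      \sum_(i' < v.+1) (sumn x1 == e1 i')%:R * (sumn x2 == e2 i')%:R)).
    under [RHS]eq_iidE => x1 _ _ do rewrite iidE_sum//.
    rewrite iidE_sum//; apply: eq_bigr => i' _.
    by rewrite -iidEZr; apply: eq_iidE => x1 _ _; rewrite iidEZl.
  rewrite /sum_pmf iidE_cat; apply: ler_iidE => // x1 _ _; apply: ler_iidE => // x2 _ _.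
  have [[k _ k2]|no] := pselect (exists2 k : 'I_v.+1, true & sumn x2 = e2 k).
    rewrite (bigD1 k)//= big1 ?addr0 => [|i' /eqP ik].
      rewrite k2 eqxx mulr1 ler_nat; case: eqP => // x1E.
      by rewrite sumn_cat x1E k2 e12// eqxx.
    case: eqP => _; rewrite ?mul0r// mul1r; case: eqP => // x2E.
    by case: ik; apply: val_inj; apply: (inj _ _ (ltn_ord i') (ltn_ord k)); rewrite -x2E -k2.
  rewrite big1// => i' _; case: eqP => _; rewrite ?mul0r// mul1r.
  by case: eqP => // x2E; case: no; exists i'.
have hinj (a b : nat) : (a * h = b * h)%N -> a = b by move/eqP; rewrite eqn_pmul2r// => /eqP.
have hle (a b : nat) : (a <= b)%N -> (a * h <= b * h)%N by move=> ab; rewrite leq_mul2r ab orbT.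
have vwh := hle _ _ vw.
case: xj => xj.
- apply: (split_le (fun i' => (x - (j2 + (v + i') * h))%N) (fun i' => (j2 + (v + i') * h)%N)).
  + move=> i' i'v; rewrite subnK// xj.
    have : ((v + i') * h <= 2 * v * h)%N by apply: hle; lia.
    lia.
  + by move=> i1 i2 _ _ /addnI /hinj /addnI.
  + move=> i' i'v; split; last first.
      by apply: (l2 _ (v + i')%N); [lia | left].
    have [ii|ii] := leqP (v + i') i.
      apply: (l1 _ (i - (v + i'))%N); first lia.
      left; rewrite mulnBl xj; have := hle _ _ ii; lia.
    apply: (l1 _ (v + i' - i)%N); first lia.
    right; rewrite mulnBl xj; have := hle _ _ (ltnW ii).
    have : ((v + i') * h <= 2 * v * h)%N by apply: hle; lia.
    lia.
- apply: (split_le (fun i' => (x - (j2 - (v + i') * h))%N) (fun i' => (j2 - (v + i') * h)%N)).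
  + move=> i' i'v; rewrite subnK//.
    have : ((v + i') * h <= 2 * v * h)%N by apply: hle; lia.
    have : (i * h <= (w1 + (v + i')) * h)%N by apply: hle; lia.
    by rewrite mulnDl; lia.
  + move=> i1 i2 i1v i2v; rewrite -/(2 * v)%N => e12.
    have : ((v + i1) * h <= 2 * v * h)%N by apply: hle; lia.
    have : ((v + i2) * h <= 2 * v * h)%N by apply: hle; lia.
    by move=> l3 l4; apply: (@addnI v); apply: hinj; lia.
  + move=> i' i'v; have l3 : ((v + i') * h <= 2 * v * h)%N by apply: hle; lia.
    split; last by apply: (l2 _ (v + i')%N); [lia | right; lia].
    have [ii|ii] := leqP (v + i') i.
      apply: (l1 _ (i - (v + i'))%N); first lia.
      right; rewrite mulnBl; have := hle _ _ ii.
      have : (i * h <= (w1 + (v + i')) * h)%N by apply: hle; lia.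
      by rewrite mulnDl; lia.
    apply: (l1 _ (v + i' - i)%N); first lia.
    left; rewrite mulnBl; have := hle _ _ (ltnW ii).
    lia.
Qed.

End Lumps.

Section LowerBound.
Context {R : realType}.

Lemma sum_pmf_lattice (B : nat) (q : nat -> R) (h m s : nat) :
  (forall a, (a < B)%N -> ~~ (h %| a)%N -> q a = 0) ->
  (s < B)%N -> ~~ (h %| s)%N -> sum_pmf B q m s = 0.
Proof.
move=> supp; elim: m s => [|m IH] s sB hs.
  by rewrite /sum_pmf /=; case: eqP => // s0; rewrite -s0 dvdn0 in hs.
rewrite /sum_pmf /= big1// => a _.
have [as_|sa] := leqP a s; last first.
  rewrite (_ : iidE _ _ _ _ = iidE B q m (fun=> 0 * 0 : R)).
    by rewrite iidEZl mul0r mulr0.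
  apply: eq_iidE => x _ _ /=; rewrite mul0r; case: eqP => // e.
  by move: sa; rewrite -e ltnNge leq_addr.
have [ha|ha] := boolP (h %| a)%N; last first.
  by rewrite supp ?mul0r//; exact: leq_ltn_trans sB.
rewrite (_ : iidE _ _ _ _ = sum_pmf B q m (s - a)).
  rewrite IH ?mulr0//; first by apply: leq_ltn_trans sB; rewrite leq_subr.
  by rewrite dvdn_subl.
by apply: eq_iidE => x _ _ /=; rewrite -[in LHS](subnKC as_) eqn_add2l.
Qed.

Lemma sum_pmf_prepend0 (B : nat) (q : nat -> R) (t m s : nat) :
  (forall a, 0 <= q a) -> \sum_(a < B.+1) q a = 1 ->
  q 0%N ^+ t * sum_pmf B q m s <= sum_pmf B q (t + m) s.
Proof.
move=> q_ge0 q_sum1; elim: t => [|t IH]; first by rewrite expr0 mul1r.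
rewrite exprS -mulrA addSn.
have := @iidE_cons_le _ B q q_ge0 q_sum1 0 (t + m) (fun x => (sumn x == s)%:R) (leq0n _).
move=> /(_ (fun=> ler0n _ _)); apply: le_trans.
by rewrite ler_wpM2l.
Qed.

(** Both sides of the mean carry points of probability at least
    [peak / sqrt m]. Smoothness widens them to lumps of width of order [sqrt m].
    Convolving a large fixed number of these, always choosing the lump on the
    side that keeps the centre within [spread * sqrt m] of the mean, widens the
    lump until it covers the mean. *)
Lemma sum_pmf_mean_ge (h : nat) (C V L p0 : R) :
  (0 < h)%N -> 1 <= C -> 1 <= V -> 0 < L -> 0 < p0 <= 1 ->
  exists2 c, 0 < c & exists n0, forall n (q : nat -> R), (n0 <= n)%N ->
    (forall a, 0 <= q a) -> \sum_(a < n.+1) q a = 1 -> p0 <= q 0%N ->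
    (forall m s : nat, sum_pmf n q m.+1 s <= C / Num.sqrt m.+1%:R) ->
    (forall m s : nat, `|sum_pmf n q m.+2 s - sum_pmf n q m.+2 (s + h)%N| <=
       L / m.+2%:R) ->
    0 <= n%:R * (1 - letterE n q (fun a => a%:R)) <= V ->
    letterE n q (fun a => a%:R ^+ 2) <= V ->
    (forall a, (a < n)%N -> ~~ (h %| a)%N -> q a = 0) ->
    (h %| n.-1)%N ->
    c / Num.sqrt n%:R <= sum_pmf n q n n.-1.
Proof.
move=> h0 C1 V1 L0 /andP[p00 p01].
pose c0 := peak C V; pose K := spread C V.
have C0 : 0 < C by exact: lt_le_trans ltr01 C1.
have V0 : 0 < V by exact: lt_le_trans ltr01 V1.
have K0 : 0 < K by exact: spread_gt0.
have c00 : 0 < c0 by exact: peak_gt0.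
(* Each convolution widens the lump by at least [c0 * r / (8 * L)] steps, with
   [r = sqrt m]; [Q] of them cover the distance [K * r] to the mean. *)
have [Q Q3 QK] : exists2 Q : nat, (2 < Q)%N & 8 * L * K / c0 <= Q%:R.
  exists (Num.truncn (8 * L * K / c0)).+3 => //.
  by apply: ltW; apply: lt_le_trans (truncnS_gt _) _; rewrite ler_nat; apply: leqW; exact: leqnSn.
have Q0 : (0 < Q)%N by apply: leq_trans Q3.
(* Lower bounds that [sqrt m] has to satisfy. *)
pose XA := 32 * C * V; pose XB := (h * Q.+1)%N%:R * c0 / (4 * L).
pose XD := 8 * L * Q%:R / c0; pose X : R := XA + XB + K + XD.
(* The factor by which each convolution may lower the height of the lump. *)
pose kappa : R := c0 ^+ 2 / (8 * L).
have kappa0 : 0 < kappa by rewrite divr_gt0 ?exprn_gt0//; lra.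
exists (p0 ^+ Q * (kappa ^+ Q.-1 * (c0 / 2))).
  by rewrite mulr_gt0 ?exprn_gt0// mulr_gt0 ?exprn_gt0// divr_gt0.
have [N XN] : exists N : nat, X ^+ 2 <= N%:R.
  by exists (Num.truncn (X ^+ 2)).+1; apply/ltW/truncnS_gt.
exists (Q * N.+1)%N.
move=> n q nQ q_ge0 q_sum1 qp0 conc step mean sqr supp hn.
have [m [mN QmE nQm]] : exists m : nat, [/\ (N < m)%N, (Q * m <= n)%N & (n < Q * m + Q)%N].
  exists (n %/ Q)%N.
  split; first by rewrite leq_divRL// mulnC.
    by rewrite mulnC leq_trunc_div.
  by rewrite addnC -mulnS mulnC ltn_ceil.
pose r := Num.sqrt m%:R : R.
have X1 : 0 <= XA by rewrite !mulr_ge0//; lra.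
have X2 : 0 <= XB by rewrite divr_ge0 ?mulr_ge0 ?(ltW c00)//; lra.
have X3 : 0 <= XD by rewrite divr_ge0 ?mulr_ge0 ?(ltW c00)//; lra.
have X0 : 0 <= X by rewrite /X; lra.
have Xr : X <= r.
  rewrite /r -(ger0_norm X0) -sqrtr_sqr ler_wsqrtr//; apply: le_trans XN _.
  by rewrite ler_nat ltnW.
have CV1 : 1 <= C * V by rewrite mulr_ege1.
have r32 : XA <= r by move: Xr; rewrite /X; lra.
have XBr : XB + K <= r by move: Xr; rewrite /X; lra.
have XDr : XD <= r by move: Xr; rewrite /X; lra.
rewrite /XA in r32.
have r1 : 1 <= r by lra.
have r0 : 0 < r by lra.
have m0 : (0 < m)%N by apply: leq_trans mN.
have rr : r * r = m%:R by rewrite -expr2 sqr_sqrtr.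
have m2 : (2 <= m)%N.
  rewrite -(ler_nat R) -rr; apply: (@le_trans _ _ (r * 2)).
    by rewrite mulr_natr; lra.
  by rewrite ler_pM2l//; lra.
have [v vle vgt] : exists2 v : nat, v%:R <= c0 * r / (4 * L) & c0 * r / (4 * L) <= v.+1%:R.
  exists (Num.truncn (c0 * r / (4 * L))); last by apply/ltW/truncnS_gt.
  by rewrite truncn_le divr_ge0 ?mulr_ge0 ?(ltW c00) ?(ltW r0)//; lra.
have [rho rhole to_rho] : exists2 rho : nat, rho%:R <= K * r &
    forall d : nat, d%:R <= K * r -> (d <= rho)%N.
  have Kr : 0 <= K * r by rewrite mulr_ge0// ltW.
  by exists (Num.truncn (K * r)) => [|d]; rewrite ?truncn_le// truncn_ge_nat.
have room : (Q.+1 * v * h + rho <= m)%N.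
  rewrite -(ler_nat R) natrD -rr.
  apply: (@le_trans _ _ (((h * Q.+1)%N%:R * c0 / (4 * L) + K) * r)).
    rewrite mulrDl lerD// (mulnC (_ * v)%N) mulnA.
    rewrite natrM; apply: le_trans (ler_wpM2l (ler0n _ _) vle) _.
    by rewrite le_eqVlt; apply/orP; left; apply/eqP; field; apply/lt0r_neq0.
  by rewrite ler_wpM2r ?(ltW r0).
have vbig : Q%:R <= c0 * r / (8 * L).
  move: XDr; rewrite /XD ler_pdivrMr// => h1.
  by rewrite ler_pdivlMr ?mulr_gt0// mulrC [c0 * r]mulrC.
have v2 : c0 * r / (8 * L) <= v%:R.
  have : 1 <= Q%:R :> R by rewrite ler1n; apply: leq_trans Q3.
  have : c0 * r / (4 * L) = c0 * r / (8 * L) + c0 * r / (8 * L) by field; apply/lt0r_neq0.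
  by move: vgt; rewrite -[v.+1]addn1 natrD; move: vbig; move: (c0 * r / (4 * L)) (c0 * r / (8 * L)) => x y; lra.
have Qv : (Q <= v)%N by rewrite -(ler_nat R); lra.
have rhoQv : (rho <= Q * v)%N.
  rewrite -(ler_nat R) natrM; apply: le_trans rhole _.
  apply: (@le_trans _ _ (Q%:R * (c0 * r / (8 * L)))); last by rewrite ler_wpM2l.
  rewrite ler_pdivrMr// in QK.
  rewrite mulrA ler_pdivlMr; last by lra.
  apply: (@le_trans _ _ ((8 * L * K) * r)); first by lra.
  by rewrite mulrA ler_wpM2r// ltW.
pose c1 := c0 / r / 2.
have c10 : 0 < c1 by rewrite !divr_gt0.
have mn : (m <= n)%N by apply: leq_trans QmE; rewrite leq_pmull.
have meanm : 0 <= m%:R * (1 - letterE n q (fun a => a%:R)) <= V.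
  move: mean => /andP[me1 me2]; have n0 : (0 < n)%N by apply: leq_trans mn.
  have e0 : 0 <= 1 - letterE n q (fun a => a%:R).
    by move: me1; rewrite pmulr_rge0 ?ltr0n.
  rewrite mulr_ge0//=; apply: le_trans me2.
  by rewrite ler_wpM2r// ler_nat.
have to_lump j : c0 / r <= sum_pmf n q m j -> lump n q h m j (2 * v) c1.
  move=> Pj; apply: (@lump_of_point _ n q h m j (2 * v) (c0 / r) (L / m%:R)) => //.
    by case: (m) m2 => [|[|m']] // _; exact: step.
  rewrite natrM -mulrA (mulrC v%:R) mulrA.
  rewrite (_ : c0 / r / 2 = 2 * (L / m%:R) * (c0 * r / (4 * L))).
    by rewrite ler_wpM2l// mulr_ge0// divr_ge0// ltW.
  rewrite -rr; field; apply/andP; split; apply/lt0r_neq0; lra.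
have hdvd j : (j < n)%N -> c0 / r <= sum_pmf n q m j -> (h %| j)%N.
  move=> jn Pj; apply/contraT => nh; have := sum_pmf_lattice m supp jn nh => P0.
  by move: Pj; rewrite P0 leNgt divr_gt0.
have m3n : (3 * m <= n)%N by apply: leq_trans QmE; rewrite leq_mul2r Q3 orbT.
have [jr [jrm /to_rho jrK /[dup] jrP /to_lump jrL]] :=
  point_right q_ge0 q_sum1 C1 V1 conc m0 meanm sqr r32.
have [jl [jlm /to_rho jlK /[dup] jlP /to_lump jlL]] :=
  point_left q_ge0 q_sum1 C1 V1 conc m0 meanm sqr r32.
have jrh : (h %| jr)%N by apply: hdvd jrP; clear - jrK jrm room m3n m0; lia.
have jlh : (h %| jl)%N by apply: hdvd jlP; clear - jlm m3n m0; lia.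
have kstep : kappa <= v.+1%:R * c1.
  apply: (@le_trans _ _ (c0 * r / (4 * L) * c1)); last by rewrite ler_wpM2r// ltW.
  rewrite /kappa /c1 le_eqVlt; apply/orP; left; apply/eqP; field.
  by apply/andP; split; apply/lt0r_neq0; lra.
have main t : (t < Q)%N -> exists j, [/\ (h %| j)%N, (j <= t.+1 * m + rho)%N,
    (t.+1 * m <= j + rho)%N & lump n q h (t.+1 * m) j (t.+2 * v) (kappa ^+ t * c1)].
  elim: t => [|t IH] tQ.
    by exists jr; rewrite !mul1n expr0 mul1r; split=> //; clear - jrm jrK; lia.
  have [j [hj j1 j2 jL]] := IH (ltnW tQ).
  have room1 : (t.+2 * v * h <= Q.+1 * v * h)%N by rewrite !leq_mul// leqW.
  have room2 : (2 * v * h <= Q.+1 * v * h)%N by rewrite !leq_mul// leqW// ltnW.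
  have jm : (m <= t.+1 * m)%N by rewrite leq_pmull.
  have tm : (t.+2 * m = t.+1 * m + m)%N by rewrite [in LHS]mulSn addnC.
  have vv : (2 * v <= t.+2 * v)%N by rewrite leq_mul.
  have vj : (t.+2 * v * h <= j)%N by clear - room1 room jm j2; lia.
  have ct0 : 0 <= kappa ^+ t * c1 by rewrite mulr_ge0 ?exprn_ge0// ltW.
  have weaken j' : lump n q h (t.+1 * m + m) j' (t.+2 * v + v) (v.+1%:R * (kappa ^+ t * c1 * c1)) ->
      lump n q h (t.+2 * m) j' (t.+3 * v) (kappa ^+ t.+1 * c1).
    move=> lp x i iw xj; apply: (@le_trans _ _ (v.+1%:R * (kappa ^+ t * c1 * c1))); last first.
      by rewrite tm; apply: lp xj; apply: leq_trans iw _; rewrite mulSn addnC.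
    rewrite (_ : _ * (_ * _ * _) = (kappa ^+ t * c1) * (v.+1%:R * c1)); last by ring.
    by rewrite exprSr (mulrAC _ kappa) ler_wpM2l.
  have [jt|jt] := leqP (t.+1 * m) j.
    exists (j + jl)%N; split; first exact: dvdn_add.
    + by clear - j1 jlm tm; lia.
    + by clear - jt jlK tm jlm; lia.
    apply: weaken; apply: lump_conv (ltW c10) jL jlL => //.
    by clear - room2 room jlK jlm; lia.
  exists (j + jr)%N; split; first exact: dvdn_add.
  + by clear - jt jrm jrK tm; lia.
  + by clear - j2 jrm tm; lia.
  apply: weaken; apply: lump_conv (ltW c10) jL jrL => //.
  by clear - room2 room jrK jrm; lia.
have [|j [hj j1 j2 jL]] := main Q.-1; first by rewrite prednK.
rewrite prednK// in j1 j2 jL.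
have cover i : (i * h <= rho + Q)%N -> (i <= Q.+1 * v)%N.
  move=> ih; have : (i <= i * h)%N by rewrite leq_pmulr.
  by rewrite mulSn; clear - ih rhoQv Qv; lia.
have PQ : kappa ^+ Q.-1 * c1 <= sum_pmf n q (Q * m) n.-1.
  have [jn|jn] := leqP j n.-1.
    have /dvdnP[i iE] : (h %| n.-1 - j)%N by rewrite dvdn_sub.
    apply: (jL _ i); last by left; rewrite -iE subnKC.
    by apply: cover; rewrite -iE; clear - j2 nQm; lia.
  have /dvdnP[i iE] : (h %| j - n.-1)%N by rewrite dvdn_sub.
  apply: (jL _ i); last by right; rewrite -iE subnKC// ltnW.
  by apply: cover; rewrite -iE; clear - j1 QmE Q0; lia.
(* The remaining letters, fewer than [Q], are required to be [0]. *)
have := @sum_pmf_prepend0 n q (n - Q * m) (Q * m) n.-1 q_ge0 q_sum1.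
rewrite subnK//; apply: le_trans.
have c10' := ltW c10.
apply: (@le_trans _ _ (p0 ^+ Q * (kappa ^+ Q.-1 * c1))); last first.
  apply: ler_pM => //; first by rewrite exprn_ge0// ltW.
    by rewrite mulr_ge0// exprn_ge0// ltW.
  apply: (@le_trans _ _ (p0 ^+ (n - Q * m))).
    by rewrite ler_wiXn2l// ?(ltW p00)//; clear - nQm; lia.
  by rewrite lerXn2r// ?nnegrE ?(ltW p00).
have -> : c1 = c0 / 2 * r^-1 by rewrite /c1 mulrAC.
have a0 : 0 <= p0 ^+ Q * (kappa ^+ Q.-1 * (c0 / 2)).
  rewrite mulr_ge0 ?exprn_ge0 ?(ltW p00)// mulr_ge0 ?exprn_ge0 ?(ltW kappa0)//.
  by rewrite divr_ge0// ltW.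
rewrite [X in _ <= _ * X]mulrA [leRHS]mulrA ler_wpM2l//.
by rewrite lef_pV2 ?posrE ?sqrtr_gt0 ?ltr0n ?(leq_trans m0)// ler_wsqrtr// ler_nat.
Qed.

End LowerBound.

(** * Occurrences of a tree code in a cyclic random word *)

Section CyclicOcc.
Variable c : seq nat.
Let k := size c.

Lemma cyclic_occ_rot i x : cyclic_occ c (rot i x) = cyclic_occ c x.
Proof.
have rot1_occ y : cyclic_occ c (rot 1 y) = cyclic_occ c y.
  case: y => // a y; rewrite /cyclic_occ size_rot.
  transitivity (count (fun i => take k (rot i (a :: y)) == c) (iota 1 (size (a :: y)))).
    rewrite (iotaDl 1 0) count_map; apply: eq_in_count => j.
    by rewrite mem_iota /= => jy; rewrite addnC rotD// addn1.
  have -> : iota 1 (size (a :: y)) = iota 1 (size y) ++ [:: (size y).+1].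
    by rewrite /= -[LHS]/(iota 1 (size y).+1) -[X in iota 1 X]addn1 iotaD.
  rewrite count_cat addnC /= addn0 rot0 (@rot_oversize _ (size y).+1 (a :: y))//.
have [ix|ix] := leqP i (size x); last by rewrite rot_oversize// ltnW.
elim: i ix => [|i IH] ix; first by rewrite rot0.
by rewrite -add1n rotD ?add1n// rot1_occ IH// ltnW.
Qed.

Definition window_at i x := take k (rot i x) == c.

Lemma cyclic_occ_split x : (0 < k <= size x)%N -> cyclic_occ c x =
  (linear_occ c x + count (window_at^~ x) (iota (size x - k).+1 k.-1))%N.
Proof.
move=> /andP[k0 kx].
have sE : size x = ((size x - k).+1 + k.-1)%N by clear - k0 kx; lia.
rewrite /cyclic_occ /linear_occ {1 2}sE !iotaD !count_cat add0n.
rewrite [X in _ = (_ + X + _)%N](_ : _ = 0)%N; last first.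
  apply/eqP; rewrite -leqn0 leqNgt -has_count; apply/hasPn => i.
  rewrite mem_iota => /andP[i1 i2]; apply/eqP => /(congr1 size).
  have lt : (size x - i < k)%N by clear - i1 k0 kx; lia.
  by rewrite size_take size_drop -/k ltnNge (ltnW lt) /= => e; rewrite e ltnn in lt.
rewrite addn0; congr (_ + _)%N; apply: eq_in_count => i.
rewrite mem_iota add0n => /andP[_ i2]; rewrite /rot takel_cat// size_drop -/k.
by clear - i2 kx; lia.
Qed.

Lemma linear_occ_cons a y :
  linear_occ c (a :: y) = (window_at 0 (a :: y) + linear_occ c y)%N.
Proof.
transitivity (window_at 0 (a :: y) +
   count (fun i => take k (drop i (a :: y)) == c) (iota 1 (size y)))%N.
  by rewrite /window_at rot0.
by rewrite (iotaDl 1 0) count_map.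
Qed.

End CyclicOcc.

Section WordWeight.
Context {R : rcfType}.
Variables (B : nat) (q : nat -> R).
Hypothesis q_ge0 : forall a, 0 <= q a.
Hypothesis q_sum1 : \sum_(a < B.+1) q a = 1.
Local Notation E := (iidE B q).
Local Notation P := (sum_pmf B q).

Definition weight (c : seq nat) : R := \prod_(a <- c) q a.

Lemma weight_ge0 c : 0 <= weight c.
Proof. by apply: prodr_ge0 => i _. Qed.

Lemma iidE_prefix (c : seq nat) m F : all (leq^~ B) c ->
  E (size c + m) (fun x => (take (size c) x == c)%:R * F x) =
  weight c * E m (fun y => F (c ++ y)).
Proof.
elim: c F => [|a c IH] F /=.
  move=> _; rewrite /weight big_nil mul1r add0n; apply: eq_iidE => x _ _.
  by rewrite take0 eqxx mul1r.
move=> /andP[aB cB]; rewrite (bigD1 (Ordinal (aB : a < B.+1)%N))//=.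
rewrite big1 ?addr0 => [|b /eqP ba].
  rewrite /weight big_cons -mulrA -(IH (fun x => F (a :: x)))//.
  by congr (_ * _); apply: eq_iidE => x _ _; rewrite eqseq_cons eqxx.
rewrite (iidE0 q_sum1) ?mulr0// => x _ _; rewrite eqseq_cons.
case: eqP => [bE|]; last by rewrite mul0r.
by case: ba; apply: val_inj.
Qed.

Variable C : R.
Hypothesis sum_pmf_leC : forall m s : nat, P m.+1 s <= C / Num.sqrt m.+1%:R.

Lemma window_prob (c : seq nat) (i m s : nat) : all (leq^~ B) c ->
  E (size c + m.+1) (fun x => (sumn x == s)%:R * (window_at c i x)%:R) <=
  weight c * (C / Num.sqrt m.+1%:R).
Proof.
move=> cB.
have -> : E (size c + m.+1) (fun x => (sumn x == s)%:R * (window_at c i x)%:R) =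
    E (size c + m.+1) (fun x => (sumn (rot i x) == s)%:R * (take (size c) (rot i x) == c)%:R).
  by apply: eq_iidE => x _ _; rewrite sumn_rot.
rewrite (iidE_rot q_sum1 i (size c + m.+1)
  (fun x => (sumn x == s)%:R * (take (size c) x == c)%:R)).
rewrite (@eq_iidE _ _ _ _ _ (fun x => (take (size c) x == c)%:R * (sumn x == s)%:R));
  last by move=> x _ _; rewrite mulrC.
rewrite iidE_prefix// ler_wpM2l ?weight_ge0//.
have [cs|cs] := leqP (sumn c) s.
  rewrite (_ : iidE _ _ _ _ = P m.+1 (s - sumn c)%N)//.
  by apply: eq_iidE => x _ _; rewrite sumn_cat -{1}(subnKC cs) eqn_add2l.
rewrite (iidE0 q_sum1).
  by rewrite divr_ge0 ?sqrtr_ge0// (conc_ge0 q_ge0 q_sum1 sum_pmf_leC).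
move=> x _ _; rewrite sumn_cat; case: eqP => // e.
by move: cs; rewrite -e ltnNge leq_addr.
Qed.

Section SteinChain.
Variables (c : seq nat) (f : nat -> R) (F D : R).
Let k := size c.
Hypothesis k_gt0 : (0 < k)%N.
Hypothesis c_letters : all (leq^~ B) c.
Hypothesis f_le : forall j, `|f j.+1| <= F.
Hypothesis f_diff : forall j, `|f j.+2 - f j.+1| <= D.

Let f_lipschitz i j : (i <= j)%N -> `|f j.+1 - f i.+1| <= D * (j - i)%N%:R.
Proof.
move=> /subnKC <-; rewrite addKn; elim: (j - i)%N => [|d IH].
  by rewrite addn0 subrr normr0 mulr0.
rewrite addnS -(subrKA (f (i + d).+1)); apply: le_trans (ler_normD _ _) _.
by rewrite -[d.+1]addn1 natrD mulrDr mulr1 addrC lerD.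
Qed.

Let F_ge0 : 0 <= F. Proof. exact: le_trans (f_le 0). Qed.
Let D_ge0 : 0 <= D. Proof. exact: le_trans (f_diff 0). Qed.

Definition occE m s : R :=
  E m (fun x => (sumn x == s)%:R * f (cyclic_occ c x).+1).

(** Cyclic and linear occurrences differ by the [k - 1] windows that straddle the
    end of the word. *)
Lemma wrap_prob m s : E (k + m.+1) (fun x => (sumn x == s)%:R *
    (cyclic_occ c x - linear_occ c x)%N%:R) <=
  k%:R * (weight c * (C / Num.sqrt m.+1%:R)).
Proof.
rewrite (@eq_iidE _ _ _ _ _ (fun x => \sum_(i <- iota m.+2 k.-1)
    (sumn x == s)%:R * (window_at c i x)%:R)); last first.
  move=> x sx _; rewrite cyclic_occ_split -/k ?k_gt0 ?sx ?leq_addr// addKn addKn.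
  rewrite -mulr_sumr -natr_sum -sum1_count; congr (_ * _%:R).
  by rewrite big_mkcond/=; apply: eq_bigr => i _; case: ifP.
rewrite iidE_sum//; apply: (@le_trans _ _ (\sum_(i <- iota m.+2 k.-1)
    weight c * (C / Num.sqrt m.+1%:R))).
  by apply: ler_sum => i _; exact: window_prob.
rewrite big_const_seq count_predT iter_addr_0 size_iota -[leLHS]mulr_natl.
rewrite ler_wpM2r ?ler_nat ?leq_pred// mulr_ge0 ?weight_ge0//.
by rewrite divr_ge0 ?sqrtr_ge0// (conc_ge0 q_ge0 q_sum1 sum_pmf_leC).
Qed.

(** The cyclic occurrences that appear when [a] is put in front of a word are in
    the [k] windows through this letter; the factor [1 / q a] is there because the
    letter is given. *)
Lemma insert_prob a m s : (a <= B)%N -> 0 < q a ->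
  E (k + m.+1) (fun y => (sumn y == s)%:R *
    (cyclic_occ c (a :: y) - linear_occ c y)%N%:R) <=
  k%:R * (weight c / q a * (C / Num.sqrt m.+1%:R)).
Proof.
move=> aB qa.
pose I := 0%N :: iota m.+3 k.-1.
rewrite (@eq_iidE _ _ _ _ _ (fun y => \sum_(i <- I)
    (sumn y == s)%:R * (window_at c i (a :: y))%:R)); last first.
  move=> y sy _; rewrite cyclic_occ_split -/k; last by rewrite k_gt0/= sy -addnS leq_addr.
  rewrite /= sy -addnS addKn linear_occ_cons.
  rewrite -mulr_sumr -natr_sum; congr (_ * _%:R).
  rewrite /I big_cons -sum1_count big_mkcond/= addnAC addnK; congr (_ + _)%N.
rewrite iidE_sum//; apply: (@le_trans _ _ (\sum_(i <- I)
    weight c / q a * (C / Num.sqrt m.+1%:R))).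
  apply: ler_sum => i _; rewrite mulrAC ler_pdivlMr// mulrC.
  have M0 : 0 <= C / Num.sqrt m.+1%:R.
    by rewrite divr_ge0 ?sqrtr_ge0// (conc_ge0 q_ge0 q_sum1 sum_pmf_leC).
  apply: le_trans (_ : E (k + m.+2) (fun x => (sumn x == a + s)%N%:R * (window_at c i x)%:R) <= _).
    rewrite (addnS k m.+1); have := @iidE_cons_le _ B q q_ge0 q_sum1 a (k + m.+1)
       (fun x => (sumn x == a + s)%N%:R * (window_at c i x)%:R) aB.
    move=> /(_ (fun=> mulr_ge0 (ler0n _ _) (ler0n _ _))); apply: le_trans.
    rewrite ler_wpM2l//; apply: ler_iidE => // x _ _ /=.
    by rewrite eqn_add2l.
  apply: le_trans (window_prob _ _ _ c_letters) _; rewrite ler_wpM2l ?weight_ge0//.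
  rewrite ler_wpM2l ?(conc_ge0 q_ge0 q_sum1 sum_pmf_leC)// lef_pV2 ?posrE ?sqrtr_gt0 ?ltr0n//.
  by rewrite ler_wsqrtr// ler_nat.
rewrite /I big_const_seq count_predT iter_addr_0 /= size_iota prednK//.
by rewrite -[leLHS]mulr_natl.
Qed.

(** Removing one letter [a]: averaging over the position of [a] compares the two
    expectations up to the fluctuation of the frequency of [a] (weighed by the
    size of [f]) and to the occurrences destroyed or created around the removed
    letter (weighed by the increments of [f]). *)
Lemma occE_remove_letter a m s : (a <= B)%N -> 0 < q a -> q a <= 1 ->
  `|occE (k + m.+1) s - occE (k + m.+2) (a + s)%N| <=
  F * (3 * C) / ((k + m.+2)%:R * Num.sqrt (q a)) +
  D * (2 * (k%:R * (weight c / q a * (C / Num.sqrt m.+1%:R)))).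
Proof.
move=> aB qa qa1.
have C0 := conc_ge0 q_ge0 q_sum1 sum_pmf_leC.
pose Gf x : R := (sumn x == a + s)%N%:R * f (cyclic_occ c x).+1.
have Gf_rot i x : Gf (rot i x) = Gf x by rewrite /Gf sumn_rot cyclic_occ_rot.
have rm := @iidE_remove_letter _ _ _ q_sum1 a (k + m.+1) _ aB qa Gf_rot.
rewrite -addnS in rm; rewrite [leRHS]addrC.
rewrite -(subrKA (E (k + m.+1) (fun y => Gf (a :: y)))).
apply: le_trans (ler_normD _ _) _; rewrite lerD//.
  rewrite /occE -iidEB; apply: le_trans; first exact: normr_iidE.
  apply: (@le_trans _ _ (E (k + m.+1) (fun y => D *
     ((sumn y == s)%:R * (cyclic_occ c (a :: y) - linear_occ c y)%N%:R +
      (sumn y == s)%:R * (cyclic_occ c y - linear_occ c y)%N%:R)))).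
    apply: ler_iidE => // y sy _; rewrite /Gf /= eqn_add2l -mulrBr normrM.
    rewrite (ger0_norm (ler0n _ _)) -mulrDr mulrCA ler_wpM2l//.
    have l1 : (linear_occ c y <= cyclic_occ c y)%N.
      by rewrite cyclic_occ_split ?leq_addr// -/k k_gt0 sy leq_addr.
    have l2 : (linear_occ c y <= cyclic_occ c (a :: y))%N.
      rewrite cyclic_occ_split -/k ?linear_occ_cons; first by rewrite -addnA addnCA leq_addr.
      by rewrite k_gt0 /= sy -addnS leq_addr.
    rewrite -(subrKA (f (linear_occ c y).+1)); apply: le_trans (ler_normD _ _) _.
    by rewrite mulrDr addrC lerD ?f_lipschitz// distrC f_lipschitz.
  rewrite iidEZl ler_wpM2l ?D_ge0// iidED mulr2n mulrDl mul1r lerD//.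
    exact: insert_prob.
  apply: le_trans (wrap_prob _ _) _; rewrite ler_wpM2l// ler_wpM2r//.
    by rewrite divr_ge0 ?sqrtr_ge0.
  by rewrite ler_pdivlMr// ler_piMr ?weight_ge0.
rewrite -/(Gf _) rm; apply: le_trans; first exact: normr_iidE.
rewrite -mulrA; apply: (@le_trans _ _ (F * E (k + m.+2) (fun x =>
   (sumn x == a + s)%N%:R * `|freq_dev q a x|))).
  rewrite -iidEZl; apply: ler_iidE => // x _ _.
  rewrite normrM mulrC [X in _ <= X]mulrA ler_wpM2r// /Gf normrM mulrC.
  by rewrite (ger0_norm (ler0n _ _)) ler_wpM2r.
rewrite ler_wpM2l ?F_ge0// !addnS.
exact: (iidE_sum_freq_dev q_ge0 q_sum1 sum_pmf_leC).
Qed.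

Lemma occE_remove_word (u : seq nat) m s :
  (forall a, a \in u -> [/\ (a <= B)%N, 0 < q a & q a <= 1]) ->
  `|occE (k + m.+1) s - occE (k + (size u + m).+1) (sumn u + s)%N| <=
  \sum_(a <- u) (F * (3 * C) / ((k + m.+1)%:R * Num.sqrt (q a)) +
    D * (2 * (k%:R * (weight c / q a * (C / Num.sqrt m.+1%:R))))).
Proof.
have C0 := conc_ge0 q_ge0 q_sum1 sum_pmf_leC.
elim: u => [|a u IH] Hu; first by rewrite big_nil !add0n subrr normr0.
have [aB qa qa1] := Hu a (mem_head _ _).
rewrite big_cons -(subrKA (occE (k + (size u + m).+1) (sumn u + s)%N)).
apply: le_trans (ler_normD _ _) _; rewrite addrC lerD//; last first.
  by apply: IH => b bu; apply: Hu; rewrite inE bu orbT.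
rewrite /= addSn -addnA; apply: le_trans (occE_remove_letter _ _ aB qa qa1) _.
apply: lerD.
  rewrite ler_wpM2l ?mulr_ge0 ?F_ge0// lef_pV2 ?posrE ?mulr_gt0 ?sqrtr_gt0 ?ltr0n ?addnS//.
  by rewrite ler_wpM2r ?sqrtr_ge0// ler_nat; lia.
rewrite ler_wpM2l ?D_ge0// ler_wpM2l// ler_wpM2l// ler_wpM2l ?divr_ge0 ?weight_ge0 ?(ltW qa)//.
rewrite ler_wpM2l// lef_pV2 ?posrE ?sqrtr_gt0 ?ltr0n//.
by rewrite ler_wsqrtr// ler_nat ltnS leq_addl.
Qed.

Hypothesis c_forest : forest_word c.
Hypothesis c_sum : (sumn c).+1 = k.

(** Occurrences of [c] cannot overlap, so conditioning on an occurrence at the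
    origin leaves an unconstrained word. *)
Lemma occE_palm m (s : nat) :
  E (k + m) (fun x => (sumn x == sumn c + s)%N%:R *
     ((cyclic_occ c x)%:R * f (cyclic_occ c x))) =
  (k + m)%:R * weight c * E m (fun y => (sumn y == s)%:R * f (linear_occ c y).+1).
Proof.
pose G x : R := (sumn x == sumn c + s)%N%:R * f (cyclic_occ c x).
have Grot i x : G (rot i x) = G x by rewrite /G sumn_rot cyclic_occ_rot.
transitivity (\sum_(i < k + m) E (k + m) (fun x => (window_at c i x)%:R * G x)).
  rewrite -iidE_sum//; apply: eq_iidE => x sx _; rewrite mulrCA -mulr_suml; congr (_ * _).
  by rewrite /cyclic_occ -sum1_count big_mkcond/= sx -natr_sum -(big_mkord xpredT (fun i => window_at c i x : nat)) /index_iota subn0.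
rewrite (eq_bigr (fun=> weight c * E m (fun y => (sumn y == s)%:R * f (linear_occ c y).+1))); last first.
  move=> i _; transitivity (E (k + m) (fun x => (window_at c 0 (rot i x))%:R * G (rot i x))).
    by apply: eq_iidE => x _ _; rewrite Grot /window_at rot0.
  rewrite (iidE_rot q_sum1 i _ (fun x => (window_at c 0 x)%:R * G x)).
  transitivity (E (size c + m) (fun x => (take (size c) x == c)%:R * G x)).
    by apply: eq_iidE => x _ _; rewrite /window_at rot0.
  rewrite iidE_prefix//; congr (_ * _); apply: eq_iidE => y _ _.
  by rewrite /G sumn_cat eqn_add2l cyclic_occ_code_cat.
by rewrite sumr_const card_ord -mulrA mulr_natl.
Qed.

Lemma stein_discrepancy m (s : nat) (lam : R) :
  (forall a, a \in c -> [/\ (a <= B)%N, 0 < q a & q a <= 1]) ->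
  lam = (k + (k + m.+1))%:R * weight c ->
  `|E (k + (k + m.+1)) (fun x => (sumn x == sumn c + s)%N%:R *
     (lam * f (cyclic_occ c x).+1 - (cyclic_occ c x)%:R * f (cyclic_occ c x)))| <=
  lam * (D * (k%:R * (weight c * (C / Num.sqrt m.+1%:R))) +
    \sum_(a <- c) (F * (3 * C) / ((k + m.+1)%:R * Num.sqrt (q a)) +
    D * (2 * (k%:R * (weight c / q a * (C / Num.sqrt m.+1%:R)))))).
Proof.
move=> Hc lamE; have lam0 : 0 <= lam by rewrite lamE mulr_ge0 ?weight_ge0.
pose Lin := E (k + m.+1) (fun y => (sumn y == s)%:R * f (linear_occ c y).+1).
have -> : E (k + (k + m.+1)) (fun x => (sumn x == sumn c + s)%N%:R *
     (lam * f (cyclic_occ c x).+1 - (cyclic_occ c x)%:R * f (cyclic_occ c x))) =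
    lam * (occE (k + (k + m).+1) (sumn c + s)%N - Lin).
  have palm : lam * Lin = E (k + (k + m.+1)) (fun x => (sumn x == sumn c + s)%N%:R *
     ((cyclic_occ c x)%:R * f (cyclic_occ c x))) by rewrite lamE -occE_palm.
  rewrite mulrBr palm -iidEZl -[(k + m).+1]addnS -iidEB; apply: eq_iidE => x _ _.
  by ring.
rewrite normrM (ger0_norm lam0) ler_wpM2l// distrC.
rewrite -(subrKA (occE (k + m.+1) s)); apply: le_trans (ler_normD _ _) _.
rewrite lerD//; last exact: occE_remove_word.
rewrite /Lin /occE -iidEB; apply: le_trans; first exact: normr_iidE.
apply: le_trans (ler_wpM2l D_ge0 (wrap_prob m s)).
rewrite -iidEZl; apply: ler_iidE => // y sy _.
rewrite -mulrBr normrM (ger0_norm (ler0n _ _)) mulrCA ler_wpM2l//.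
rewrite distrC f_lipschitz//.
by rewrite cyclic_occ_split ?leq_addr// -/k k_gt0 sy leq_addr.
Qed.

End SteinChain.

(** The bound of the Stein discrepancy for the increments [1 / lam] and the size
    [F1 / sqrt lam] of Poisson Stein solutions; [eta] bounds the weight of [c]
    with one letter left out. *)
Lemma stein_discrepancy_le (c : seq nat) (f : nat -> R) (F1 eta : R) n s
    (lam := n%:R * weight c) :
  (0 < size c)%N -> (4 * size c < n)%N ->
  (forall a, a \in c -> [/\ (a <= B)%N, 0 < q a & q a <= 1]) ->
  forest_word c -> (sumn c).+1 = size c ->
  (forall j, `|f j.+1| <= F1 / Num.sqrt lam) ->
  (forall j, `|f j.+2 - f j.+1| <= lam^-1) ->
  (forall a, a \in c -> weight c / q a <= eta) -> 0 <= F1 ->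
  `|E n (fun x => (sumn x == sumn c + s)%N%:R *
     (lam * f (cyclic_occ c x).+1 - (cyclic_occ c x)%:R * f (cyclic_occ c x)))| <=
  C / Num.sqrt n%:R * ((size c)%:R ^+ 2 * (6 * eta) + (size c)%:R * (6 * F1 * Num.sqrt eta)).
Proof.
move=> k0 kn Hc okc sumc fF fD weta F0.
have [m nE] : exists m, n = (size c + (size c + m.+1))%N.
  by exists (n - size c - (size c).+1)%N; clear - kn; lia.
have C0 := conc_ge0 q_ge0 q_sum1 sum_pmf_leC.
have w0 : 0 < weight c by rewrite /weight big_seq; apply: prodr_gt0 => a /Hc[].
have n0 : 0 < n%:R :> R by rewrite ltr0n nE; clear; lia.
have lam0 : 0 < lam by rewrite mulr_gt0.
have rn0 : 0 < Num.sqrt (n%:R : R) by rewrite sqrtr_gt0.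
have invm : C / Num.sqrt m.+1%:R <= 2 * (C / Num.sqrt n%:R).
  by apply: div_sqrt_le2; rewrite -?(ltr0n R)//; clear - kn nE; lia.
have eta0 : 0 <= eta.
  case: (c) k0 Hc weta => // a c' _ /(_ a (mem_head _ _))[_ qa _] /(_ a (mem_head _ _)).
  by apply: le_trans; rewrite divr_ge0 ?weight_ge0// ltW.
have weta' : weight c <= eta.
  case: (c) k0 Hc weta => // a c' _ /(_ a (mem_head _ _))[_ qa qa1] /(_ a (mem_head _ _)).
  by apply: le_trans; rewrite ler_pdivlMr// ler_piMr ?weight_ge0.
have := @stein_discrepancy c f (F1 / Num.sqrt lam) lam^-1 k0 _ fF fD okc sumc m s lam Hc.
rewrite -nE => /(_ _ erefl) H; apply: le_trans (H _) _.
  by apply/allP => a /Hc[].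
rewrite mulrDr mulrA divff ?gt_eqF// mul1r mulr_sumr.
set X := C / Num.sqrt n%:R in invm *; have X0 : 0 <= X by rewrite divr_ge0 ?sqrtr_ge0.
set Y := C / Num.sqrt m.+1%:R in invm *; have Y0 : 0 <= Y by rewrite divr_ge0 ?sqrtr_ge0.
set k := size c in k0 *.
have k1 : 1 <= k%:R :> R by rewrite ler1n.
have T1 : k%:R * (weight c * Y) <= 2 * (k%:R * eta * X).
  rewrite (_ : 2 * (k%:R * eta * X) = k%:R * (eta * (2 * X))); last by ring.
  by rewrite ler_wpM2l// ler_pM// weight_ge0.
have term a : a \in c -> lam * (F1 / Num.sqrt lam * (3 * C) /
      ((k + m.+1)%:R * Num.sqrt (q a)) + lam^-1 * (2 * (k%:R * (weight c / q a * Y)))) <=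
    X * (6 * F1 * Num.sqrt eta) + 4 * (k%:R * eta * X).
  move=> ac; have [aB qa qa1] := Hc a ac.
  rewrite mulrDr [X in _ + X <= _]mulrA divff ?gt_eqF// mul1r lerD//; last first.
    rewrite (_ : 4 * (k%:R * eta * X) = 2 * (k%:R * (eta * (2 * X)))); last by ring.
    by rewrite ler_wpM2l// ler_wpM2l// ler_pM ?weta// divr_ge0 ?weight_ge0// ltW.
  have sl : lam / Num.sqrt lam = Num.sqrt n%:R * Num.sqrt (weight c).
    by rewrite -{1}(sqr_sqrtr (ltW lam0)) expr2 mulfK ?gt_eqF ?sqrtr_gt0// sqrtrM.
  have sw : Num.sqrt (weight c) / Num.sqrt (q a) <= Num.sqrt eta.
    by rewrite -sqrtrV ?(ltW qa)// -sqrtrM ?weight_ge0// ler_wsqrtr// weta.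
  have inv2 : Num.sqrt n%:R / (k + m.+1)%:R <= 2 / Num.sqrt n%:R :> R.
    rewrite ler_pdivrMr ?ltr0n ?addnS// mulrAC ler_pdivlMr// -expr2 sqr_sqrtr//.
    rewrite -natrM ler_nat; clear - nE kn; rewrite /k; lia.
  rewrite (_ : lam * _ = (Num.sqrt n%:R / (k + m.+1)%:R) *
      (Num.sqrt (weight c) / Num.sqrt (q a)) * (F1 * (3 * C))); last first.
    rewrite (_ : lam * (F1 / Num.sqrt lam * (3 * C) / ((k + m.+1)%:R * Num.sqrt (q a))) =
       (lam / Num.sqrt lam) * (F1 * (3 * C) / ((k + m.+1)%:R * Num.sqrt (q a)))); last by ring.
    by rewrite sl invfM; ring.
  rewrite (_ : X * (6 * F1 * Num.sqrt eta) = (2 / Num.sqrt n%:R) * Num.sqrt eta * (F1 * (3 * C))); last first.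
    by rewrite /X; ring.
  have FC0 : 0 <= F1 * (3 * C) by rewrite mulr_ge0 ?mulr_ge0.
  rewrite ler_wpM2r//; apply: ler_pM => //.
have sumT : \sum_(a <- c) lam * (F1 / Num.sqrt lam * (3 * C) /
      ((k + m.+1)%:R * Num.sqrt (q a)) + lam^-1 * (2 * (k%:R * (weight c / q a * Y)))) <=
    k%:R * (X * (6 * F1 * Num.sqrt eta) + 4 * (k%:R * eta * X)).
  set Z := X * _ + _ in term *; rewrite (_ : k%:R * Z = \sum_(a <- c) Z); last first.
    by rewrite big_const_seq count_predT iter_addr_0 mulr_natl.
  rewrite big_seq [leRHS]big_seq; apply: ler_sum => a; exact: term.
apply: le_trans (lerD T1 sumT) _.
have h1 : 2 * (k%:R * eta * X) <= 2 * (k%:R * (k%:R * eta * X)).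
  by rewrite ler_wpM2l// ler_peMl// !mulr_ge0.
have -> : X * (k%:R ^+ 2 * (6 * eta) + k%:R * (6 * F1 * Num.sqrt eta)) =
  2 * (k%:R * (k%:R * eta * X)) + k%:R * (X * (6 * F1 * Num.sqrt eta) + 4 * (k%:R * eta * X)).
  by ring.
by rewrite lerD2r.
Qed.

End WordWeight.

(** * The law of the Galton-Watson tree *)

(** Depth-first, so that the second components spell the code of the tree. *)
Fixpoint node_degs (t : plane_tree) : seq (word * nat) :=
  let: Node ts := t in
  ([::], size ts) ::
    (fix loop (i : nat) ts := if ts is t :: ts' then
       map (fun vd => (i :: vd.1, vd.2)) (node_degs t) ++ loop i.+1 ts'
     else [::]) 0%N ts.

Definition forest_degs (i : nat) (ts : seq plane_tree) : seq (word * nat) :=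
  flatten [seq map (fun vd => (it.1 :: vd.1, vd.2)) (node_degs it.2)
          | it <- zip (iota i (size ts)) ts].

Lemma node_degsE ts : node_degs (Node ts) = ([::], size ts) :: forest_degs 0 ts.
Proof.
rewrite /=; congr (_ :: _); rewrite /forest_degs; move: 0%N.
by elim: ts => //= t ts IH i; rewrite IH.
Qed.

Lemma plane_tree_nth_ind (P : plane_tree -> Prop) :
  (forall ts, (forall i, (i < size ts)%N -> P (nth tree0 ts i)) -> P (Node ts)) ->
  forall t, P t.
Proof.
move=> IH; elim=> ts /foldr_andP H; apply: IH => i its; apply: H.
exact: mem_nth.
Qed.

Lemma mem_forest_degs i0 ts (v : word) d :
  ((v, d) \in forest_degs i0 ts) =
  [exists i : 'I_(size ts), (v == (i0 + i)%N :: behead v) &&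
     ((behead v, d) \in node_degs (nth tree0 ts i))].
Proof.
apply/flattenP/existsP => [[s /mapP[[j t] jt ->] /= /mapP[[u e] ue [-> ->]]]|].
  have := jt; rewrite -[zip _ _](mkseq_nth (0%N, tree0)) size_zip size_iota minnn.
  move=> /mapP[k]; rewrite mem_iota /= add0n => ks.
  rewrite nth_zip ?size_iota// nth_iota// => -[jE tE].
  by exists (Ordinal ks); rewrite /= -tE jE ue eqxx.
move=> [i /andP[/eqP vE vd]].
exists (map (fun vd => ((i0 + i)%N :: vd.1, vd.2)) (node_degs (nth tree0 ts i))).
  apply/mapP; exists ((i0 + i)%N, nth tree0 ts i) => //.
  rewrite -[X in X \in _](_ : nth (0%N, tree0) (zip (iota i0 (size ts)) ts) i = _).
    by apply: mem_nth; rewrite size_zip size_iota minnn.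
  by rewrite nth_zip ?size_iota// nth_iota.
by apply/mapP; exists (behead v, d) => //=; rewrite -vE.
Qed.

Lemma uniq_node_degs t : uniq (map fst (node_degs t)).
Proof.
elim/plane_tree_nth_ind: t => ts IH; rewrite node_degsE /=.
apply/andP; split.
  apply/mapP => -[[v d] /[swap] /= <-]; rewrite mem_forest_degs.
  by case/existsP.
rewrite /forest_degs; move: 0%N => i0; elim: ts i0 IH => //= t ts IHs i0 IH.
rewrite map_cat cat_uniq -map_comp IHs ?andbT; last by move=> i its; exact: (IH i.+1).
rewrite (map_comp (cons i0) fst) map_inj_uniq ?(IH 0%N)//=; last by move=> ? ? [].
apply/hasPn => v /mapP[[u d] /= ud ->]; apply/mapP => -[w _ uE].
move: ud; rewrite uE -/(forest_degs _ _) mem_forest_degs => /existsP[i].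
by move=> /andP[/eqP[]]; clear; lia.
Qed.

Lemma node_degs_code t : map snd (node_degs t) = code t.
Proof.
elim/plane_tree_nth_ind: t => ts IH; rewrite node_degsE /=; congr (_ :: _).
rewrite /forest_degs; move: 0%N => i0; elim: ts i0 IH => //= t ts IHs i0 IH.
rewrite map_cat -map_comp IHs; last by move=> i its; exact: (IH i.+1).
by congr (_ ++ _); rewrite -(IH 0%N)//.
Qed.

Lemma grown_tree_cons c (i : nat) u :
  grown_tree c (i :: u) <->
  (i < c [::])%N /\ grown_tree (fun v => c (i :: v)) u.
Proof.
split=> [g|[ic g] v j].
  split; first by apply: (g [::] i); rewrite /= eqxx prefix0s.
  by move=> v j vu; apply: (g (i :: v) j); rewrite /= eqxx.
case: v => [|i' v] /=; first by move=> /andP[/eqP-> _].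
by move=> /andP[/eqP-> vu]; exact: g.
Qed.

Lemma grown_tree_nil c : grown_tree c [::].
Proof. by move=> [|i v] j. Qed.

Lemma is_node_cons (i : nat) u ts : is_node (i :: u) (Node ts) =
  (i < size ts)%N && is_node u (nth tree0 ts i).
Proof.
rewrite /=; case: ltnP => its; first by rewrite onthE (nth_map tree0).
by rewrite onth_default.
Qed.

(** That the tree grown from [c] be [t] is a condition on the values of [c] at the
    nodes of [t] only. By independence its probability is therefore the product of
    the weights of the letters of the code. *)
Lemma grown_treeP c t : grown_tree c = [set v | is_node v t] <->
  (forall v d, (v, d) \in node_degs t -> c v = d).
Proof.
elim/plane_tree_nth_ind: t c => ts IH c.
have step : grown_tree c = [set v | is_node v (Node ts)] <->
    c [::] = size ts /\ forall i, (i < size ts)%N ->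
      grown_tree (fun v => c (i :: v)) = [set v | is_node v (nth tree0 ts i)].
  split=> [gE|[c0 gE]].
    have lt i : (i < c [::])%N = (i < size ts)%N.
      apply/idP/idP => [ic|its].
        have : grown_tree c [:: i].
          by apply/grown_tree_cons; split=> //; exact: grown_tree_nil.
        by rewrite gE /= -[X in is_true X]/(is_node [:: i] (Node ts)) is_node_cons => /andP[].
      have : grown_tree c [:: i] by rewrite gE /= -[X in is_true X]/(is_node [:: i] (Node ts)) is_node_cons its.
      by move/grown_tree_cons => [].
    have c0 : c [::] = size ts.
      apply/eqP; rewrite eqn_leq; apply/andP; split; rewrite leqNgt.
        by rewrite lt ltnn.
      by rewrite -lt ltnn.
    split=> // i its; apply/seteqP; split=> u /=.
      move=> gu; have : grown_tree c (i :: u) by apply/grown_tree_cons; rewrite c0.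
      by rewrite gE -[_ (i :: u)]/(is_true (is_node (i :: u) (Node ts))) is_node_cons => /andP[].
    move=> iu; have : grown_tree c (i :: u).
      by rewrite gE -[_ (i :: u)]/(is_true (is_node (i :: u) (Node ts))) is_node_cons its.
    by move/grown_tree_cons => [].
  apply/seteqP; split=> -[|i u] //.
  - move/grown_tree_cons => [ic gu]; rewrite c0 in ic.
    rewrite -[_ (i :: u)]/(is_true (is_node (i :: u) (Node ts))) is_node_cons ic /=.
    by move: gu; rewrite gE.
  - by move=> _; exact: grown_tree_nil.
  - rewrite -[_ (i :: u)]/(is_true (is_node (i :: u) (Node ts))) is_node_cons => /andP[its iu].
    by apply/grown_tree_cons; rewrite c0; split=> //; rewrite gE.
rewrite step node_degsE; split=> [[c0 gE] v d|H].
  rewrite inE => /predU1P[[-> ->]//|]; rewrite mem_forest_degs.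
  move=> /existsP[i /andP[/eqP vE vd]]; rewrite vE.
  have /(IH i (ltn_ord i)) := gE i (ltn_ord i); exact.
split=> [|i its]; first by apply: H; rewrite inE eqxx.
apply/(IH i its) => v d vd; apply: H; rewrite inE mem_forest_degs; apply/orP; right.
by apply/existsP; exists (Ordinal its); rewrite /= eqxx.
Qed.

Lemma is_node_inj t t' : [set v | is_node v t] = [set v | is_node v t'] -> t = t'.
Proof.
elim/plane_tree_nth_ind: t t' => ts IH [ts'] E.
have E' v : is_node v (Node ts) = is_node v (Node ts').
  by apply/idP/idP; [move: (congr1 (fun A => A v) E) => /= -> |move: (congr1 (fun A => A v) E) => /= <-].
have lt i : (i < size ts)%N = (i < size ts')%N.
  by have := E' [:: i]; rewrite !is_node_cons !andbT.
have ss : size ts = size ts'.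
  by apply/eqP; rewrite eqn_leq; apply/andP; split; rewrite leqNgt; [rewrite lt ltnn|rewrite -lt ltnn].
congr Node; apply: (@eq_from_nth _ tree0) => // i its.
apply: IH => //; apply/seteqP; split=> u /= iu.
  have := E' (i :: u); rewrite !is_node_cons its -lt its /= iu; exact.
have := E' (i :: u); rewrite !is_node_cons its -lt its /= iu => ->; exact.
Qed.

Section GaltonWatsonLaw.
Context {R : realType} {d d' : measure_display}
  {S : measurableType d} {Omega : measurableType d'}.
Variables (Q : probability S R) (P : probability Omega R).
Variables (xi : {RV Q >-> nat}) (X : word -> {RV P >-> nat}).
Hypothesis iid_X : iid_copies xi X.

Definition offspring_pmf (a : nat) : R := fine (distribution Q xi [set a]).
Local Notation p := offspring_pmf.

Lemma offspring_pmfE a : distribution Q xi [set a] = (p a)%:E.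
Proof. by rewrite /p fineK// fin_num_measure. Qed.

Lemma offspring_pmf_ge0 a : 0 <= p a.
Proof. by rewrite fine_ge0. Qed.

Let tree_event t : set Omega := [set w | gw_tree X w = [set v | is_node v t]].

Let degree_at t v := nth 0%N (map snd (node_degs t)) (index v (map fst (node_degs t))).

Let degree_atE t v e : (v, e) \in node_degs t -> degree_at t v = e.
Proof.
move=> /(nthP ([::], 0%N))[i ilt iE].
have -> : v = nth [::] (map fst (node_degs t)) i by rewrite (nth_map ([::], 0%N)) ?iE.
by rewrite /degree_at index_uniq ?size_map ?uniq_node_degs// (nth_map ([::], 0%N)) ?iE.
Qed.

Lemma tree_eventE t : tree_event t =
  \bigcap_(v in [set` map fst (node_degs t)])
    (X v @^-1` [set degree_at t v]).
Proof.
apply/seteqP; split=> w.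
  move=> /grown_treeP H v /= /mapP[[u e] /[dup] ue /degree_atE uE ->] /=.
  by rewrite uE (H _ _ ue).
move=> H; apply/grown_treeP => v e ve; rewrite -(degree_atE ve).
by apply: (H v); apply/mapP; exists (v, e).
Qed.

Lemma measurable_tree_event t : measurable (tree_event t).
Proof.
rewrite tree_eventE; apply: fin_bigcap_measurable; first exact: finite_seq.
by move=> v _; exact: measurable_funPTI.
Qed.

Lemma prob_tree_event t : P (tree_event t) = (weight p (code t))%:E.
Proof.
case: iid_X => same indep.
rewrite tree_eventE (indep _ (fun v => [set degree_at t v]) (uniq_node_degs t)).
rewrite -node_degs_code /weight -prodEFin.
rewrite big_map [RHS]big_map; apply: eq_big_seq => -[v e] ve /=.
by rewrite (degree_atE ve) -offspring_pmfE -(same v).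
Qed.

Lemma gw_piE T : gw_pi X T = weight p (code T).
Proof.
rewrite /gw_pi /gw_law (_ : [set w | _] = tree_event T) ?prob_tree_event//.
apply/seteqP; split=> w /=; first by move=> [t ->].
by exists T.
Qed.

Fixpoint words (B m : nat) : seq (seq nat) :=
  if m is m'.+1 then [seq a :: x | a <- iota 0 B.+1, x <- words B m'] else [:: [::]].

Lemma wordsS B m : words B m.+1 = [seq a :: x | a <- iota 0 B.+1, x <- words B m].
Proof. by []. Qed.

Lemma iidE_words (B : nat) (q : nat -> R) m F :
  iidE B q m F = \sum_(x <- words B m) weight q x * F x.
Proof.
elim: m F => [|m IH] F; first by rewrite /= big_seq1 /weight big_nil mul1r.
rewrite wordsS.
rewrite big_allpairs_dep [LHS]/= -(big_mkord xpredT (fun a => q a * iidE B q m (fun x => F (a :: x)))).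
rewrite /index_iota subn0; apply: eq_bigr => a _; rewrite IH mulr_sumr.
by apply: eq_bigr => x _; rewrite mulrA /weight big_cons.
Qed.

Lemma mem_words (B m : nat) x :
  (x \in words B m) = (size x == m) && all (leq^~ B) x.
Proof.
elim: m x => [|m IH] x; first by rewrite /= inE; case: x.
rewrite wordsS.
apply/idP/idP => [/allpairsPdep[a [y [ai yw ->]]]|].
  move: yw ai; rewrite IH mem_iota => /andP[/eqP <- yB] /=; rewrite eqxx yB andbT.
  by rewrite add0n ltnS.
case: x => [//|a x]; rewrite [size _]/= eqSS [all _ _]/= => /and3P[sx aB xB].
apply/allpairsPdep; exists a, x; split=> //; last by rewrite IH sx xB.
by rewrite mem_iota add0n ltnS.
Qed.

Lemma uniq_words (B m : nat) : uniq (words B m).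
Proof.
elim: m => // m IH.
rewrite wordsS.
apply: allpairs_uniq => //; first exact: iota_uniq.
by move=> [a x] [b y] _ _ /= [-> ->].
Qed.

Lemma all_leq_sumn (n : nat) x : (sumn x < n)%N -> all (fun a => a < n)%N x.
Proof.
elim: x => //= a x IH h; rewrite IH ?andbT; first by apply: leq_ltn_trans h; exact: leq_addr.
by apply: leq_ltn_trans h; exact: leq_addl.
Qed.

Lemma eq_weight (q q' : nat -> R) x :
  (forall a, a \in x -> q a = q' a) -> weight q x = weight q' x.
Proof. by move=> qq; rewrite /weight; apply: eq_big_seq. Qed.

(** Only trees with [n] nodes are concerned, whose codes are words of [n] letters
    smaller than [n]; hence any alphabet [0 .. n] whose weights agree with the
    offspring law below [n] computes the probability. *)
Lemma gw_law_size (n : nat) (q : nat -> R) (E : set plane_tree) :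
  (forall a, (a < n)%N -> q a = p a) ->
  gw_law X ([set t | tree_size t = n] `&` E) =
  (iidE n q n (fun x => (((sumn x).+1 == n) && forest_word x)%:R *
     (`[< E (head tree0 (parse x)) >])%:R))%:E.
Proof.
move=> qp.
pose good x := ((sumn x).+1 == n) && forest_word x && `[< E (head tree0 (parse x)) >].
pose L := [seq head tree0 (parse x) | x <- words n n & good x].
have goodP x : x \in words n n -> good x ->
    code (head tree0 (parse x)) = x.
  rewrite mem_words => /andP[/eqP sx _] /andP[/andP[/eqP sn okx] _].
  by have [] := parse_treeP okx; rewrite ?sn ?sx.
have uL : uniq L.
  rewrite map_inj_in_uniq ?filter_uniq ?uniq_words// => x y.
  rewrite !mem_filter => /andP[gx wx] /andP[gy wy] /(congr1 code).
  by rewrite !goodP.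
have -> : gw_law X ([set t | tree_size t = n] `&` E) =
    P (\bigcup_(t in [set` L]) tree_event t).
  congr (P _); apply/seteqP; split=> w [t].
    move=> [/= tn Et] wt; exists t => //=; apply/mapP; exists (code t).
      have [okt st] := forest_word_code t.
      rewrite mem_filter /good parse_code st size_code tn eqxx okt /= asboolT//=.
      rewrite mem_words size_code tn eqxx /=.
      have := @all_leq_sumn n (code t); rewrite -tn -size_code -st leqnn => /(_ isT).
      by apply: sub_all => a /ltnW.
    by rewrite parse_code.
  move=> /= /mapP[x]; rewrite mem_filter => /andP[gx wx] tE wt; exists t => //.
  split=> /=; last by rewrite tE; move: gx => /andP[_ /asboolP].
  by rewrite -size_code tE goodP//; move: wx; rewrite mem_words => /andP[/eqP].
have triv : trivIset [set` L] tree_event.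
  apply/trivIsetP => t t' _ _ /eqP tt'; apply/seteqP; split=> // w [/= wt wt'].
  by apply: tt'; apply: is_node_inj; rewrite -wt -wt'.
rewrite (measure_fin_bigcup _ (finite_seq L) triv); last first.
  by move=> t _; exact: measurable_tree_event.
rewrite -fsbig_seq// /L big_map big_filter iidE_words -sumEFin big_mkcond/=.
apply: eq_big_seq => x wx; rewrite -natrM mulnb -/(good x); case: ifPn => gx.
  rewrite prob_tree_event goodP// mulr1; congr (_%:E); apply: eq_weight => a ax.
  apply/esym/qp; move: gx => /andP[/andP[/eqP sn _] _].
  have /allP lt : all (fun a => a < n)%N x by apply: all_leq_sumn; rewrite -sn.
  exact: lt.
by rewrite mulr0.
Qed.

(** By the cycle lemma the code of the tree may be replaced by a word subject
    only to the constraint on its sum. *)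
Lemma gw_law_size_cycle (n : nat) (q : nat -> R) (G : seq nat -> bool) :
  (forall a, 0 <= q a) -> \sum_(a < n.+1) q a = 1 -> (0 < n)%N ->
  (forall i x, G (rot i x) = G x) ->
  iidE n q n (fun x => (((sumn x).+1 == n) && forest_word x)%:R * (G x)%:R) =
  n%:R^-1 * iidE n q n (fun x => ((sumn x).+1 == n)%:R * (G x)%:R).
Proof.
move=> q0 q1 n0 Grot.
have -> : iidE n q n (fun x => ((sumn x).+1 == n)%:R * (G x)%:R) =
  \sum_(i < n) iidE n q n (fun x => (((sumn (rot i x)).+1 == n) && forest_word (rot i x))%:R *
     (G (rot i x))%:R).
  rewrite -iidE_sum//; apply: eq_iidE => x sx _.
  under eq_bigr do rewrite Grot sumn_rot.
  rewrite -mulr_suml; congr (_ * _); case: eqP => [sn|_]; last by rewrite big1.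
  by rewrite -natr_sum -sx cycle_lemma// sx.
under eq_bigr => i _ do rewrite
  (iidE_rot q1 i n (fun x => (((sumn x).+1 == n) && forest_word x)%:R * (G x)%:R)).
by rewrite sumr_const card_ord -[X in _ = _ * X]mulr_natl mulKf// pnatr_eq0 -lt0n.
Qed.

Lemma fringe_count_lawE (n : nat) (q : nat -> R) (T : plane_tree) (A : set nat) :
  (forall a, 0 <= q a) -> \sum_(a < n.+1) q a = 1 -> (0 < n)%N ->
  (forall a, (a < n)%N -> q a = p a) ->
  0 < sum_pmf n q n n.-1 ->
  fringe_count_law X n T A =
  (iidE n q n (fun x => (sumn x == n.-1)%:R * (cyclic_occ (code T) x \in A)%:R) /
   sum_pmf n q n n.-1)%:E.
Proof.
move=> q0 q1 n0 qp pos; rewrite /fringe_count_law /gw_cond_law.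
have nR : n%:R != 0 :> R by rewrite pnatr_eq0 -lt0n.
have sE x : (((sumn x).+1 == n) = (sumn x == n.-1)).
  by rewrite -[in LHS](prednK n0) eqSS.
have -> : gw_law X ([set t | tree_size t = n] `&` (fringe_count T @^-1` A)) =
    (n%:R^-1 * iidE n q n (fun x => (sumn x == n.-1)%:R *
      (cyclic_occ (code T) x \in A)%:R))%:E.
  rewrite (gw_law_size _ qp).
  rewrite -(@eq_iidE _ _ _ _ (fun x => ((sumn x).+1 == n)%:R * (cyclic_occ (code T) x \in A)%:R)
    (fun x => (sumn x == n.-1)%:R * (cyclic_occ (code T) x \in A)%:R));
    last by move=> x _ _; rewrite sE.
  rewrite -gw_law_size_cycle//; last by move=> i x; rewrite cyclic_occ_rot.
  congr (_%:E); apply: eq_iidE => x sx _.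
  case: (boolP (_ && _)) => [/andP[/eqP sn okx]|_]; last by rewrite !mul0r.
  rewrite !mul1r; congr ((_ : bool)%:R).
  rewrite -[LHS]/(`[< A (fringe_count T (head tree0 (parse x))) >]) fringe_count_code.
  have [|_ ->] := parse_treeP okx; first by rewrite sn sx.
  by apply/idP/idP => [/asboolP ?|]; rewrite in_setE.
have -> : gw_law X [set t | tree_size t = n] = (n%:R^-1 * sum_pmf n q n n.-1)%:E.
  rewrite -[X in gw_law _ X]setIT (gw_law_size _ qp).
  rewrite (@eq_iidE _ _ _ _ _ (fun x => (((sumn x).+1 == n) && forest_word x)%:R * (true : bool)%:R));
    last by move=> x _ _; rewrite asboolT.
  rewrite (@gw_law_size_cycle n q (fun=> true))//; congr ((_ * _)%:E).
  by apply: eq_iidE => x _ _; rewrite mulr1 sE.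
rewrite inver ifF; last by apply/negbTE; rewrite mulf_neq0 ?invr_eq0// gt_eqF.
by rewrite -EFinM; congr (_%:E); field; rewrite nR gt_eqF.
Qed.

End GaltonWatsonLaw.

(** * Moments of the offspring law and truncation of the alphabet *)

Section Series.
Context {R : realType}.

(** Convergence of a series of nonnegative terms, in terms of finite sums only. *)
Definition nonneg_series_sum (u : nat -> R) (s : R) : Prop :=
  (forall N, \sum_(i < N) u i <= s) /\
  (forall e : R, 0 < e -> exists N, s - e <= \sum_(i < N) u i).

Lemma nneseries_sum (u : nat -> R) (s : R) : (forall i, 0 <= u i) ->
  (\sum_(i <oo) (u i)%:E = s%:E)%E -> nonneg_series_sum u s.
Proof.
move=> u0 us; have u0' i : (0 <= i)%N -> true -> (0 <= (u i)%:E)%E by rewrite lee_fin.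
split=> [N|e e0].
  have := @nneseries_lim_ge R (fun i => (u i)%:E) xpredT 0 N u0'.
  by rewrite us sumEFin lee_fin big_mkord.
apply: contrapT => no.
have : (\sum_(i <oo) (u i)%:E <= (s - e)%:E)%E.
  apply: lime_le; first exact: is_cvg_nneseries.
  apply: nearW => N; rewrite sumEFin lee_fin big_mkord leNgt; apply/negP => lt.
  by apply: no; exists N; exact: ltW.
by rewrite us lee_fin lerBrDr gerDl leNgt e0.
Qed.

Lemma nonneg_series_sum_ext (u : nat -> R) s e : (forall i, 0 <= u i) ->
  nonneg_series_sum u s -> 0 < e ->
  exists N, forall n, (N <= n)%N -> s - e <= \sum_(i < n) u i.
Proof.
move=> u0 [_ us] e0; have [N NP] := us e e0; exists N => n Nn.
apply: le_trans NP _; rewrite -!(big_mkord xpredT u) (@big_cat_nat _ _ _ N 0 n)//=.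
by rewrite lerDl sumr_ge0.
Qed.

End Series.

Section Truncation.
Context {R : realType}.
Variable p : nat -> R.
Hypothesis p_ge0 : forall a, 0 <= p a.
Hypothesis p_sum : nonneg_series_sum p 1.
Hypothesis p_mean : nonneg_series_sum (fun a => a%:R * p a) 1.
Variable V : R.
Hypothesis p_sqr : forall N, \sum_(a < N) a%:R ^+ 2 * p a <= V.

(** The law of the minimum of [B] and of a variable with law [p]. As the code of a
    tree with [B] nodes has letters less than [B], its weight does not change. *)
Definition trunc_pmf (B a : nat) : R :=
  if (a < B)%N then p a else if a == B then 1 - \sum_(i < B) p i else 0.

Lemma trunc_pmf_lt B a : (a < B)%N -> trunc_pmf B a = p a.
Proof. by rewrite /trunc_pmf => ->. Qed.

Lemma trunc_pmf_ge0 B a : 0 <= trunc_pmf B a.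
Proof.
rewrite /trunc_pmf; case: ifP => // _; case: ifP => // _.
by rewrite subr_ge0; apply: p_sum.1.
Qed.

Lemma letterE_trunc B (g : nat -> R) :
  letterE B (trunc_pmf B) g =
  \sum_(a < B) p a * g a + (1 - \sum_(i < B) p i) * g B.
Proof.
rewrite /letterE big_ord_recr/= {2}/trunc_pmf ltnn eqxx; congr (_ + _).
by apply: eq_bigr => a _; rewrite trunc_pmf_lt.
Qed.

Lemma trunc_pmf_sum B : \sum_(a < B.+1) trunc_pmf B a = 1.
Proof.
have := letterE_trunc B (fun=> 1); rewrite mulr1 /letterE.
under eq_bigr do rewrite mulr1; move=> ->.
under eq_bigr do rewrite mulr1.
by rewrite addrCA subrr addr0.
Qed.

Let part (u : nat -> R) (B d : nat) :
  \sum_(i < B + d) u i = \sum_(i < B) u i + \sum_(i < d) u (B + i)%N.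
Proof. by rewrite big_split_ord. Qed.

(** The mean lost by truncation is at most [V / B], by the second moment. *)
Lemma trunc_pmf_mean B : 0 <= B%:R * (1 - letterE B (trunc_pmf B) (fun a => a%:R)) <= V.
Proof.
have p0 := p_ge0; have sq := p_sqr.
rewrite letterE_trunc.
have comm : \sum_(a < B) p a * a%:R = \sum_(a < B) a%:R * p a.
  by apply: eq_bigr => a _; rewrite mulrC.
rewrite comm; set S1 := \sum_(a < B) _; set S0 := \sum_(i < B) _.
have tail d : \sum_(i < d) i%:R * p (B + i)%N =
    (\sum_(a < B + d) a%:R * p a - S1) - B%:R * (\sum_(a < B + d) p a - S0).
  have ad (x y : R) : x + y - x = y by rewrite addrAC subrr add0r.
  rewrite (part (fun a => a%:R * p a)) (part p) /S1 /S0 !ad mulr_sumr -sumrB.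
  by apply: eq_bigr => i _; rewrite natrD; ring.
have tail_sq d : B%:R * (\sum_(i < d) i%:R * p (B + i)%N) <= V.
  apply: le_trans (sq (B + d)%N); rewrite (part (fun a => a%:R ^+ 2 * p a)) mulr_sumr.
  apply: (@le_trans _ _ (\sum_(i < d) (B + i)%N%:R ^+ 2 * p (B + i)%N)); last first.
    by rewrite lerDr sumr_ge0// => i _; rewrite mulr_ge0// sqr_ge0.
  apply: ler_sum => i _; rewrite mulrA ler_wpM2r// -natrX -natrM ler_nat.
  by rewrite expnS expn1 leq_mul// ?leq_addr ?leq_addl.
have pm := p_mean.1; have ps := p_sum.1.
have lim e : 0 < e -> exists d, 1 - e <= \sum_(a < B + d) a%:R * p a /\
    1 - e <= \sum_(a < B + d) p a.
  move=> e0; have u0 i : 0 <= i%:R * p i by rewrite mulr_ge0.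
  have [n1 h1] := nonneg_series_sum_ext u0 p_mean e0.
  have [n2 h2] := nonneg_series_sum_ext p_ge0 p_sum e0.
  exists (n1 + n2)%N; split; [apply: h1 | apply: h2]; clear; lia.
set M := S1 + _; have ME : 1 - M = (1 - S1) - B%:R * (1 - S0) by rewrite /M; ring.
have M0 : 0 <= 1 - M.
  apply: ler_of_addgt0 => e e0.
  have B1 : 0 < B%:R + 1 :> R by rewrite ltr_wpDl.
  have [d [d1 d2]] := lim (e / (B%:R + 1)) (divr_gt0 e0 B1).
  have t0 : 0 <= \sum_(i < d) i%:R * p (B + i)%N by apply: sumr_ge0 => i _; rewrite mulr_ge0.
  rewrite tail in t0; rewrite ME.
  have := pm (B + d)%N; have := ps (B + d)%N => hs hm.
  have : B%:R * (1 - e / (B%:R + 1)) <= B%:R * \sum_(a < B + d) p a by rewrite ler_wpM2l.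
  have -> : B%:R * (1 - e / (B%:R + 1)) = B%:R - (e - e / (B%:R + 1)).
    by field; rewrite gt_eqF.
  have : 0 < e / (B%:R + 1) by rewrite divr_gt0.
  move: t0 hm; rewrite !mulrBr; move: (B%:R * _) (B%:R * _) (e / _) (\sum_(a < B + d) a%:R * p a) => x y z t.
  by lra.
rewrite mulr_ge0//=; apply: ler_of_addgt0 => e e0.
have B1 : 0 < B%:R + 1 :> R by rewrite ltr_wpDl.
have [d [d1 d2]] := lim (e / (B%:R + 1)) (divr_gt0 e0 B1).
have := tail_sq d; rewrite tail ME => ts.
have hs := ps (B + d)%N.
have h1 : B%:R * (1 - S1 - B%:R * (1 - S0)) <= B%:R * (\sum_(a < B + d) a%:R * p a - S1 -
   B%:R * (\sum_(a < B + d) p a - S0) + e / (B%:R + 1)).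
  rewrite ler_wpM2l//.
  have : B%:R * (\sum_(a < B + d) p a - S0) <= B%:R * (1 - S0) by rewrite ler_wpM2l// lerD2r.
  move: (B%:R * _) (B%:R * _) (e / _) d1 => x y z d1; lra.
apply: le_trans h1 _; rewrite mulrDr lerD//.
by rewrite mulrCA ler_piMr ?(ltW e0)// ler_pdivrMr// mul1r lerDl.
Qed.

Lemma trunc_pmf_sqr B : letterE B (trunc_pmf B) (fun a => a%:R ^+ 2) <= V.
Proof.
have p0 := p_ge0; have sq := p_sqr.
rewrite letterE_trunc.
apply: ler_of_addgt0 => e e0.
have B1 : 0 < B%:R ^+ 2 + 1 :> R by rewrite ltr_wpDl// sqr_ge0.
have [n h] := nonneg_series_sum_ext p_ge0 p_sum (divr_gt0 e0 B1).
have := h (B + n)%N (leq_addl _ _); rewrite (part p) => hn.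
apply: le_trans (_ : \sum_(a < B + n) a%:R ^+ 2 * p a + e <= _); last by rewrite lerD2r.
rewrite (part (fun a => a%:R ^+ 2 * p a)) -addrA.
have -> : \sum_(a < B) p a * a%:R ^+ 2 = \sum_(a < B) a%:R ^+ 2 * p a.
  by apply: eq_bigr => a _; rewrite mulrC.
rewrite lerD2l.
apply: (@le_trans _ _ ((\sum_(i < n) p (B + i)%N + e / (B%:R ^+ 2 + 1)) * B%:R ^+ 2)).
  by rewrite ler_wpM2r ?sqr_ge0//; lra.
rewrite mulrDl lerD//.
  rewrite mulr_suml; apply: ler_sum => i _; rewrite mulrC ler_wpM2r//.
  by rewrite lerXn2r ?nnegrE// ler_nat leq_addr.
by rewrite mulrAC -mulrA ler_piMr ?(ltW e0)// ler_pdivrMr// mul1r lerDl.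
Qed.

End Truncation.

Section OffspringMoments.
Context {R : realType} {d : measure_display} {S : measurableType d}.
Variables (Q : probability S R) (xi : {RV Q >-> nat}).
Local Notation p := (offspring_pmf xi).

Lemma integral_offspring (g : nat -> R) : (forall i, 0 <= g i) ->
  (\int[Q]_s (g (xi s))%:E = \sum_(i <oo) (g i * p i)%:E)%E.
Proof.
move=> g0.
have mF k : measurable (xi @^-1` [set k]) by exact: measurable_funPTI.
have covT : \bigcup_k (xi @^-1` [set k]) = setT.
  by apply/seteqP; split=> // s _; exists (xi s).
rewrite -covT ge0_integral_bigcup//; last first.
- apply/trivIsetP => i j _ _ /eqP ij; apply/seteqP; split=> // s [/= si sj].
  by apply: ij; rewrite -si -sj.
- by move=> s _; rewrite lee_fin.
- rewrite covT => _ Y mY; rewrite setTI.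
  exact: (measurable_funPTI xi (_ : measurable [set i | Y (g i)%:E])).
apply: eq_eseriesr => i _.
rewrite (eq_integral (fun=> (g i)%:E)); last by move=> s; rewrite inE /= => ->.
by rewrite integral_cst// EFinM -offspring_pmfE.
Qed.

Hypothesis mean_xi : ('E_Q[fun s => (xi s)%:R] = 1)%E.
Hypothesis var_xi : (0 < 'V_Q[fun s => ((xi s)%:R : R)] < +oo)%E.

Lemma offspring_sum : nonneg_series_sum p 1.
Proof.
apply: nneseries_sum; first by move=> i; exact: offspring_pmf_ge0.
have := @integral_offspring (fun=> 1) (fun=> ler01).
rewrite integral_cst//= mul1e probability_setT => ->.
by apply: eq_eseriesr => i _; rewrite mul1r.
Qed.

Lemma offspring_mean : nonneg_series_sum (fun a => a%:R * p a) 1.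
Proof.
apply: nneseries_sum; first by move=> i; rewrite mulr_ge0// offspring_pmf_ge0.
by rewrite -(integral_offspring (g := fun a => a%:R))// -mean_xi unlock.
Qed.

Lemma offspring_var : exists2 v : R, 0 < v &
  nonneg_series_sum (fun a => (a%:R - 1) ^+ 2 * p a) v.
Proof.
have := var_xi; rewrite /variance unlock mean_xi /= unlock.
set I := integral _ _ _; have -> : I = (\int[Q]_s (((xi s)%:R - 1) ^+ 2)%:E)%E by [].
rewrite (integral_offspring (g := fun a => (a%:R - 1) ^+ 2)); last by move=> i; exact: sqr_ge0.
set Z := (\sum_(i <oo) _)%E => /andP[Z0 Zoo].
have Zfin : Z = (fine Z)%:E by rewrite fineK// ge0_fin_numE// ltW.
exists (fine Z); first by rewrite -lte_fin -Zfin.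
by apply: nneseries_sum => // i; rewrite mulr_ge0 ?sqr_ge0// offspring_pmf_ge0.
Qed.

Lemma offspring_sqr : exists2 V : R, 1 <= V &
  forall N, \sum_(a < N) a%:R ^+ 2 * p a <= V.
Proof.
have [v v0 [vle _]] := offspring_var; exists (2 * v + 2); first by lra.
move=> N; apply: (@le_trans _ _ (2 * (\sum_(a < N) (a%:R - 1) ^+ 2 * p a) + 2 * \sum_(a < N) p a)).
  rewrite !mulr_sumr -big_split/=; apply: ler_sum => a _; rewrite mulrA -mulrDl.
  rewrite ler_wpM2r ?offspring_pmf_ge0//.
  by have := sqr_ge0 ((a : nat)%:R - 2 : R); rewrite !expr2; lra.
apply: lerD; first by rewrite ler_wpM2l// vle.
by rewrite -[leRHS]mulr1 ler_wpM2l// offspring_sum.1.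
Qed.

(** A law with mean one that is not concentrated at one charges zero: were it to
    charge only the positive integers, its excess over one would have mean zero. *)
Lemma offspring_pos0 : 0 < p 0%N.
Proof.
rewrite lt_neqAle offspring_pmf_ge0 andbT eq_sym; apply/eqP => p00.
have [v v0 [_ vge]] := offspring_var.
have exc a : a%:R * p a - p a = (a.-1)%:R * p a.
  by case: a => [|a]; [rewrite p00; ring | rewrite -[a.+1]addn1 natrD /= addn1 /=; ring].
have exc0 a : (a.-1)%:R * p a = 0.
  apply/eqP; rewrite eq_le mulr_ge0 ?offspring_pmf_ge0// andbT.
  apply: ler_of_addgt0 => e e0.
  have [N hN] := nonneg_series_sum_ext (offspring_pmf_ge0 xi) offspring_sum e0.
  have := hN (N + a.+1)%N (leq_addr _ _); have := offspring_mean.1 (N + a.+1)%N.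
  have : (a.-1)%:R * p a <= \sum_(i < N + a.+1) (i.-1)%:R * p i.
    have aN : (a < N + a.+1)%N by rewrite addnS ltnS leq_addl.
    rewrite (bigD1 (Ordinal aN))//= lerDl sumr_ge0// => i _.
    by rewrite mulr_ge0// offspring_pmf_ge0.
  under eq_bigr => i _ do rewrite -exc.
  by rewrite sumrB; lra.
have [N hN] := vge (v / 2) (divr_gt0 v0 (ltr0n _ 2)).
have : \sum_(i < N) (i%:R - 1) ^+ 2 * p i = 0.
  apply: big1 => -[[|a] aN] _ /=; first by rewrite p00 mulr0.
  rewrite -[a.+1]addn1 natrD addrK expr2 -mulrA addn1.
  by have := exc0 a.+1; rewrite /= => ->; rewrite mulr0.
by move=> s0; rewrite s0 in hN; lra.
Qed.

Lemma offspring_pos_letter : exists2 b, (0 < b)%N & 0 < p b.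
Proof.
apply: contrapT => no.
have h0 : 0 < 2^-1 :> R by rewrite invr_gt0.
have [N hN] := offspring_mean.2 2^-1 h0.
have : \sum_(i < N) i%:R * p i = 0.
  apply: big1 => -[[|a] aN] _ /=; first by rewrite mul0r.
  suff -> : p a.+1 = 0 by rewrite mulr0.
  apply/eqP; rewrite eq_le offspring_pmf_ge0 andbT leNgt; apply/negP => pa.
  by apply: no; exists a.+1.
by move=> s0; rewrite s0 in hN; lra.
Qed.

Lemma offspring_max : exists2 theta : R, 0 < theta < 1 & forall a, p a <= theta.
Proof.
have [b b0 pb] := offspring_pos_letter; have p0 := offspring_pos0.
have pair a a' : a != a' -> p a + p a' <= 1.
  move=> aa'; apply: le_trans (offspring_sum.1 (a + a').+1).
  have aN : (a < (a + a').+1)%N by rewrite ltnS leq_addr.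
  have aN' : (a' < (a + a').+1)%N by rewrite ltnS leq_addl.
  rewrite (bigD1 (Ordinal aN))//= (bigD1 (Ordinal aN'))//=; last first.
    by rewrite -val_eqE /= eq_sym.
  by rewrite addrA lerDl sumr_ge0// => i _; exact: offspring_pmf_ge0.
exists (1 - Num.min (p 0%N) (p b)).
  have := pair 0%N b; rewrite ltn_eqF// => /(_ isT).
  by case: (leP (p 0%N) (p b)) => _ h; apply/andP; split; lra.
move=> a; have [->|a0] := eqVneq a 0%N.
  have := pair 0%N b; rewrite ltn_eqF// => /(_ isT).
  by case: (leP (p 0%N) (p b)); lra.
by have := pair a 0%N a0; case: (leP (p 0%N) (p b)); lra.
Qed.

End OffspringMoments.

(** * Poisson approximation in total variation *)

Section PoissonFacts.
Context {R : realType}.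
Variable lam : R.

Lemma Po_setT : Po lam setT = 1%E.
Proof. exact: probability_setT. Qed.

Lemma fin_num_Po (A : set nat) : Po lam A \is a fin_num.
Proof. by apply: (@fin_num_measure _ _ _ (poisson_prob lam 0)). Qed.

Lemma Po_ge0 (A : set nat) : (0 <= Po lam A)%E.
Proof. exact: (@measure_ge0 _ _ _ (poisson_prob lam 0)). Qed.

Lemma Po_setC (A : set nat) : fine (Po lam (~` A)) = 1 - fine (Po lam A).
Proof.
have mA : measurable A by [].
rewrite /Po (probability_setC (poisson_prob lam 0) mA) fineB//.
exact: fin_num_Po.
Qed.

Lemma le_Po (A B : set nat) : A `<=` B -> fine (Po lam A) <= fine (Po lam B).
Proof.
move=> AB; rewrite fine_le ?fin_num_Po//.
by apply: (@le_measure _ _ _ (poisson_prob lam 0)); rewrite ?inE.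
Qed.

Hypothesis lam_gt0 : 0 < lam.
Local Notation p := (poisson_pmf lam).

Lemma poisson_pmfE k : p k = lam ^+ k / k`!%:R * expR (- lam).
Proof. by rewrite /poisson_pmf lam_gt0. Qed.

Lemma poisson_pmf_gt0 k : 0 < p k.
Proof.
by rewrite poisson_pmfE mulr_gt0 ?expR_gt0// divr_gt0 ?exprn_gt0// ltr0n fact_gt0.
Qed.

Lemma poisson_pmf_rec k : k.+1%:R * p k.+1 = lam * p k.
Proof.
rewrite !poisson_pmfE factS natrM exprS; field.
by rewrite pnatr_eq0 -lt0n fact_gt0 nat1r pnatr_eq0.
Qed.

Lemma Po_series (A : set nat) :
  nonneg_series_sum (fun i => (i \in A)%:R * p i) (fine (Po lam A)).
Proof.
have p0 i := ltW (poisson_pmf_gt0 i).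
apply: nneseries_sum; first by move=> i; rewrite mulr_ge0.
rewrite fineK ?fin_num_Po// /Po /poisson_prob lam_gt0.
rewrite -[X in _ = esum X _](set_mem_set A) -nneseries_esum; last first.
  by move=> i _; rewrite lee_fin.
rewrite [RHS]eseries_mkcond; apply: eq_eseriesr => i _.
by case: (i \in A); rewrite ?mul1r ?mul0r.
Qed.

Lemma poisson_pmf_series : nonneg_series_sum p 1.
Proof.
have := Po_series setT; rewrite Po_setT /=; congr nonneg_series_sum.
by apply/funext => i; rewrite in_setT mul1r.
Qed.

Lemma Po_cut_le (A : set nat) k : fine (Po lam A) - \sum_(i < k) ((i : nat) \in A)%:R * p i <=
  1 - \sum_(i < k) p i.
Proof.
have := (Po_series (~` A)).1 k; rewrite Po_setC.
rewrite (eq_bigr (fun i : 'I_k => p i - ((i : nat) \in A)%:R * p i)); last first.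
  by move=> i _; rewrite in_setC; case: (_ \in A); rewrite /= ?mul1r ?mul0r ?subrr ?subr0.
by rewrite sumrB; lra.
Qed.

End PoissonFacts.

Lemma Po_set0_ge {R : realType} (lam : R) : 0 <= lam ->
  1 - lam <= fine (Po lam [set 0%N]).
Proof.
rewrite le_eqVlt => /predU1P[<-|l0].
  by rewrite /Po /poisson_prob ltxx diracE mem_set//= subr0.
have := (Po_series l0 [set 0%N]).1 1; rewrite big_ord1 mem_set// mul1r.
apply: le_trans; rewrite poisson_pmfE// expr0 fact0 divr1 mul1r.
by have := expR_ge1Dx (- lam).
Qed.

Lemma mem_le_sumn (x : seq nat) a : a \in x -> (a <= sumn x)%N.
Proof.
elim: x => //= b x IH; rewrite inE => /predU1P[->|/IH ax]; first exact: leq_addr.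
exact: leq_trans ax (leq_addl _ _).
Qed.

Section FixedSize.
Context {R : realType}.
Variables (n : nat) (q : nat -> R) (C c0 : R) (T : plane_tree) (A : set nat).
Let c := code T.
Let k := tree_size T.
Let P := sum_pmf n q n n.-1.
Let law := iidE n q n (fun x => (sumn x == n.-1)%:R * (cyclic_occ c x \in A)%:R) / P.
Hypothesis q_ge0 : forall a, 0 <= q a.
Hypothesis q_sum1 : \sum_(a < n.+1) q a = 1.
Hypothesis conc : forall m s : nat, sum_pmf n q m.+1 s <= C / Num.sqrt m.+1%:R.
Hypothesis c0_gt0 : 0 < c0.
Hypothesis lower : c0 / Num.sqrt n%:R <= P.
Hypothesis kn : (4 * k < n)%N.
Let lam : R := n%:R * weight q c.

Let k_gt0 : (0 < k)%N.
Proof. by rewrite /k /tree_size; case: T. Qed.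

Let n_gt0 : (0 < n)%N. Proof. exact: leq_ltn_trans kn. Qed.

Let sqrt_gt0 : 0 < Num.sqrt (n%:R : R). Proof. by rewrite sqrtr_gt0 ltr0n. Qed.

Let P_gt0 : 0 < P.
Proof. by apply: lt_le_trans lower; rewrite divr_gt0. Qed.

Let size_c : size c = k. Proof. exact: size_code. Qed.

Let sum_c : (sumn c).+1 = size c. Proof. by have [] := forest_word_code T. Qed.

Let letters a : a \in c -> (a < n)%N.
Proof.
move=> /mem_le_sumn ac; apply: leq_ltn_trans ac _.
by move: sum_c kn; rewrite size_c; clear; lia.
Qed.

Let sE : n.-1 = (sumn c + (n.-1 - sumn c))%N.
Proof. by move: sum_c kn; rewrite size_c; clear; lia. Qed.

Let C_ge0 : 0 <= C. Proof. exact: (@conc_ge0 R n q q_ge0 q_sum1 C conc). Qed.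

Let over_P (y X : R) : 0 <= X -> y <= C / Num.sqrt n%:R * X -> y / P <= C / c0 * X.
Proof.
move=> X0 yX; rewrite ler_pdivrMr//; apply: le_trans yX _.
have -> : C / Num.sqrt n%:R * X = C / c0 * X * (c0 / Num.sqrt n%:R).
  by field; rewrite !gt_eqF.
by rewrite ler_wpM2l// mulr_ge0// divr_ge0// ltW.
Qed.

(** When few occurrences are expected, both laws are close to the unit mass
    at zero. *)
Lemma tv_le_mean : `|law - fine (Po lam A)| <= lam * (2 * (C / c0) + 1).
Proof.
have lam_ge0 : 0 <= lam by rewrite mulr_ge0// weight_ge0.
have C0 := C_ge0; have c00 := c0_gt0.
pose z : R := (0%N \in A)%:R.
have law_z : `|law - z| <= C / c0 * (2 * lam).
  have -> : law - z = iidE n q n (fun x => (sumn x == n.-1)%:R *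
      ((cyclic_occ c x \in A)%:R - z)) / P.
    rewrite /law -[z in LHS](mulfK (lt0r_neq0 P_gt0)) -mulrBl; congr (_ / _).
    by rewrite /P -iidEZl -iidEB; apply: eq_iidE => x _ _; rewrite mulrBr [X in _ - X]mulrC.
  rewrite normrM normfV (gtr0_norm P_gt0); apply: over_P; first by rewrite mulr_ge0.
  apply: le_trans; first exact: normr_iidE.
  apply: (@le_trans _ _ (iidE n q n (fun x => (sumn x == n.-1)%:R *
      ((cyclic_occ c x)%:R * (fun=> 1 : R) (cyclic_occ c x))))).
    apply: ler_iidE => // x _ _; rewrite normrM (ger0_norm (ler0n _ _)) ler_wpM2l// mulr1.
    rewrite /z; case: (cyclic_occ c x) => [|j]; first by rewrite subrr normr0.
    apply: (@le_trans _ _ 1); last by rewrite ler1n.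
    by case: (_ \in A); case: (_ \in A); rewrite ?subrr ?normr0 ?subr0 ?normr1 ?sub0r ?normrN1.
  have cB : all (leq^~ n) c by apply/allP => a /letters /ltnW.
  have okc : forest_word c by have [] := forest_word_code T.
  have nE : n = (size c + (n - size c - 1).+1)%N by move: kn; rewrite size_c; clear; lia.
  rewrite [in X in iidE _ _ X _]nE sE (occE_palm q_sum1 (fun=> 1 : R) cB okc sum_c) -nE -/lam.
  have -> : iidE n q (n - size c - 1).+1 (fun y => (sumn y == n.-1 - sumn c)%N%:R * 1) =
      sum_pmf n q (n - size c - 1).+1 (n.-1 - sumn c).
    by apply: eq_iidE => y _ _; rewrite mulr1.
  rewrite (_ : C / _ * (2 * lam) = lam * (2 * (C / Num.sqrt n%:R))); last by ring.
  rewrite ler_wpM2l//; apply: le_trans (conc _ _) _.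
  apply: div_sqrt_le2 => //.
  by move: kn; rewrite size_c; clear; lia.
have po_z : `|fine (Po lam A) - z| <= lam.
  have Pz := Po_set0_ge lam_ge0.
  rewrite /z; case: (boolP (0%N \in A)) => /=.
    rewrite in_setE => A0; have : fine (Po lam [set 0%N]) <= fine (Po lam A).
      by apply: le_Po => _ ->.
    have : fine (Po lam A) <= fine (Po lam setT) by apply: le_Po.
    rewrite Po_setT /= => h1 h2; rewrite ler_norml; apply/andP; split; lra.
  rewrite notin_setE => A0; have : fine (Po lam A) <= fine (Po lam (~` [set 0%N])).
    by apply: le_Po => i Ai /= i0; apply: A0; rewrite -i0.
  rewrite Po_setC => h1; have h0 : 0 <= fine (Po lam A) by rewrite fine_ge0// Po_ge0.
  by rewrite subr0 ger0_norm//; lra.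
rewrite -(subrKA z); apply: le_trans (ler_normD _ _) _.
rewrite [in X in _ + X]distrC (_ : lam * _ = C / c0 * (2 * lam) + lam); last by ring.
exact: lerD.
Qed.

Lemma weight_le (th : R) a : 0 <= th -> (forall b, (b < n)%N -> q b <= th) ->
  a \in c -> weight q c <= q a * th ^+ k.-1.
Proof.
move=> th0 qth ac; rewrite /weight (big_rem a)//= ler_wpM2l//.
rewrite -size_c -(size_rem ac).
have : forall b, b \in rem a c -> (b < n)%N by move=> b /mem_rem /letters.
elim: (rem a c) => [|b y IH] yn; first by rewrite big_nil expr0.
rewrite big_cons /= exprS ler_pM ?prodr_ge0//.
  by apply: qth; apply: yn; rewrite mem_head.
by apply: IH => e ey; apply: yn; rewrite inE ey orbT.
Qed.

(** The main case: the difference of the two laws is the Stein discrepancy divided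
    by the probability of the conditioning event. *)
Lemma tv_le_stein (th dl : R) : 0 <= th <= 1 -> (forall b, (b < n)%N -> q b <= th) ->
  0 < dl -> dl <= lam ->
  `|law - fine (Po lam A)| <= C / c0 * (k%:R ^+ 2 * (6 * th ^+ k.-1) +
    k%:R * (6 * (4 + (Num.sqrt dl)^-1) * Num.sqrt (th ^+ k.-1))).
Proof.
move=> /andP[th0 th1] qth dl0 dl_lam.
have lam0 : 0 < lam by apply: lt_le_trans dl_lam.
have w0 : 0 < weight q c by rewrite -(pmulr_rgt0 _ (_ : 0 < n%:R))// ltr0n.
have qpos a : a \in c -> 0 < q a.
  move=> ac; rewrite lt_neqAle q_ge0 andbT eq_sym; apply/eqP => qa.
  by have := w0; rewrite /weight (big_rem a)//= qa mul0r ltxx.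
pose W := fine (Po lam A); pose w i := i \in A.
have W_ge j : \sum_(i < j) (w i)%:R * poisson_pmf lam i <= W by exact: (Po_series lam0 A).1.
have W_le j : W - \sum_(i < j) (w i)%:R * poisson_pmf lam i <=
    1 - \sum_(i < j) poisson_pmf lam i by exact: Po_cut_le.
pose f := stein_sol (poisson_pmf lam) w W.
have [ple1 pto1] := poisson_pmf_series lam0.
have -> : law - W = iidE n q n (fun x => (sumn x == n.-1)%:R *
    (lam * f (cyclic_occ c x).+1 - (cyclic_occ c x)%:R * f (cyclic_occ c x))) / P.
  rewrite /law -[W in LHS](mulfK (lt0r_neq0 P_gt0)) -mulrBl; congr (_ / _).
  rewrite /P -iidEZl -iidEB; apply: eq_iidE => x _ _.
  rewrite (stein_eq lam0 (poisson_pmf_gt0 lam0) (poisson_pmf_rec lam0)).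
  by rewrite mulrBr [X in _ - X]mulrC.
rewrite normrM normfV (gtr0_norm P_gt0); apply: over_P.
  by rewrite addr_ge0// !mulr_ge0 ?exprn_ge0 ?sqrtr_ge0// addr_ge0// invr_ge0 sqrtr_ge0.
rewrite sE -size_c; have := @stein_discrepancy_le R n q q_ge0 q_sum1 C conc c f
  (4 + (Num.sqrt dl)^-1) (th ^+ k.-1) n (n.-1 - sumn c).
rewrite -size_c; apply => //.
- by rewrite size_c.
- by rewrite size_c.
- move=> a ac; split; [exact/ltnW/letters | exact: qpos | ].
  by apply: le_trans (qth _ (letters ac)) th1.
- by have [] := forest_word_code T.
- move=> j; have := @stein_sol_bound R lam _ lam0 (poisson_pmf_gt0 lam0)
    (poisson_pmf_rec lam0) ple1 pto1 w W W_ge W_le j.+1 isT.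
  move=> fj; apply: le_trans fj _.
  rewrite [leRHS]mulrDl lerD2l -[in leLHS](sqr_sqrtr (ltW lam0)) expr2 invfM ler_wpM2r ?invr_ge0 ?sqrtr_ge0//.
  by rewrite lef_pV2 ?posrE ?sqrtr_gt0// ler_wsqrtr.
- by move=> j; exact: (stein_sol_diff lam0 (poisson_pmf_gt0 lam0)
    (poisson_pmf_rec lam0) ple1 pto1 W_ge W_le).
- by move=> a ac; rewrite ler_pdivrMr ?qpos// mulrC size_c weight_le.
Qed.

End FixedSize.

Lemma bernoulli_ineq {R : realDomainType} (x : R) k : 0 <= x -> 1 + k%:R * x <= (1 + x) ^+ k.
Proof.
move=> x0; elim: k => [|k IH]; first by rewrite mul0r addr0 expr0.
rewrite exprS; apply: (@le_trans _ _ ((1 + x) * (1 + k%:R * x))).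
  rewrite -[k.+1]addn1 natrD; have : 0 <= k%:R * (x * x) by rewrite !mulr_ge0.
  by rewrite mulrDl !mulrDr; lra.
by rewrite ler_wpM2l// addr_ge0.
Qed.

Lemma natr_exp_small {R : realType} (rho e : R) : 0 < rho < 1 -> 0 < e ->
  exists K, forall k, (K <= k)%N -> k%:R * rho ^+ k <= e.
Proof.
move=> /andP[r0 r1] e0; pose s := Num.sqrt rho.
have s0 : 0 < s by rewrite sqrtr_gt0.
have s1 : s < 1 by rewrite -sqrtr1 ltr_sqrt.
pose x := s^-1 - 1; have x0 : 0 < x by rewrite subr_gt0 invf_gt1.
have sk k : s ^+ k * (1 + k%:R * x) <= 1.
  have := bernoulli_ineq k (ltW x0); rewrite /x addrCA subrr addr0 exprVn => h.
  by rewrite mulrC -ler_pdivlMr ?exprn_gt0// div1r.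
have xk k : k%:R * x * s ^+ k <= 1.
  by apply: le_trans (sk k); rewrite mulrC ler_wpM2l ?exprn_ge0 ?(ltW s0)//; lra.
exists (Num.truncn ((x * x * e)^-1)).+1 => k Kk.
have k0 : (0 < k)%N by apply: leq_trans Kk.
have k1 : 0 < k%:R * x by rewrite mulr_gt0 ?ltr0n.
have ke : 1 <= k%:R * (x * x * e).
  rewrite -ler_pdivrMr ?mulr_gt0// div1r; apply/ltW; apply: lt_le_trans (truncnS_gt _) _.
  by rewrite ler_nat.
have -> : rho ^+ k = s ^+ k * s ^+ k by rewrite -exprMn -expr2 sqr_sqrtr// ltW.
have s0k : 0 <= s ^+ k by rewrite exprn_ge0// ltW.
have xx : 0 < k%:R * (x * x) by rewrite !mulr_gt0 ?ltr0n.
rewrite -(ler_pM2r xx).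
apply: (@le_trans _ _ 1); last by rewrite mulrCA (mulrC e).
rewrite [leLHS](_ : _ = (k%:R * x * s ^+ k) * (k%:R * x * s ^+ k)); last by ring.
by rewrite mulr_ile1// mulr_ge0// ltW.
Qed.

(** Geometric decay beats the powers of [k]. With [th] a bound for the offspring
    probabilities, [th ^+ k.-1] bounds the weight of a tree of size [k] with one node
    left out. *)
Lemma stein_bound_small {R : realType} (th F e : R) : 0 < th < 1 -> 0 <= F -> 0 < e ->
  exists K, forall k, (K <= k)%N ->
  k%:R ^+ 2 * (6 * th ^+ k.-1) + k%:R * (6 * F * Num.sqrt (th ^+ k.-1)) <= e.
Proof.
move=> /andP[t0 t1] F0 e0; pose r := Num.sqrt th.
have r0 : 0 < r by rewrite sqrtr_gt0.
have r1 : r < 1 by rewrite -sqrtr1 ltr_sqrt.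
have F6 : 0 < 6 + 6 * F by lra.
pose d := Num.min 1 (e / (6 + 6 * F)).
have d0 : 0 < d by rewrite /d lt_min ltr01 divr_gt0.
have r01 : 0 < r < 1 by rewrite r0 r1.
have [K hK] := natr_exp_small r01 (mulr_gt0 d0 r0).
exists K.+1 => -[//|k] Kk; set u := k.+1%:R * r ^+ k.
have u0 : 0 <= u by rewrite mulr_ge0// exprn_ge0// ltW.
have ud : u <= d.
  by rewrite -(ler_pM2r r0) /u -mulrA -exprSr; apply: hK; apply: ltnW.
have ts : th ^+ k = r ^+ k * r ^+ k by rewrite -exprMn -expr2 sqr_sqrtr// ltW.
rewrite /= ts -expr2 sqrtr_sqr ger0_norm ?exprn_ge0 ?(ltW r0)//.
rewrite (_ : _ + _ = 6 * (u * u) + 6 * F * u); last by rewrite /u; ring.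
have u1 : u <= 1 by apply: le_trans ud _; rewrite /d ge_min lexx.
have ue : u * (6 + 6 * F) <= e.
  by rewrite -ler_pdivlMr//; apply: le_trans ud _; rewrite /d ge_min lexx orbT.
have uu : u * u <= u by rewrite ler_piMr.
by lra.
Qed.

Section UniformTV.
Context {R : realType} {d d' : measure_display}
  {S : measurableType d} {Omega : measurableType d'}.
Variables (Q : probability S R) (P : probability Omega R).
Variables (xi : {RV Q >-> nat}) (X : word -> {RV P >-> nat}) (h : nat).
Hypothesis mean_xi : ('E_Q[fun s => (xi s)%:R] = 1)%E.
Hypothesis var_xi : (0 < 'V_Q[fun s => ((xi s)%:R : R)] < +oo)%E.
Hypothesis iid_X : iid_copies xi X.
Hypothesis span_h : is_span xi h.
Local Notation p := (offspring_pmf xi).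

Lemma span_gt0 : (0 < h)%N.
Proof.
have [b b0 pb] := offspring_pos_letter mean_xi.
have := span_h.1 b; rewrite /= offspring_pmfE lte_fin => /(_ (conj b0 pb)).
by case: (h) => //; rewrite dvd0n; case: b b0 {pb}.
Qed.

(** The constants of the local estimates, uniform over the truncations. *)
Lemma local_bounds : exists C, 0 < C /\ exists2 c0, 0 < c0 & exists N0,
  forall n, (N0 <= n)%N -> (h %| n.-1)%N ->
  (forall m s : nat, sum_pmf n (trunc_pmf p n) m.+1 s <= C / Num.sqrt m.+1%:R) /\
  c0 / Num.sqrt n%:R <= sum_pmf n (trunc_pmf p n) n n.-1.
Proof.
have p0 := offspring_pos0 mean_xi var_xi.
have psum := offspring_sum xi; have pge := offspring_pmf_ge0 xi.
have [b b0 pb] := offspring_pos_letter mean_xi.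
have [V V1 pV] := offspring_sqr mean_xi var_xi.
have p01 : p 0%N <= 1 by have := psum.1 1%N; rewrite big_ord1.
pose C := (Num.sqrt (p 0%N))^-1 + (Num.sqrt (p b))^-1.
have s0 : 0 < (Num.sqrt (p 0%N))^-1 by rewrite invr_gt0 sqrtr_gt0.
have sb : 0 < (Num.sqrt (p b))^-1 by rewrite invr_gt0 sqrtr_gt0.
have C1 : 1 <= C.
  rewrite /C; suff : 1 <= (Num.sqrt (p 0%N))^-1 by lra.
  by rewrite invf_ge1 ?sqrtr_gt0// -sqrtr1 ler_wsqrtr.
have Sb : (1 <= b)%N /\ (0 < distribution Q xi [set b])%E.
  by rewrite offspring_pmfE lte_fin.
have [A [A' [AS hA]]] := span_combination span_h.2 (ex_intro2 _ _ b Sb b0).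
have AP a : a \in A ++ A' -> 0 < p a.
  by move=> /AS[_]; rewrite offspring_pmfE lte_fin.
pose cost a := 3 * C * ((Num.sqrt (p 0%N))^-1 + (Num.sqrt (p a))^-1).
pose L := \sum_(a <- A ++ A') cost a + 1.
have C0 : 0 < C by lra.
have L0 : 0 < L.
  rewrite ltr_wpDl// sumr_ge0// => a _; rewrite mulr_ge0 ?addr_ge0 ?invr_ge0 ?sqrtr_ge0//.
  by lra.
have p00 : 0 < p 0%N <= 1 by rewrite p0 p01.
have [c0 c00 [N0 lower]] := sum_pmf_mean_ge span_gt0 C1 V1 L0 p00.
exists C; split=> //; exists c0 => //.
exists (N0 + (b + sumn (A ++ A')).+1)%N => n nN hn.
pose q := trunc_pmf p n.
have nb : (b < n)%N by clear - nN; lia.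
have n0 : (0 < n)%N by clear - nN; lia.
have nA a : a \in A ++ A' -> (a < n)%N by move=> /mem_le_sumn; clear - nN; lia.
have q0 a : 0 <= q a by exact: trunc_pmf_ge0.
have q1 : \sum_(a < n.+1) q a = 1 by exact: trunc_pmf_sum.
have qE a : (a < n)%N -> q a = p a by exact: trunc_pmf_lt.
have conc (m s : nat) : sum_pmf n q m.+1 s <= C / Num.sqrt m.+1%:R.
  have := @sum_pmf_le R n q q0 q1 b m s; rewrite b0 (ltnW nb) !qE// => /(_ isT); exact.
split=> //; apply: lower => //.
- by clear - nN; lia.
- by rewrite -/(q 0%N) qE.
- move=> m s; have := @sum_pmf_span_step R n q q0 q1 _ C conc h A A' m s.
  rewrite qE// => /(_ p0) st; apply: le_trans (st _ hA) _.
    by move=> a aA; rewrite qE ?nA// AP// andbT ltnW// nA.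
  rewrite ler_wpM2r// (_ : \sum_(a <- A ++ A') _ = \sum_(a <- A ++ A') cost a).
    by rewrite /L lerDl.
  by apply: eq_big_seq => a aA; rewrite /step_cost /cost !qE // nA.
- exact: (trunc_pmf_mean pge psum (offspring_mean mean_xi) pV).
- exact: (trunc_pmf_sqr pge psum pV).
- move=> a an ha; rewrite -/(q a) qE//; apply/eqP; rewrite eq_le pge andbT leNgt.
  have a0 : (0 < a)%N by case: (a) ha => //; rewrite dvdn0.
  apply/negP => pa; move: ha; rewrite span_h.1//=; split=> //.
  by rewrite offspring_pmfE lte_fin.
Qed.

(** A level [dl] for the expected number of occurrences separates the two regimes:
    below it [tv_le_mean] applies, above it [tv_le_stein]. *)
Lemma tv_uniform (e : R) : 0 < e -> exists N0 K0, forall n T,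
  (N0 <= n)%N -> (h %| n.-1)%N -> (K0 <= tree_size T)%N ->
  (4 * tree_size T < n)%N ->
  exists2 r : set nat -> R, (forall A, fringe_count_law X n T A = (r A)%:E) &
    forall A, `|r A - fine (Po (n%:R * gw_pi X T) A)| <= e.
Proof.
move=> e0.
have [C [C0 [c0 c00 [N0 loc]]]] := local_bounds.
have [th th01 pth] := offspring_max mean_xi var_xi.
have Cc : 0 < C / c0 by rewrite divr_gt0.
pose B := 2 * (C / c0) + 1; have B0 : 0 < B by rewrite /B; lra.
pose dl := e / B; have dl0 : 0 < dl by rewrite divr_gt0.
have F0 : 0 <= 4 + (Num.sqrt dl)^-1 by rewrite addr_ge0// invr_ge0 sqrtr_ge0.
have [K0 hK] := stein_bound_small th01 F0 (divr_gt0 e0 Cc).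
exists N0, K0 => n T nN hn TK Tn.
have [conc lower] := loc n nN hn.
pose q := trunc_pmf p n.
have psum := offspring_sum xi; have pge := offspring_pmf_ge0 xi.
have q0 a : 0 <= q a by exact: trunc_pmf_ge0.
have q1 : \sum_(a < n.+1) q a = 1 by exact: trunc_pmf_sum.
have qE a : (a < n)%N -> q a = p a by exact: trunc_pmf_lt.
have n0 : (0 < n)%N by apply: leq_ltn_trans Tn.
have pos : 0 < sum_pmf n q n n.-1.
  by apply: lt_le_trans lower; rewrite divr_gt0// sqrtr_gt0 ltr0n.
exists (fun A => iidE n q n (fun x => (sumn x == n.-1)%:R * (cyclic_occ (code T) x \in A)%:R) /
   sum_pmf n q n n.-1) => A.
  exact: (fringe_count_lawE iid_X).
have -> : gw_pi X T = weight q (code T).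
  rewrite (gw_piE iid_X); apply: eq_weight => a aT; rewrite qE//.
  have [_ sT] := forest_word_code T; have := mem_le_sumn aT.
  by move: sT Tn; rewrite size_code; clear; lia.
have [small|big] := leP (n%:R * weight q (code T)) dl.
  apply: le_trans (tv_le_mean A q0 q1 conc c00 lower Tn) _.
  by rewrite -/B -ler_pdivlMr.
have th01' : 0 <= th <= 1 by move: th01 => /andP[/ltW-> /ltW->].
have qth a : (a < n)%N -> q a <= th by move=> an; rewrite qE.
apply: le_trans (tv_le_stein A q0 q1 conc c00 lower Tn th01' qth dl0 (ltW big)) _.
by rewrite mulrC -ler_pdivlMr//; exact: hK.
Qed.

End UniformTV.

(** * Normal approximation of the Poisson law *)

Section NormalCdf.
Context {R : realType}.
Local Notation mu := (normal_prob (0 : R) 1).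

Definition normal_cdf (t : R) : R := fine (mu `]-oo, t]%classic).
Local Notation F := normal_cdf.

Lemma fin_num_normal (A : set R) : measurable A -> mu A \is a fin_num.
Proof. by move=> mA; rewrite fin_num_measure. Qed.

Lemma le_fine_normal (U V : set R) : measurable U -> measurable V -> U `<=` V ->
  fine (mu U) <= fine (mu V).
Proof.
move=> mU mV UV; rewrite fine_le ?fin_num_normal//.
by apply: le_measure; rewrite ?inE.
Qed.

Lemma normal_cdf_sub (a b : R) : a <= b -> F b - F a = fine (mu `]a, b]%classic).
Proof.
move=> ab; rewrite /F.
have -> : `]-oo, b]%classic = `]-oo, a]%classic `|` `]a, b]%classic :> set R.
  apply/seteqP; split=> x /=; rewrite !in_itv/=; first by case: (leP x a); [left|right].
  by move=> [xa|/andP[]//]; exact: le_trans ab.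
rewrite measureU//; last first.
  apply/seteqP; split=> // x /= []; rewrite !in_itv/= => xa /andP[ax _].
  by move: (lt_le_trans ax xa); rewrite ltxx.
by rewrite fineD ?fin_num_normal// addrAC subrr add0r.
Qed.

Lemma normal_cdf_le (a b : R) : a <= b -> F a <= F b.
Proof.
by move=> ab; rewrite -subr_ge0 normal_cdf_sub// fine_ge0.
Qed.

Lemma normal_cdf_ge0 a : 0 <= F a. Proof. by rewrite fine_ge0. Qed.

Lemma normal_cdf_le1 a : F a <= 1.
Proof.
by rewrite -lee_fin fineK ?fin_num_normal// probability_le1.
Qed.

Lemma normal_cdf_cell (a b m1 m2 : R) : a <= b ->
  (forall t, a <= t <= b -> m1 <= normal_pdf 0 1 t <= m2) -> 0 <= m1 ->
  m1 * (b - a) <= F b - F a <= m2 * (b - a).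
Proof.
move=> ab mt m10; rewrite normal_cdf_sub//.
have leb : lebesgue_measure (`]a, b]%classic : set R) = (b - a)%:E.
  rewrite lebesgue_measure_itv/= lte_fin; case: ltP => // ba.
  by rewrite (le_anti (introT andP (conj ab ba))) subrr.
have mpdf : measurable_fun (`]a, b]%classic : set R) (fun x => (normal_pdf 0 1 x)%:E : \bar R).
  by apply/measurable_EFinP; apply: measurable_funTS; exact: measurable_normal_pdf.
have cst_int (c : R) : (\int[lebesgue_measure]_(x in `]a, b]%classic) c%:E = (c * (b - a))%:E)%E.
  by rewrite integral_cst// EFinM -leb.
have ab_in x : `]a, b]%classic x -> m1 <= normal_pdf 0 1 x <= m2.
  by rewrite /= in_itv/= => /andP[ax xb]; apply: mt; rewrite (ltW ax).
have m20 : 0 <= m2.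
  by have /andP[h1 h2] := mt a (introT andP (conj (lexx a) ab)); apply: le_trans h2; exact: le_trans h1.
apply/andP; split; rewrite -lee_fin fineK ?fin_num_normal// -cst_int /normal_prob; apply: ge0_le_integral => //;
  try (by move=> x xab; rewrite lee_fin normal_pdf_ge0);
  by move=> x /ab_in /andP[h1 h2]; rewrite lee_fin.
Qed.

Lemma normal_cdf_tails (e : R) : 0 < e -> exists n : nat,
  1 - e <= F n%:R /\ F (- n%:R) <= e.
Proof.
move=> e0; pose A (n : nat) : set R := `[- n%:R, n%:R]%classic.
have AT : \bigcup_n A n = setT.
  apply/seteqP; split=> // x _; exists (Num.truncn `|x|).+1 => //=.
  by rewrite /A /= in_itv/= -ler_norml ltW// truncnS_gt.
have mA i : measurable (A i) by exact: measurable_itv.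
have cv : mu (A n) @[n --> \oo] --> mu setT.
  rewrite -AT; apply: nondecreasing_cvg_mu => //; first by apply: bigcup_measurable => i _; exact: mA.
  move=> n m nm; apply/subsetPset => x; rewrite /A /= !in_itv/= => /andP[h1 h2].
  by rewrite (le_trans _ h1) ?lerN2 ?ler_nat// (le_trans h2)// ler_nat.
have [n An] : exists n, 1 - e <= fine (mu (A n)).
  apply: contrapT => no.
  have : (mu setT <= (1 - e)%:E)%E.
    rewrite -(cvg_lim _ cv)//; apply: lime_le; first by apply/cvg_ex; exists (mu setT).
    apply: nearW => n; rewrite -[leLHS]fineK ?fin_num_normal// lee_fin leNgt; apply/negP => h.
    by apply: no; exists n; exact: ltW.
  by rewrite probability_setT lee_fin lerBrDr gerDl leNgt e0.
exists n.+1; split.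
  apply: le_trans An _; apply: le_fine_normal => // x; rewrite /A /= !in_itv/= => /andP[_ h2].
  by apply: le_trans h2 _; rewrite ler_nat.
have AC : fine (mu (~` A n)) <= e.
  rewrite (probability_setC mu (mA n)) fineB ?fin_num_normal//.
  by rewrite [fine 1%E]/=; move: An; lra.
apply: le_trans AC; apply: le_fine_normal => //; first exact: measurableC.
move=> x; rewrite /A /= !in_itv/= => xn /andP[h _].
by have := le_trans h xn; rewrite lerN2 ler_nat ltnn.
Qed.

Lemma normal_pdf_std (t : R) : normal_pdf 0 1 t = normal_peak 1 * expR (- (t ^+ 2) / 2).
Proof.
by rewrite normal_pdfE ?oner_eq0// /normal_fun subr0 expr1n.
Qed.

Lemma normal_cdf_lipschitz (a b : R) : a <= b -> F b - F a <= normal_peak 1 * (b - a).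
Proof.
move=> ab; suff : 0 * (b - a) <= F b - F a <= normal_peak 1 * (b - a) by case/andP.
apply: normal_cdf_cell => // t _; rewrite normal_pdf_ge0 /=.
by apply: normal_pdf_ub; exact: oner_neq0.
Qed.

End NormalCdf.

Lemma expR_le_1Dx (R : realType) (y : R) : `|y| <= 2^-1 ->
  expR y <= (1 + y) * expR (2 * y ^+ 2).
Proof.
rewrite ler_norml => /andP[y1 y2].
have e1 : 1 + (2 * y ^+ 2 - y) <= expR (2 * y ^+ 2 - y) by exact: expR_ge1Dx.
have y0 : 0 <= 1 + y by lra.
have e2 : 1 <= (1 + y) * expR (2 * y ^+ 2 - y).
  apply: le_trans (ler_wpM2l y0 e1).
  have : 0 <= y ^+ 2 * (1 + 2 * y) by rewrite mulr_ge0 ?sqr_ge0//; lra.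
  by rewrite (_ : (1 + y) * _ = 1 + y ^+ 2 * (1 + 2 * y)); [lra|ring].
have -> : 2 * y ^+ 2 = y + (2 * y ^+ 2 - y) by ring.
by rewrite expRD mulrCA ler_peMr// expR_ge0.
Qed.

Section PoissonLocal.
Context {R : realType}.
Variables (lam M : R).
Hypothesis lam_gt0 : 0 < lam.
Hypothesis M_ge1 : 1 <= M.
Local Notation p := (poisson_pmf lam).
Local Notation F := (@normal_cdf R).
Let dl : R := (Num.sqrt lam)^-1.
Hypothesis dlM : dl * M <= 2^-1.
Definition std_point (k : nat) : R := (k%:R - lam) / Num.sqrt lam.
Local Notation x := std_point.

Let sq_gt0 : 0 < Num.sqrt lam. Proof. by rewrite sqrtr_gt0. Qed.
Let dl_gt0 : 0 < dl. Proof. by rewrite invr_gt0. Qed.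
Let dl_le1 : dl <= 1.
Proof.
have d0 := dl_gt0; have M1 := M_ge1; have h := dlM.
have : dl <= dl * M by rewrite ler_peMr// ltW.
by lra.
Qed.

Lemma std_pointS k : x k.+1 = x k + dl.
Proof. by rewrite /std_point -/dl -[k.+1]addn1 natrD; ring. Qed.

Let u (k : nat) : R := p k * expR (x k ^+ 2 / 2).

(** Divided by the Gaussian density, the Poisson probabilities vary slowly: with
    [y = dl * x (k + 1)], the ratio of consecutive ones is
    [exp (y - dl^2 / 2) / (1 + y)], equal to one up to terms of second order. *)
Lemma tilted_pmfS k : `|x k.+1| <= M ->
  u k.+1 <= u k * expR (2 * (M ^+ 2 * dl ^+ 2)) /\
  u k <= u k.+1 * expR (2 * (M ^+ 2 * dl ^+ 2)).
Proof.
move=> xM; have d0 := dl_gt0; have M1 := M_ge1; have l0 := lam_gt0.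
pose y := dl * x k.+1.
have ysmall : `|y| <= 2^-1.
  by rewrite /y normrM (gtr0_norm d0); apply: le_trans dlM; rewrite ler_pM2l.
have y2 : y ^+ 2 <= M ^+ 2 * dl ^+ 2.
  rewrite /y exprMn mulrC ler_wpM2r ?sqr_ge0//.
  by rewrite -[x k.+1 ^+ 2]real_normK ?num_real// lerXn2r ?nnegrE//; lra.
have y1 : 1 + y = k.+1%:R / lam.
  rewrite /y /std_point /dl mulrC -mulrA -invfM -expr2 sqr_sqrtr ?ltW// mulrBl.
  by rewrite divff ?gt_eqF// addrC subrK.
have y1p : 0 < 1 + y by rewrite y1 divr_gt0// ltr0n.
have uS : u k.+1 * (1 + y) = u k * expR (y - dl ^+ 2 / 2).
  have pk : p k = p k.+1 * (1 + y).
    by rewrite y1 mulrA [p k.+1 * _]mulrC poisson_pmf_rec// mulrAC divff ?mul1r ?gt_eqF.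
  rewrite /u pk.
  have -> : x k.+1 ^+ 2 / 2 = x k ^+ 2 / 2 + (y - dl ^+ 2 / 2).
    by rewrite /y std_pointS; field.
  by rewrite expRD; ring.
have uk0 : 0 <= u k by rewrite mulr_ge0 ?expR_ge0// ltW// poisson_pmf_gt0.
have uk10 : 0 <= u k.+1 by rewrite mulr_ge0 ?expR_ge0// ltW// poisson_pmf_gt0.
split.
  rewrite -(ler_pM2r y1p) uS -[leRHS]mulrA ler_wpM2l//.
  apply: (@le_trans _ _ (expR y)).
    by rewrite ler_expR gerBl divr_ge0 ?sqr_ge0.
  apply: le_trans (expR_le_1Dx ysmall) _; rewrite mulrC ler_wpM2r ?(ltW y1p)//.
  by rewrite ler_expR ler_wpM2l.
have e0 : 1 + y <= expR y by exact: expR_ge1Dx.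
have : u k * (1 + y) <= u k.+1 * expR (dl ^+ 2 / 2) * (1 + y).
  rewrite [leRHS]mulrAC uS -[leRHS]mulrA -expRD subrK.
  by rewrite ler_wpM2l.
rewrite ler_pM2r// => h; apply: le_trans h _; rewrite ler_wpM2l// ler_expR.
have M2 : 1 <= M ^+ 2 by rewrite exprn_ege1.
have d2 : 0 <= dl ^+ 2 by rewrite sqr_ge0.
have : dl ^+ 2 <= M ^+ 2 * dl ^+ 2 by rewrite ler_peMl.
by lra.
Qed.

Lemma std_point_le k l : (k <= l)%N -> x k <= x l.
Proof.
by move=> kl; rewrite /std_point ler_wpM2r ?(ltW dl_gt0)// lerD2r ler_nat.
Qed.

Lemma tilted_pmf_chain k j : `|x k| <= M -> `|x (k + j)%N| <= M ->
  u (k + j)%N <= u k * expR (j%:R * (2 * (M ^+ 2 * dl ^+ 2))) /\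
  u k <= u (k + j)%N * expR (j%:R * (2 * (M ^+ 2 * dl ^+ 2))).
Proof.
move=> xk; elim: j => [|j IH] xj; first by rewrite addn0 mul0r expR0 !mulr1.
have xj' : `|x (k + j)%N| <= M.
  move: xk xj; rewrite !ler_norml => /andP[k1 k2] /andP[j1 j2].
  have := @std_point_le k (k + j) (leq_addr _ _).
  have := @std_point_le (k + j) (k + j.+1) (leq_add (leqnn _) (leqnSn _)).
  by move=> h1 h2; apply/andP; split; lra.
have [h1 h2] := IH xj'; rewrite addnS in xj *; have [h3 h4] := tilted_pmfS xj.
set E := 2 * _ in h1 h2 h3 h4 *.
have e0 (z : R) : 0 <= expR z by exact: expR_ge0.
rewrite -[j.+1]addn1 natrD mulrDl mul1r expRD; split.
  by apply: le_trans h3 _; rewrite mulrA ler_wpM2r.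
by apply: le_trans h2 _; rewrite [leRHS]mulrCA [leLHS]mulrC ler_wpM2l.
Qed.

Lemma tilted_pmf_flat k l : `|x k| <= M -> `|x l| <= M ->
  u k <= u l * expR (4 * M ^+ 3 * dl).
Proof.
move=> xk xl; have d0 := dl_gt0; have M1 := M_ge1.
have expo j : x (j.1 + j.2)%N - x j.1 <= 2 * M ->
    j.2%:R * (2 * (M ^+ 2 * dl ^+ 2)) <= 4 * M ^+ 3 * dl.
  case: j => a j /=; have -> : x (a + j)%N - x a = j%:R * dl.
    by rewrite /std_point natrD -/dl; ring.
  move=> h; rewrite (_ : _ * _ = (j%:R * dl) * (2 * (M ^+ 2 * dl))); last by ring.
  rewrite (_ : 4 * M ^+ 3 * dl = (2 * M) * (2 * (M ^+ 2 * dl))); last by ring.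
  by rewrite ler_wpM2r// mulr_ge0// mulr_ge0 ?sqr_ge0// ltW.
have gap a b : `|x a| <= M -> `|x b| <= M -> x b - x a <= 2 * M.
  by rewrite !ler_norml => /andP[? ?] /andP[? ?]; lra.
have u0 j : 0 <= u j by rewrite mulr_ge0 ?expR_ge0// ltW// poisson_pmf_gt0.
have [kl|lk] := leqP k l.
  have := @tilted_pmf_chain k (l - k) xk; rewrite subnKC// => /(_ xl)[_ h].
  apply: le_trans h _; rewrite ler_wpM2l// ler_expR.
  by apply: (expo (k, (l - k)%N)); rewrite /= subnKC// gap.
have := @tilted_pmf_chain l (k - l) xl; rewrite subnKC ?(ltnW lk)// => /(_ xk)[h _].
apply: le_trans h _; rewrite ler_wpM2l// ler_expR.
by apply: (expo (l, (k - l)%N)); rewrite /= subnKC ?gap// ltnW.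
Qed.

Definition cell (k : nat) : R := F (x k.+1) - F (x k).

Lemma cell_bounds k : `|x k| <= M ->
  dl * normal_peak 1 * expR (- (x k ^+ 2 / 2)) * expR (- (dl * (M + 1))) <= cell k <=
  dl * normal_peak 1 * expR (- (x k ^+ 2 / 2)) * expR (dl * (M + 1)).
Proof.
move=> xM; have d0 := dl_gt0; have d1 := dl_le1; have M1 := M_ge1.
have c0 : 0 < normal_peak (1 : R) by apply: normal_peak_gt0; rewrite oner_eq0.
have xx : x k <= x k.+1 by rewrite std_pointS; lra.
pose m1 := normal_peak 1 * (expR (- (x k ^+ 2 / 2)) * expR (- (dl * (M + 1)))).
pose m2 := normal_peak 1 * (expR (- (x k ^+ 2 / 2)) * expR (dl * (M + 1))).
have := @normal_cdf_cell R (x k) (x k.+1) m1 m2 xx.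
have -> : x k.+1 - x k = dl by rewrite std_pointS; ring.
rewrite (_ : m1 * dl = dl * normal_peak 1 * expR (- (x k ^+ 2 / 2)) * expR (- (dl * (M + 1))));
  last by rewrite /m1; ring.
rewrite (_ : m2 * dl = dl * normal_peak 1 * expR (- (x k ^+ 2 / 2)) * expR (dl * (M + 1)));
  last by rewrite /m2; ring.
apply; last by rewrite !mulr_ge0 ?expR_ge0// ltW.
move=> t /andP[t1]; rewrite std_pointS => t2; rewrite normal_pdf_std /m1 /m2 -!expRD.
move: xM; rewrite ler_norml => /andP[x1 x2].
have key : `|(x k ^+ 2 / 2) - (t ^+ 2 / 2)| <= dl * (M + 1).
  have -> : x k ^+ 2 / 2 - t ^+ 2 / 2 = (x k - t) * ((x k + t) / 2) by field.
  rewrite normrM ler_pM//; rewrite ler_norml; apply/andP; split; lra.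
move: key; rewrite ler_norml => /andP[k1 k2].
by rewrite !(ler_pM2l c0) !ler_expR; apply/andP; split; lra.
Qed.

Lemma pmf_cell_exchange k l : `|x k| <= M -> `|x l| <= M ->
  p k * cell l <= p l * cell k * expR (dl * (4 * M ^+ 3 + 2 * (M + 1))).
Proof.
move=> xk xl; have d0 := dl_gt0.
have /andP[_ gl] := cell_bounds xl; have /andP[gk _] := cell_bounds xk.
have c0 : 0 < normal_peak (1 : R) by apply: normal_peak_gt0; rewrite oner_eq0.
have pk := poisson_pmf_gt0 lam_gt0 k; have pl := poisson_pmf_gt0 lam_gt0 l.
have flat := tilted_pmf_flat xk xl; rewrite /u in flat.
pose a k : R := expR (x k ^+ 2 / 2); pose b k : R := expR (- (x k ^+ 2 / 2)).
have ab j : a j * b j = 1 by rewrite /a /b -expRD subrr expR0.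
have b0 j : 0 <= b j by exact: expR_ge0.
pose D := dl * normal_peak 1; have D0 : 0 <= D by rewrite mulr_ge0// ltW.
apply: le_trans (ler_wpM2l (ltW pk) gl) _.
have -> : expR (dl * (4 * M ^+ 3 + 2 * (M + 1))) =
    expR (4 * M ^+ 3 * dl) * expR (dl * (M + 1)) * expR (dl * (M + 1)).
  by rewrite -!expRD; congr expR; ring.
apply: (@le_trans _ _ (p l * (D * b k * expR (- (dl * (M + 1)))) *
   (expR (4 * M ^+ 3 * dl) * expR (dl * (M + 1)) * expR (dl * (M + 1))))); last first.
  rewrite ler_wpM2r ?mulr_ge0 ?expR_ge0// ler_wpM2l// ltW//.
have ee : expR (- (dl * (M + 1))) * expR (dl * (M + 1)) = 1.
  by rewrite -expRD addrC subrr expR0.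
rewrite (_ : p l * _ * _ = (expR (- (dl * (M + 1))) * expR (dl * (M + 1))) *
   (p l * (D * b k) * expR (4 * M ^+ 3 * dl) * expR (dl * (M + 1)))); last by ring.
rewrite ee mul1r [leLHS]mulrA ler_wpM2r ?expR_ge0//.
rewrite (_ : p k * _ = (p k * a k) * b k * b l * D); last first.
  by rewrite -[p k * a k * b k]mulrA ab mulr1 /D -/(b l); ring.
rewrite (_ : p l * _ * _ = (p l * a l * expR (4 * M ^+ 3 * dl)) * b k * b l * D); last first.
  rewrite (_ : p l * a l * _ * _ * _ * _ = (a l * b l) * (p l * (D * b k) * expR (4 * M ^+ 3 * dl))); last by ring.
  by rewrite ab mul1r.
by rewrite !ler_wpM2r.
Qed.

End PoissonLocal.

Section PoissonSums.
Context {R : realType}.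
Variable lam : R.
Hypothesis lam_gt0 : 0 < lam.
Local Notation p := (poisson_pmf lam).
Local Notation x := (std_point lam).

Lemma Po_prefix K : fine (Po lam `I_K) = \sum_(i < K) p i.
Proof.
have [Wge Wlim] := Po_series lam_gt0 `I_K.
have p0 i := poisson_pmf_ge0 lam i.
have part N : \sum_(i < N) ((i : nat) \in `I_K)%:R * p i <= \sum_(i < K) p i.
  rewrite -(big_mkord xpredT (fun i => (i \in `I_K)%:R * p i)) -(big_mkord xpredT p).
  have [NK|KN] := leqP N K.
    rewrite [leRHS](@big_cat_nat _ _ _ N 0 K)//= -[leLHS]addr0 lerD ?sumr_ge0//.
    by apply: ler_sum => i _; rewrite ler_piMl// lern1 leq_b1.
  rewrite (@big_cat_nat _ _ _ K 0 N) ?(ltnW KN)//= -[leRHS]addr0 lerD//.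
    by apply: ler_sum => i _; rewrite ler_piMl// lern1 leq_b1.
  rewrite big_nat big1// => i /andP[Ki _]; rewrite (memNset (A := `I_K)) ?mul0r//=.
  by rewrite ltnNge Ki.
apply/eqP; rewrite eq_le; apply/andP; split.
  apply: ler_of_addgt0 => e e0.
  have [N hN] := Wlim e e0; have := part N; lra.
apply: le_trans (Wge K); apply: ler_sum => i _.
by rewrite mem_set ?mul1r//= ltn_ord.
Qed.

(** The sum telescopes because [k p_k = lam p_(k - 1)]. As soon as [N >= lam] the
    value is nonpositive, so partial sums of the variance do not exceed [lam]. *)
Lemma poisson_var_partial N :
  \sum_(k < N) ((k%:R - lam) ^+ 2 - lam) * p k = N%:R * (lam - N%:R) * p N.
Proof.
elim: N => [|N IH]; first by rewrite big_ord0 !mul0r.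
rewrite big_ord_recr/= IH [RHS]mulrAC poisson_pmf_rec// -[N.+1]addn1 natrD; ring.
Qed.

Lemma poisson_chebyshev (M : R) (lo hi : nat) : 0 < M ->
  (forall k, (k < lo)%N -> M * Num.sqrt lam <= lam - k%:R) ->
  (forall k, (hi < k)%N -> M * Num.sqrt lam <= k%:R - lam) -> (lo <= hi.+1)%N ->
  \sum_(k < lo) p k <= M ^- 2 /\ 1 - M ^- 2 <= \sum_(lo <= k < hi.+1) p k.
Proof.
move=> M0 lolam hilam lohi; have l0 := lam_gt0.
have s0 : 0 < Num.sqrt lam by rewrite sqrtr_gt0.
have p0 i := poisson_pmf_ge0 lam i.
have M2 : 0 < M ^+ 2 * lam by rewrite mulr_gt0// exprn_gt0.
have sq (z : R) : M * Num.sqrt lam <= z -> M ^+ 2 * lam <= z ^+ 2.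
  move=> h; have h0 : 0 <= M * Num.sqrt lam by rewrite mulr_ge0// ltW.
  rewrite -[lam in leLHS](sqr_sqrtr (ltW l0)) -exprMn lerXn2r ?nnegrE//.
  exact: le_trans h.
have far k : (k < lo)%N || (hi < k)%N -> p k * (M ^+ 2 * lam) <= (k%:R - lam) ^+ 2 * p k.
  move=> kk; rewrite mulrC ler_wpM2r//; case/orP: kk => [/lolam/sq|/hilam/sq//].
  by rewrite -[leRHS]sqrrN opprB.
have tails n : lam <= n%:R -> (hi < n)%N ->
    \sum_(k < lo) p k + \sum_(hi.+1 <= k < n) p k <= M ^- 2.
  move=> ln hn.
  have var : \sum_(k < n) (k%:R - lam) ^+ 2 * p k <= lam.
    have := poisson_var_partial n; under eq_bigr do rewrite mulrBl.
    rewrite sumrB -mulr_sumr => E.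
    have : n%:R * (lam - n%:R) * p n <= 0.
      by rewrite mulr_le0_ge0// mulr_ge0_le0// subr_le0.
    have : lam * \sum_(k < n) p k <= lam.
      by rewrite ler_piMr ?(ltW l0)//; apply: (poisson_pmf_series l0).1.
    by move: E; lra.
  rewrite -(ler_pM2r M2) [leRHS]mulrA mulVf ?mul1r ?gt_eqF ?exprn_gt0//.
  apply: le_trans var; rewrite -(big_mkord xpredT p) -(big_mkord xpredT (fun k => (k%:R - lam) ^+ 2 * p k)).
  rewrite [leRHS](@big_cat_nat _ _ _ lo 0 n)//=; last by clear - lohi hn; lia.
  rewrite [X in _ <= _ + X](@big_cat_nat _ _ _ hi.+1 lo n)//=.
  rewrite mulrDl !mulr_suml lerD//.
    rewrite !big_nat; apply: ler_sum => k /andP[_ kl]; apply: far; by rewrite kl.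
  rewrite -[leLHS]add0r lerD//.
    by apply: sumr_ge0 => k _; rewrite mulr_ge0 ?sqr_ge0.
  by rewrite !big_nat; apply: ler_sum => k /andP[hk _]; apply: far; rewrite hk orbT.
have tail0 n : 0 <= \sum_(hi.+1 <= k < n) p k by apply: sumr_ge0.
split.
  pose n := (Num.truncn lam + hi).+1.
  have ln : lam <= n%:R.
    apply/ltW; apply: lt_le_trans (truncnS_gt _) _; rewrite ler_nat /n ltnS leq_addr//.
  have := tails n ln; rewrite /n ltnS leq_addl => /(_ isT); have := tail0 n; rewrite /n; lra.
apply: ler_of_addgt0 => e e0.
have [N hN] := nonneg_series_sum_ext p0 (poisson_pmf_series l0) e0.
pose n := (N + (Num.truncn lam + hi)).+1.
have Nn : (N <= n)%N by rewrite /n; clear; lia.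
have hn : (hi < n)%N by rewrite /n; clear; lia.
have ln : lam <= n%:R.
  apply/ltW; apply: lt_le_trans (truncnS_gt _) _; rewrite ler_nat /n; rewrite ltnS (leq_trans _ (leq_addl _ _)) ?leq_addr//.
have split_sum : \sum_(k < n) p k = \sum_(k < lo) p k +
    (\sum_(lo <= k < hi.+1) p k + \sum_(hi.+1 <= k < n) p k).
  rewrite -!(big_mkord xpredT p) (@big_cat_nat _ _ _ lo 0 n)//=; last by clear - lohi hn; lia.
  by congr (_ + _); rewrite (@big_cat_nat _ _ _ hi.+1 lo n).
have := tails n ln hn; have := hN n Nn; rewrite split_sum.
by move: (\sum_(k < lo) p k) (\sum_(lo <= k < hi.+1) p k) (\sum_(hi.+1 <= k < n) p k) => a b c; lra.
Qed.

End PoissonSums.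

Lemma expR_le_1Dsmall {R : realType} (t eta : R) : 0 < t <= 1 -> 0 <= eta <= t / 2 ->
  expR eta <= 1 + t.
Proof.
move=> /andP[t0 t1] /andP[e0 et].
have h1 : 1 - eta <= expR (- eta) by exact: expR_ge1Dx.
have h2 : expR eta * (1 - eta) <= 1.
  apply: (@le_trans _ _ (expR eta * expR (- eta))); first by rewrite ler_wpM2l ?expR_ge0.
  by rewrite -expRD subrr expR0.
have h3 : 1 <= (1 + t) * (1 - eta) by nra.
have h4 : 0 < 1 - eta by lra.
by rewrite -(ler_pM2r h4); apply: le_trans h2 h3.
Qed.

(** [SJ / SI] and [GJ / GI] agree up to the factor [E], and the denominators are
    close to one. *)
Lemma ratio_transfer {R : realType} (t E SJ SI GJ GI : R) : 0 < t <= 4^-1 ->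
  0 <= SJ <= 1 -> 1 - t <= SI <= 1 -> 0 <= GJ <= 1 -> 1 - 2 * t <= GI <= 1 ->
  E <= 1 + t -> SJ * GI <= SI * GJ * E -> SI * GJ <= SJ * GI * E ->
  SJ <= GJ + 3 * t /\ GJ <= SJ + 2 * t.
Proof.
move=> /andP[t0 t4] /andP[j0 j1] /andP[i0 i1] /andP[g0 g1] /andP[h0 h1] Et up down.
have E0 : 0 <= 1 + t by lra.
have u1 : SJ * (1 - 2 * t) <= SJ * GI by rewrite ler_wpM2l.
have u2 : SI * GJ * E <= 1 * GJ * (1 + t).
  apply: (@le_trans _ _ (SI * GJ * (1 + t))); first by rewrite ler_wpM2l ?mulr_ge0//; lra.
  by rewrite !ler_wpM2r.
have d1 : (1 - t) * GJ <= SI * GJ by rewrite ler_wpM2r.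
have d2 : SJ * GI * E <= SJ * 1 * (1 + t).
  apply: (@le_trans _ _ (SJ * GI * (1 + t))); first by rewrite ler_wpM2l ?mulr_ge0//; lra.
  by rewrite ler_wpM2r// ler_wpM2l.
have a1 : SJ * t <= t by rewrite ler_piMl// ltW.
have a2 : GJ * t <= t by rewrite ler_piMl// ltW.
by move: u1 u2 d1 d2 up down a1 a2; lra.
Qed.

(** Poisson probabilities and Gaussian cells are proportional on any window of
    fixed width up to a factor tending to one; both carry almost all their mass
    in a wide window, so the factor of proportionality is close to one, and
    sums over the points below [z] may be compared. *)
Lemma poisson_clt {R : realType} (z e : R) : 0 < e -> exists2 Lam : R, 0 < Lam &
  forall lam, Lam <= lam ->
  `|fine (Po lam [set m : nat | (m%:R - lam) / Num.sqrt lam <= z]) - normal_cdf z| <= e.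
Proof.
move=> e0; pose c := normal_peak (1 : R).
have c0 : 0 < c by apply: normal_peak_gt0; rewrite oner_eq0.
pose t := Num.min 4^-1 (e / (2 * c + 6)).
have t0 : 0 < t by rewrite /t lt_min divr_gt0 ?invr_gt0//; lra.
have t4 : t <= 4^-1 by rewrite /t ge_min lexx.
have te : t * (2 * c + 6) <= e.
  by rewrite -ler_pdivlMr; [rewrite /t ge_min lexx orbT | lra].
have [n [Fn Fn']] := normal_cdf_tails t0.
have ti0 : 0 < t^-1 by rewrite invr_gt0.
pose M : R := n%:R + 2 + `|z| + t^-1.
have z0 : 0 <= `|z| by []. have n0 : 0 <= n%:R :> R by [].
have M1 : 1 <= M by rewrite /M; lra.
have zM : `|z| + 1 <= M by rewrite /M; lra.
have nM : n%:R + 1 <= M by rewrite /M; lra.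
have tM : t^-1 <= M by rewrite /M; lra.
clearbody M.
have M2t : M ^- 2 <= t.
  rewrite -[leRHS]invrK lef_pV2 ?posrE ?exprn_gt0 ?invr_gt0//; last by lra.
  by apply: le_trans tM _; rewrite expr2 ler_peMr//; lra.
pose K3 : R := 4 * M ^+ 3 + 2 * (M + 1).
have K30 : 0 <= K3 by rewrite addr_ge0// ?mulr_ge0 ?exprn_ge0//; lra.
pose S := 2 * M + t^-1 + 2 * K3 / t.
have K3t : 0 <= 2 * K3 / t by rewrite divr_ge0 ?(ltW t0)//; lra.
have S0 : 0 < S by rewrite /S; lra.
exists (S ^+ 2) => [|lam Lam_le]; first by rewrite exprn_gt0.
have l0 : 0 < lam by apply: lt_le_trans Lam_le; rewrite exprn_gt0.
pose s := Num.sqrt lam.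
have Ss : S <= s by rewrite -(ger0_norm (ltW S0)) -sqrtr_sqr ler_wsqrtr.
have s0 : 0 < s by lra.
have ss : s * s = lam by rewrite -expr2 sqr_sqrtr// ltW.
have sM : 2 * M <= s by move: Ss; rewrite /S; lra.
have st : t^-1 <= s by move: Ss; rewrite /S; lra.
have sK : 2 * K3 / t <= s by move: Ss; rewrite /S; lra.
clear Ss Lam_le; clearbody S.
pose dl := s^-1; have d0 : 0 < dl by rewrite invr_gt0.
have dM : dl * M <= 2^-1 by rewrite mulrC ler_pdivrMr// mulrC; lra.
have dt : dl <= t by rewrite -[leRHS]invrK lef_pV2 ?posrE.
have dK : expR (dl * K3) <= 1 + t.
  apply: expR_le_1Dsmall; first by apply/andP; split; lra.
  rewrite mulr_ge0 ?(ltW d0)//= mulrC ler_pdivrMr//.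
  by move: sK; rewrite ler_pdivrMr// => h; lra.
have s1 : 1 <= s by lra.
clear S0 K3t sK ti0 tM st.
have M_s : M * s <= lam by rewrite -ss ler_pM2r//; lra.
have Ms0 : 0 <= lam - M * s by lra.
have Mp0 : 0 <= lam + M * s by rewrite addr_ge0 ?mulr_ge0//; lra.
have zs : - (M * s) + s <= z * s <= M * s.
  have -> : - (M * s) + s = (1 - M) * s by ring.
  have := zM; have := ler_norm z; have := ler_norm (- z); rewrite normrN => h1 h2 h3.
  by rewrite !(ler_pM2r s0); apply/andP; split; lra.
move: zs => /andP[zs1 zs2].
have z_ge0 : 0 <= lam + z * s by lra.
pose lo := (Num.truncn (lam - M * s)).+1.
pose hi := Num.truncn (lam + M * s).
pose jz := Num.truncn (lam + z * s).
have lo_gt : lam - M * s < lo%:R by exact: truncnS_gt.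
have lo_le : lo%:R <= lam - M * s + 1 by rewrite /lo -[_.+1]addn1 natrD lerD2r truncn_le.
have hi_le : hi%:R <= lam + M * s by rewrite truncn_le.
have hi_gt : lam + M * s < hi.+1%:R by exact: truncnS_gt.
have jz_le : jz%:R <= lam + z * s by rewrite truncn_le.
have jz_gt : lam + z * s < jz.+1%:R by exact: truncnS_gt.
have lojz : (lo <= jz)%N by rewrite truncn_ge_nat//; lra.
have jzhi : (jz <= hi)%N by rewrite truncn_ge_nat//; lra.
have lo_lt k : (k < lo)%N -> k%:R <= lam - M * s by rewrite /lo ltnS truncn_ge_nat.
have hi_lt k : (hi < k)%N -> lam + M * s < k%:R.
  by move=> hk; apply: lt_le_trans hi_gt _; rewrite ler_nat.
clearbody lo hi.
pose x := std_point lam.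
have xE k : x k = (k%:R - lam) / s by [].
have xle k (y : R) : k%:R <= lam + y * s -> x k <= y.
  by move=> h; rewrite xE ler_pdivrMr//; lra.
have xge k (y : R) : lam + y * s <= k%:R -> y <= x k.
  by move=> h; rewrite xE ler_pdivlMr//; lra.
have xin k : (lo <= k < hi.+1)%N -> `|x k| <= M.
  rewrite ltnS => /andP[lk kh]; rewrite ler_norml; apply/andP; split.
    apply: xge; apply: le_trans (_ : lo%:R <= _); last by rewrite ler_nat.
    by lra.
  by apply: xle; apply: le_trans hi_le; rewrite ler_nat.
have ds : dl * s = 1 by rewrite mulVf// gt_eqF.
have -> : [set m : nat | (m%:R - lam) / Num.sqrt lam <= z] = `I_jz.+1.
  apply/seteqP; split=> m /=.
    by rewrite ltnS truncn_ge_nat// ler_pdivrMr// -/s; lra.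
  by rewrite ltnS truncn_ge_nat// ler_pdivrMr// -/s; lra.
rewrite Po_prefix//.
have M0 : 0 < M by exact: lt_le_trans ltr01 M1.
have [cheb1 cheb2] := @poisson_chebyshev R lam l0 M lo hi M0
  (fun k kl => ltac:(have := lo_lt k kl; rewrite -/s; lra))
  (fun k kh => ltac:(have := hi_lt k kh; rewrite -/s; lra))
  (leq_trans lojz (leqW jzhi)).
pose p := poisson_pmf lam.
have p0 k : 0 <= p k by exact: poisson_pmf_ge0.
pose G := cell lam.
have G0 k : 0 <= G k.
  by rewrite subr_ge0 normal_cdf_le//; apply: std_point_le => //; exact: leqnSn.
have telG a b : (a <= b)%N -> \sum_(a <= k < b) G k = normal_cdf (x b) - normal_cdf (x a).
  by move=> ab; rewrite -(telescope_sumr (fun k => normal_cdf (x k)) ab).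
set SJ := \sum_(lo <= k < jz.+1) p k; set SI := \sum_(lo <= k < hi.+1) p k in cheb2.
set GJ := \sum_(lo <= k < jz.+1) G k; set GI := \sum_(lo <= k < hi.+1) G k.
have jin k : (lo <= k < jz.+1)%N -> (lo <= k < hi.+1)%N.
  by move=> /andP[-> kj] /=; apply: leq_trans kj _; rewrite ltnS.
have exch k l : (lo <= k < hi.+1)%N -> (lo <= l < hi.+1)%N ->
    p k * G l <= p l * G k * expR (dl * K3).
  by move=> /xin xk /xin xl; apply: (@pmf_cell_exchange R lam M l0 M1 dM).
have up : SJ * GI <= SI * GJ * expR (dl * K3).
  rewrite [SI * GJ]mulrC /SJ /GI /SI /GJ !big_distrlr/= mulr_suml.
  rewrite !big_nat; apply: ler_sum => k /jin kI; rewrite mulr_suml !big_nat.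
  by apply: ler_sum => l lI; rewrite [G k * p l]mulrC; exact: exch.
have down : SI * GJ <= SJ * GI * expR (dl * K3).
  rewrite [SI * GJ]mulrC /SJ /GI /SI /GJ !big_distrlr/= mulr_suml.
  rewrite !big_nat; apply: ler_sum => k /jin kI; rewrite mulr_suml !big_nat.
  by apply: ler_sum => l lI; rewrite [G k * p l]mulrC; exact: exch.
have SE : \sum_(i < jz.+1) p i = \sum_(i < lo) p i + SJ.
  by rewrite -!(big_mkord xpredT p) (@big_cat_nat _ _ _ lo 0 jz.+1)//=; exact: leqW.
have SI1 : SI <= 1.
  apply: le_trans ((poisson_pmf_series l0).1 hi.+1).
  rewrite -(big_mkord xpredT p) (@big_cat_nat _ _ _ lo 0 hi.+1)//=; last exact: leq_trans lojz (leqW jzhi).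
  by rewrite lerDr sumr_ge0.
have SJ0 : 0 <= SJ by apply: sumr_ge0.
have SJ1 : \sum_(i < jz.+1) p i <= 1 by exact: (poisson_pmf_series l0).1.
have plo0 : 0 <= \sum_(i < lo) p i by apply: sumr_ge0.
have xlo : x lo <= - n%:R.
  apply: xle; have : (n%:R + 1) * s <= M * s by rewrite ler_pM2r.
  by rewrite mulrDl mul1r; lra.
have xhi : n%:R <= x hi.+1.
  apply: xge; apply: le_trans (ltW hi_gt); rewrite lerD2l ler_pM2r//; lra.
have xjz1 : z <= x jz.+1 by apply: xge; exact: ltW.
have xjz2 : x jz.+1 <= z + dl.
  by apply: xle; rewrite mulrDl ds -[jz.+1]addn1 natrD; lra.
have Fjz : normal_cdf (x jz.+1) <= normal_cdf z + c * t.
  have := normal_cdf_lipschitz xjz1; rewrite -/c.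
  have : c * (x jz.+1 - z) <= c * t by rewrite ler_pM2l//; lra.
  by lra.
have Fjz' := normal_cdf_le xjz1.
have Flo := normal_cdf_le xlo; have Fhi := normal_cdf_le xhi.
have Flo0 := normal_cdf_ge0 (x lo); have Fhi1 := normal_cdf_le1 (x hi.+1).
have Fjz1 := normal_cdf_le1 (x jz.+1).
have GJE : GJ = normal_cdf (x jz.+1) - normal_cdf (x lo) by apply: telG; exact: leqW.
have GIE : GI = normal_cdf (x hi.+1) - normal_cdf (x lo).
  by apply: telG; apply: leq_trans lojz (leqW jzhi).
have GJ0 : 0 <= GJ by apply: sumr_ge0.
move: cheb1; rewrite -/p => cheb1; rewrite -/p -/SI in cheb2; rewrite SE in SJ1 *.
move: (normal_cdf (x lo)) (normal_cdf (x hi.+1)) (normal_cdf (x jz.+1)) (normal_cdf (- n%:R))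
  (normal_cdf n%:R) (normal_cdf z) (M ^- 2) (expR (dl * K3)) (\sum_(i < lo) p i)
  Fjz Fjz' Flo Fhi Flo0 Fhi1 Fjz1 GJE GIE Fn Fn' M2t dK up down SJ1 plo0 cheb1 cheb2.
clearbody SJ SI GJ GI c; clear - t0 t4 te c0 SJ0 SI1 GJ0.
move=> Flo Fhi Fj Fn' Fn Fz Mi E Plo Fjz Fjz' Flon Fhin Flo0 Fhi1 Fjz1 GJE GIE hFn hFn'.
move=> M2t dK up down SJ1 plo0 cheb1 cheb2.
have [r1 r2] : SJ <= GJ + 3 * t /\ GJ <= SJ + 2 * t.
  apply: (@ratio_transfer R t E SJ SI GJ GI) => //; apply/andP; split=> //; lra.
have tc : 0 <= t * c by rewrite mulr_ge0// ltW.
by rewrite ler_norml; apply/andP; split; lra.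
Qed.

(** * The limit theorems *)

Section Limits.
Context {R : realType} {d d' : measure_display}
  {S : measurableType d} {Q : probability S R} {xi : {RV Q >-> nat}}
  {Omega : measurableType d'} {P : probability Omega R}
  {X : word -> {RV P >-> nat}} {h : nat} {k : nat -> nat}.
Hypothesis mean_xi : ('E_Q[fun s => (xi s)%:R] = 1)%E.
Hypothesis var_xi : (0 < 'V_Q[fun s => ((xi s)%:R : R)] < +oo)%E.
Hypothesis iid_X : iid_copies xi X.
Hypothesis span_h : is_span xi h.
Hypothesis k_oo : k n @[n --> oo_1mod h] --> \oo.
Hypothesis k_littleo : (k n)%:R / n%:R @[n --> oo_1mod h] --> (0 : R).

#[local] Instance oo_1mod_filter : Filter (oo_1mod h) := within_filter _ _.

Lemma near_oo_1mod (N : nat) : \forall n \near oo_1mod h, (N <= n)%N /\ (h %| n.-1)%N.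
Proof.
exists N.+1 => //= n Nn n1; split; first exact: ltnW.
by rewrite -subn1 -eqn_mod_dvd; [apply/eqP | apply: leq_trans Nn].
Qed.

Lemma near_small_trees (K : nat) :
  \forall n \near oo_1mod h, (K <= k n)%N /\ (4 * k n < n)%N.
Proof.
have big : \forall n \near oo_1mod h, (K <= k n)%N.
  by move/cvgnyPge : k_oo; exact.
have small : \forall n \near oo_1mod h, `|0 - (k n)%:R / n%:R| <= (8^-1 : R).
  by move/cvgrPdist_le : k_littleo; apply; rewrite invr_gt0.
near=> n; split; first by near: n.
have n0 : (0 < n)%N by near: n; apply: filterS (near_oo_1mod 1) => n [].
have : `|0 - (k n)%:R / n%:R| <= (8^-1 : R) by near: n.
rewrite sub0r normrN ger0_norm ?divr_ge0// ler_pdivrMr ?ltr0n// => kn.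
have : (8 * (k n)%:R <= n%:R :> R) by lra.
rewrite -natrM ler_nat => kn8; clear - n0 kn8; lia.
Unshelve. all: by end_near.
Qed.

Lemma near_tv_uniform (e : R) : 0 < e -> \forall n \near oo_1mod h,
  forall T, tree_size T = k n ->
  exists2 r : set nat -> R, (forall A, fringe_count_law X n T A = (r A)%:E) &
    forall A, `|r A - fine (Po (n%:R * gw_pi X T) A)| <= e.
Proof.
move=> e0; have [N0 [K0 tv]] := tv_uniform mean_xi var_xi iid_X span_h e0.
near=> n => T Tk.
have [Nn hn] : (N0 <= n)%N /\ (h %| n.-1)%N by near: n; exact: near_oo_1mod.
have [Kn kn] : (K0 <= k n)%N /\ (4 * k n < n)%N by near: n; exact: near_small_trees.
by apply: tv; rewrite ?Tk.
Unshelve. all: by end_near.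
Qed.

Lemma dTV_ge0 {d0} {U : measurableType d0} (mu nu : set U -> \bar R) : (0 <= dTV mu nu)%E.
Proof.
apply: le_trans (_ : `|mu set0 - nu set0|%E <= _)%E; first exact: abse_ge0.
by apply: ereal_sup_ubound; exists set0.
Qed.

Lemma exists_tree_size m : (0 < m)%N -> exists T, tree_size T = m.
Proof.
case: m => // m _; elim: m => [|m [T TE]]; first by exists tree0.
by exists (Node [:: T]); rewrite /tree_size /= cats0; congr _.+1.
Qed.

Lemma sup_dTV_cvg0 : (forall n, (0 < k n)%N) ->
  ereal_sup [set dTV (fringe_count_law X n T) (Po (n%:R * gw_pi X T))
             | T in [set T | tree_size T = k n]] @[n --> oo_1mod h] --> 0%E.
Proof.
move=> k_gt0.
have near_le (e : R) : 0 < e -> \forall n \near oo_1mod h,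
    (0 <= ereal_sup [set dTV (fringe_count_law X n T) (Po (n%:R * gw_pi X T))
             | T in [set T | tree_size T = k n]] <= e%:E)%E.
  move=> e0; apply: filterS (near_tv_uniform e0) => n tv; apply/andP; split.
    have [T TE] := exists_tree_size (k_gt0 n).
    apply: le_trans (dTV_ge0 (fringe_count_law X n T) (Po (n%:R * gw_pi X T))) _.
    by apply: ereal_sup_ubound; exists T.
  apply: ge_ereal_sup => _ [T /tv[r rE rP] <-].
  apply: ge_ereal_sup => _ [A _ <-].
  by rewrite rE -[Po _ A]fineK ?fin_num_Po// -EFinB lee_fin.
apply/fine_cvgP; split.
  apply: filterS (near_le 1 ltr01) => n /andP[s0 s1].
  by rewrite fin_real// (lt_le_trans _ s0)//= (le_lt_trans s1)// ltry.
apply/cvgrPdist_le => e e0; apply: filterS (near_le e e0) => n /andP[s0 s1] /=.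
rewrite sub0r normrN ger0_norm ?fine_ge0// -lee_fin fineK//.
by rewrite fin_real// (lt_le_trans _ s0)//= (le_lt_trans s1)// ltry.
Qed.

Variable T : nat -> plane_tree.
Hypothesis size_T : forall n, tree_size (T n) = k n.
Local Notation lam := (fun n => n%:R * gw_pi X (T n)).

(** By the bound in total variation, limits of Poisson probabilities carry over to
    the fringe counts. *)
Lemma fringe_law_cvg (A : nat -> set nat) (l : R) :
  fine (Po (lam n) (A n)) @[n --> oo_1mod h] --> l ->
  fringe_count_law X n (T n) (A n) @[n --> oo_1mod h] --> l%:E.
Proof.
move=> /cvgrPdist_le Pol; apply/fine_cvgP; split.
  by apply: filterS (near_tv_uniform ltr01) => n /(_ _ (size_T n))[r rE _]; rewrite rE.
apply/cvgrPdist_le => e e0; have e20 : 0 < e / 2 by rewrite divr_gt0.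
near=> n; rewrite /=.
have [r rE rP] : exists2 r : set nat -> R,
    (forall A, fringe_count_law X n (T n) A = (r A)%:E) &
    forall A, `|r A - fine (Po (lam n) A)| <= e / 2.
  have := size_T n; move: (T n); near: n; exact: near_tv_uniform.
have : `|l - fine (Po (lam n) (A n))| <= e / 2 by near: n; exact: Pol.
have := rP (A n); rewrite rE /= => h1 h2.
rewrite (_ : l - r (A n) = (l - fine (Po (lam n) (A n))) - (r (A n) - fine (Po (lam n) (A n)))); last by ring.
apply: le_trans (ler_normB _ _) _; lra.
Unshelve. all: by end_near.
Qed.

Lemma lam_ge0 n : 0 <= lam n.
Proof.
by rewrite mulr_ge0// (gw_piE iid_X) weight_ge0// => a; exact: offspring_pmf_ge0.
Qed.

Lemma fringe_law_at0 : lam n @[n --> oo_1mod h] --> (0 : R) ->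
  fringe_count_law X n (T n) [set 0%N] @[n --> oo_1mod h] --> 1%E.
Proof.
move=> lam0; apply: (fringe_law_cvg (A := fun=> [set 0%N])).
apply: (@squeeze_cvgr _ _ _ _ (fun n => 1 - lam n) (fun=> 1)).
- near=> n; rewrite Po_set0_ge ?lam_ge0//=.
  by rewrite -lee_fin fineK ?fin_num_Po// -(Po_setT (lam n)) -[leLHS]fineK ?fin_num_Po// -[leRHS]fineK ?fin_num_Po// lee_fin le_Po.
- by rewrite -[X in _ --> X]subr0; apply: cvgB => //; exact: cvg_cst.
- exact: cvg_cst.
Unshelve. all: by end_near.
Qed.

Lemma poisson_pmf_cvg (mu : R) i : 0 < mu -> lam n @[n --> oo_1mod h] --> mu ->
  poisson_pmf (lam n) i @[n --> oo_1mod h] --> poisson_pmf mu i.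
Proof.
move=> mu0 lammu.
pose f (x : R) := x ^+ i / i`!%:R * expR (- x).
have fc : f (lam n) @[n --> oo_1mod h] --> f mu.
  apply: cvgM; last first.
    by exact: (cvg_comp _ _ (cvgN lammu) (@continuous_expR R (- mu))).
  by apply: cvgM; [exact: (cvg_comp _ _ lammu (@exprn_continuous R i mu)) | exact: cvg_cst].
rewrite poisson_pmfE//; apply: cvg_trans fc; apply: near_eq_cvg.
have : \forall n \near oo_1mod h, 0 < lam n by exact: (cvgr_gt _ lammu).
by apply: filterS => n l0; rewrite poisson_pmfE.
Qed.

Lemma fringe_law_poisson (mu : R) : 0 < mu -> lam n @[n --> oo_1mod h] --> mu ->
  cvg_in_law (oo_1mod h)
    (fun n => pushforward (fringe_count_law X n (T n)) (fun m : nat => m%:R : R))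
    (pushforward (Po mu) (fun m : nat => m%:R : R)).
Proof.
move=> mu0 lammu x _; rewrite /pushforward.
have pre : exists K, (fun m : nat => m%:R : R) @^-1` `]-oo, x]%classic = `I_K.
  case: (leP 0 x) => x0.
    exists (Num.truncn x).+1; apply/seteqP; split=> m /=; rewrite in_itv/= ltnS truncn_ge_nat//.
  exists 0%N; apply/seteqP; split=> m //=; rewrite in_itv/= => mx.
  by have := le_lt_trans mx x0; rewrite ltNge ler0n.
case: pre => K ->.
rewrite -[Po mu _]fineK ?fin_num_Po//; apply: (fringe_law_cvg (A := fun=> `I_K)).
rewrite Po_prefix//.
have sumc : \sum_(i < K) poisson_pmf (lam n) i @[n --> oo_1mod h] --> \sum_(i < K) poisson_pmf mu i.
  elim: K => [|K IH]; first by under eq_fun do rewrite big_ord0; rewrite big_ord0; exact: cvg_cst.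
  under eq_fun do rewrite big_ord_recr; rewrite big_ord_recr; apply: cvgD => //.
  exact: poisson_pmf_cvg.
apply: cvg_trans sumc; apply: near_eq_cvg.
have : \forall n \near oo_1mod h, 0 < lam n by exact: (cvgr_gt _ lammu).
by apply: filterS => n l0; rewrite Po_prefix.
Qed.

Lemma fringe_law_normal : lam n @[n --> oo_1mod h] --> +oo ->
  cvg_in_law (oo_1mod h)
    (fun n => pushforward (fringe_count_law X n (T n))
                (fun m : nat => (m%:R - lam n) / Num.sqrt (lam n) : R))
    (normal_prob 0 1).
Proof.
move=> lamoo x _; rewrite /pushforward.
rewrite -[normal_prob 0 1 _]fineK ?fin_num_normal//.
apply: fringe_law_cvg; apply/cvgrPdist_le => e e0.
have [Lam _ clt] := poisson_clt x e0.
have : \forall n \near oo_1mod h, Lam <= lam n by move/cvgryPge : lamoo; exact.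
apply: filterS => n /clt; rewrite distrC; apply: le_trans.
by rewrite (_ : _ @^-1` _ = [set m : nat | (m%:R - lam n) / Num.sqrt (lam n) <= x])//;
  apply/seteqP; split=> m; rewrite /= in_itv.
Qed.

End Limits.

Theorem theorem2 (R : realType) (d d' : measure_display)
    (S : measurableType d) (Q : probability S R) (xi : {RV Q >-> nat})
    (Omega : measurableType d') (P : probability Omega R)
    (X : word -> {RV P >-> nat}) (h : nat) (k : nat -> nat)
    (mean_xi : ('E_Q[fun s => (xi s)%:R] = 1)%E)
    (var_xi : (0 < 'V_Q[fun s => ((xi s)%:R : R)] < +oo)%E)
    (iid_X : iid_copies xi X)
    (span_h : is_span xi h)
    (k_gt0 : forall n, (0 < k n)%N)
    (k_oo : k n @[n --> oo_1mod h] --> \oo)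
    (k_littleo : (k n)%:R / n%:R @[n --> oo_1mod h] --> (0 : R)) :
  (ereal_sup [set dTV (fringe_count_law X n T) (Po (n%:R * gw_pi X T))
             | T in [set T | tree_size T = k n]]
     @[n --> oo_1mod h] --> 0%E) /\
  (forall T : nat -> plane_tree, (forall n, tree_size (T n) = k n) ->
    [/\ n%:R * gw_pi X (T n) @[n --> oo_1mod h] --> (0 : R) ->
          fringe_count_law X n (T n) [set 0%N] @[n --> oo_1mod h] --> 1%E,
        forall mu : R, 0 < mu ->
          n%:R * gw_pi X (T n) @[n --> oo_1mod h] --> mu ->
          cvg_in_law (oo_1mod h)
            (fun n => pushforward (fringe_count_law X n (T n))
                        (fun m : nat => m%:R : R))
            (pushforward (Po mu) (fun m : nat => m%:R : R)) &
        n%:R * gw_pi X (T n) @[n --> oo_1mod h] --> +oo ->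
          cvg_in_law (oo_1mod h)
            (fun n => pushforward (fringe_count_law X n (T n))
                        (fun m : nat => (m%:R - n%:R * gw_pi X (T n)) /
                                        Num.sqrt (n%:R * gw_pi X (T n)) : R))
            (normal_prob 0 1)]).
Proof.
split; first exact: (sup_dTV_cvg0 mean_xi var_xi iid_X span_h).
move=> T size_T; split.
- exact: (fringe_law_at0 mean_xi var_xi iid_X span_h k_oo k_littleo size_T).
- by move=> mu; exact: (fringe_law_poisson mean_xi var_xi iid_X span_h k_oo k_littleo size_T).
- exact: (fringe_law_normal mean_xi var_xi iid_X span_h k_oo k_littleo size_T).
Qed.
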